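(* Let $(A,\mathfrak{m},k)$ be a complete, equicharacteristic local domain of dimension $d>0$ whose residue field $k=A/\mathfrak{m}$ is algebraically closed. Then for any prime number $p>0$ there exists a regular subring $R = k[[X_1,\dots,X_d]]$ of $A$ (i.e. a subring of $A$ isomorphic to a power series ring in $d$ variables over $k$) such that the inclusion $R \to A$ is finite and $p$ is relatively prime to the generic degree $[K(A):K(R)]$.
   Context: Local rings are Noetherian, and ''complete'' means complete with respect to the maximal ideal. Equicharacteristic means that $A$ and its residue field $k$ have the same characteristic. For a domain $D$, $K(D)$ denotes its fraction field. *)

(* Defs.v *)
From HB Require Import structures.
From mathcomp Require Import all_boot all_order all_algebra.
From mathcomp Require Import ring_quotient fraction.
From mathcomp Require Import mpoly.
From mathcomp Require Import boolp.
Set Implicit Arguments.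
Unset Strict Implicit.
Unset Printing Implicit Defensive.
Import GRing.Theory.
Local Open Scope ring_scope.

(* The power series ring k[[X_1, ..., X_d]]: families of coefficients indexed
   by monomials, with the Cauchy product.  A record rather than a bare function
   type, so as not to inherit the pointwise ring structure on functions. *)
Record mfps (k : Type) (d : nat) := Mfps { mfps_coef : 'X_{1..d} -> k }.

HB.instance Definition _ (k : Type) d := gen_eqMixin (mfps k d).
HB.instance Definition _ (k : Type) d := gen_choiceMixin (mfps k d).

Section PowerSeriesRing.
Variables (k : comNzRingType) (d : nat).
Implicit Types (f g h : mfps k d) (m : 'X_{1..d}).

Lemma mfpsP f g : mfps_coef f =1 mfps_coef g -> f = g.
Proof. by case: f g => [f] [g] /= /funext->. Qed.

Definition mfps_zero : mfps k d := Mfps (fun=> 0).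
Definition mfps_one : mfps k d := Mfps (fun m => (m == 0%MM)%:R).
Definition mfps_opp f : mfps k d := Mfps (fun m => - mfps_coef f m).
Definition mfps_add f g : mfps k d :=
  Mfps (fun m => mfps_coef f m + mfps_coef g m).

(* The bound (mdeg m).+1 only makes the index type finite: h.1 + h.2 = m
   already forces both degrees to be at most mdeg m. *)
Definition mfps_mul f g : mfps k d :=
  Mfps (fun m =>
    \sum_(h : 'X_{1..d < (mdeg m).+1, (mdeg m).+1} | m == (h.1 + h.2)%MM)
      mfps_coef f h.1 * mfps_coef g h.2).

Lemma mfps_addA : associative mfps_add.
Proof. by move=> f g h; apply: mfpsP => m /=; rewrite addrA. Qed.

Lemma mfps_addC : commutative mfps_add.
Proof. by move=> f g; apply: mfpsP => m /=; rewrite addrC. Qed.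

Lemma mfps_add0 : left_id mfps_zero mfps_add.
Proof. by move=> f; apply: mfpsP => m /=; rewrite add0r. Qed.

Lemma mfps_addN : left_inverse mfps_zero mfps_opp mfps_add.
Proof. by move=> f; apply: mfpsP => m /=; rewrite addNr. Qed.

HB.instance Definition _ :=
  GRing.isZmodule.Build (mfps k d) mfps_addA mfps_addC mfps_add0 mfps_addN.

Let trunc n f : {mpoly k[d]} :=
  \sum_(m : 'X_{1..d < n}) mfps_coef f m *: 'X_[m].

Let truncE n f m : (mdeg m < n)%N -> (trunc n f)@_m = mfps_coef f m.
Proof. exact: mcoeff_mpoly. Qed.

Let coef_mul f g m (p q : {mpoly k[d]}) :
    (forall a, (mdeg a <= mdeg m)%N -> p@_a = mfps_coef f a) ->
    (forall a, (mdeg a <= mdeg m)%N -> q@_a = mfps_coef g a) ->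
  mfps_coef (mfps_mul f g) m = (p * q)@_m.
Proof.
move=> pf qg; rewrite mcoeffM /=; apply: eq_bigr => -[[a /= la] [b /= lb]] _.
by rewrite pf ?qg.
Qed.

Let coef_trunc n f m a :
  (mdeg m < n)%N -> (mdeg a <= mdeg m)%N -> (trunc n f)@_a = mfps_coef f a.
Proof. by move=> mn hm; rewrite truncE // (leq_ltn_trans hm). Qed.

Let coef_mul_trunc n f g m : (mdeg m < n)%N ->
  (trunc n f * trunc n g)@_m = mfps_coef (mfps_mul f g) m.
Proof. by move=> mn; symmetry; apply: coef_mul => h; apply: coef_trunc. Qed.

Lemma mfps_mulA : associative mfps_mul.
Proof.
move=> f g h; apply: mfpsP => m; pose n := (mdeg m).+1.
have tr u a : (mdeg a <= mdeg m)%N -> (trunc n u)@_a = mfps_coef u a.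
  exact: coef_trunc.
have trM u v a : (mdeg a <= mdeg m)%N ->
    (trunc n u * trunc n v)@_a = mfps_coef (mfps_mul u v) a.
  by move=> am; apply: coef_mul_trunc.
rewrite (coef_mul (tr f) (trM g h)) mulrA.
by rewrite -(coef_mul (trM f g) (tr h)).
Qed.

Lemma mfps_mulC : commutative mfps_mul.
Proof.
move=> f g; apply: mfpsP => m; have mn := ltnSn (mdeg m).
by rewrite -!(coef_mul_trunc _ _ mn) mulrC.
Qed.

Lemma mfps_mul1 : left_id mfps_one mfps_mul.
Proof.
move=> f; apply: mfpsP => m.
rewrite (coef_mul (p := 1) (q := trunc (mdeg m).+1 f)) ?mul1r ?truncE //.
  by move=> h _; rewrite mcoeff1.
by move=> h hm; rewrite truncE.
Qed.

Lemma mfps_mulDl : left_distributive mfps_mul mfps_add.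
Proof.
move=> f g h; apply: mfpsP => m /=.
by rewrite -big_split; apply: eq_bigr => a _; rewrite mulrDl.
Qed.

Lemma mfps_one_neq0 : mfps_one != 0.
Proof.
apply/eqP => /(congr1 (fun f => mfps_coef f 0%MM)) /=.
by rewrite eqxx => /eqP; rewrite oner_eq0.
Qed.

HB.instance Definition _ := GRing.Zmodule_isComNzRing.Build (mfps k d)
  mfps_mulA mfps_mulC mfps_mul1 mfps_mulDl mfps_one_neq0.

End PowerSeriesRing.

Section LinearCombinations.
Variable V : comNzRingType.
Implicit Types (S I : {pred V}) (s : seq V).

Definition spanned_by S s (x : V) : Prop :=
  exists2 c : 'I_(size s) -> V,
    forall i, c i \in S & x = \sum_(i < size s) c i * s`_i.

Definition lin_indep_over S s : Prop :=
  forall c : 'I_(size s) -> V, (forall i, c i \in S) ->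
    \sum_(i < size s) c i * s`_i = 0 -> forall i, c i = 0.

Definition finite_over S : Prop := exists s, forall x, spanned_by S s x.

(* Meaningful when S is a subfield of V. *)
Definition has_degree_over S (n : nat) : Prop :=
  exists s, [/\ size s = n, forall x, spanned_by S s x & lin_indep_over S s].

End LinearCombinations.

Section LocalRings.
Variable A : comNzRingType.
Implicit Types (I J m : {pred A}) (n : nat).

(* idealr_closed is about proper ideals; the unit ideal is generated by 1. *)
Definition noetherian_ring : Prop :=
  forall I, idealr_closed I ->
    exists s : seq A, forall x, x \in I <-> spanned_by predT s x.

Definition prime_ideal I : Prop := idealr_closed I /\ prime_idealr_closed I.

Definition maximal_ideal I : Prop :=
  idealr_closed I /\
  forall J, idealr_closed J -> {subset I <= J} -> {subset J <= I}.

Definition local_ring_with m : Prop :=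
  maximal_ideal m /\ forall J, maximal_ideal J -> J =i m.

(* Strictly increasing chains c 0 < ... < c n of prime ideals. *)
Definition prime_chain n (c : nat -> {pred A}) : Prop :=
  (forall i, (i <= n)%N -> prime_ideal (c i)) /\
  (forall i, (i < n)%N ->
     {subset c i <= c i.+1} /\ ~ {subset c i.+1 <= c i}).

Definition has_krull_dim n : Prop :=
  (exists c, prime_chain n c) /\
  (forall l c, prime_chain l c -> (l <= n)%N).

Definition ideal_mul I J : {pred A} :=
  [pred x | `[< exists2 s : seq (A * A),
      forall uv, uv \in s -> uv.1 \in I /\ uv.2 \in J
      & x = \sum_(uv <- s) uv.1 * uv.2 >]].

Fixpoint ideal_exp I n : {pred A} :=
  if n is n'.+1 then ideal_mul I (ideal_exp I n') else predT.

(* The canonical map from A to the inverse limit of the A / m^n is bijective: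
   a coherent sequence of residue classes is given by representatives a n. *)
Definition adic_complete m : Prop :=
  forall a : nat -> A,
    (forall n, a n.+1 - a n \in ideal_exp m n) ->
    exists! l : A, forall n, a n - l \in ideal_exp m n.

(* k, with the map pi, is the quotient A / m. *)
Definition is_residue_field m (k : fieldType) (pi : {rmorphism A -> k}) : Prop :=
  (forall y, exists x, pi x = y) /\ (forall x, x \in m <-> pi x = 0).

End LocalRings.

Definition equicharacteristic (A k : nzRingType) : Prop :=
  [pchar A] =i [pchar k].

(* R is a subring of A isomorphic to k[[X_1, ..., X_d]], the isomorphism being
   given as an injective morphism to A with image R. *)
Definition power_series_subring (A k : comNzRingType) (d : nat)
    (R : {pred A}) : Prop :=
  GRing.subring_closed R /\
  exists phi : {rmorphism mfps k d -> A},
    injective phi /\ (forall x, x \in R <-> exists f, phi f = x).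

(* K(R), as a subfield of K(A), for R a subring of the domain A. *)
Definition subring_frac (A : idomainType) (R : {pred A}) :
    {pred {fraction A}} :=
  [pred z | `[< exists a b : A,
      [/\ a \in R, b \in R, b != 0 & z = tofrac a / tofrac b] >]].

(* Main.v *)
(* Choose parameters [y] of [A] over which the fraction field is separable, generated by some
   [z] with minimal polynomial [f] over R = k[[y]], and change coordinates so that [f] stays
   separable over O = k[[t]], [t] the last parameter, when the other parameters vanish.  As [k]
   is algebraically closed, an extension of Frac(O) generated by a root of an irreducible factor
   of [f] is totally ramified, so its norm takes every valuation; by the Chinese remainder
   theorem some [h], polynomial in [z], has over O a norm of valuation D > 0 prime to [p].
   The characteristic polynomial chi of [h] over R (with [h] perturbed so as to generate the
   fraction field) is distinguished in [h] and regular of order [D] in [t].  Hence A is finite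
   over the power series ring in [h] and the parameters other than [t], with generic degree
   [D] and generic basis 1, t, ..., t^(D-1). *)
Require Import Defs.
From HB Require Import structures.
From mathcomp Require Import all_boot all_order all_algebra fraction.
From mathcomp Require Import separable generic_quotient mpoly boolp ring zify.
From mathcomp Require classical_sets.
Set Implicit Arguments.
Unset Strict Implicit.
Unset Printing Implicit Defensive.
Import GRing.Theory.
Local Open Scope ring_scope.

Arguments mfps_coef {k d} m _ : simpl never.

(** * Power series and evaluation in complete rings *)

(** The generic degree of a Noether normalisation is hard to prescribe, but it can be read as an
    order of vanishing. The relation chi between [h] and the parameters is Weierstrass regular in
    two directions: its order in [h] gives back the old degree, its order in t is the degree over
    the new parameters, and this order is the valuation of the norm of [h] on the t-axis. [A] itself
    need not be a hypersurface; only its fraction field is generated by [h], so degrees are computed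
    with fractions. On the t-axis [f] may become reducible; a combination of [f] and its derivative
    equal to an element of the base ring that survives there keeps each irreducible factor prime to
    its cofactor, so one factor can be treated alone. Multiplying an element of norm valuation 1 by
    t^M, with p dividing M, gives D = M (N + 1) + 1. Integral closures over k[[t]] are never formed:
    elements of integral norm, shown to be closed under sums, take their place. Finally, no
    embedding of [k] in [A] is given; a coefficient field is constructed first, in a way that
    depends on the characteristic. *)

Lemma mfps_coefE (k : Type) d (u : 'X_{1..d} -> k) m : mfps_coef (Mfps u) m = u m.
Proof. by []. Qed.

Section PowerSeriesCoefficients.
Variables (k : comNzRingType) (n : nat).
Implicit Types (f g : mfps k n) (m a b : 'X_{1..n}).

Lemma mfps_coefM f g m : mfps_coef (f * g) m =
  \sum_(h : 'X_{1..n < (mdeg m).+1, (mdeg m).+1} | m == (h.1 + h.2)%MM)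
      mfps_coef f h.1 * mfps_coef g h.2.
Proof. by []. Qed.

Lemma mfps_coefD f g m : mfps_coef (f + g) m = mfps_coef f m + mfps_coef g m.
Proof. by []. Qed.

Lemma mfps_coefN f m : mfps_coef (- f) m = - mfps_coef f m.
Proof. by []. Qed.

Lemma mfps_coefB f g m : mfps_coef (f - g) m = mfps_coef f m - mfps_coef g m.
Proof. by []. Qed.

Lemma mfps_coef0 m : mfps_coef (0 : mfps k n) m = 0.
Proof. by []. Qed.

Lemma mfps_coef1 m : mfps_coef (1 : mfps k n) m = (m == 0%MM)%:R.
Proof. by []. Qed.

Lemma mfps_coef_sum (I : Type) (r : seq I) (P : pred I) (F : I -> mfps k n) m :
  mfps_coef (\sum_(i <- r | P i) F i) m = \sum_(i <- r | P i) mfps_coef (F i) m.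
Proof. by elim/big_rec2: _ => // i y1 y2 _ <-. Qed.

Lemma mfps_coefM_eq0 f g m :
  (forall a b, (a + b)%MM = m -> mfps_coef f a * mfps_coef g b = 0) ->
  mfps_coef (f * g) m = 0.
Proof. by move=> H; rewrite mfps_coefM big1 // => h /eqP e; rewrite H. Qed.

Lemma mfps_coefM_unique f g a b :
  (forall a' b', (a' + b')%MM = (a + b)%MM ->
     mfps_coef f a' * mfps_coef g b' <> 0 -> a' = a /\ b' = b) ->
  mfps_coef (f * g) (a + b)%MM = mfps_coef f a * mfps_coef g b.
Proof.
move=> H; rewrite mfps_coefM.
have la : (mdeg a < (mdeg (a + b)%MM).+1)%N by rewrite mdegD ltnS leq_addr.
have lb : (mdeg b < (mdeg (a + b)%MM).+1)%N by rewrite mdegD ltnS leq_addl.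
rewrite (bigD1 (BMultinom la, BMultinom lb)) //= big1 ?addr0 // => h /andP[/eqP e ne].
apply/eqP/negP => /negP/eqP nz.
have [e1 e2] := H h.1 h.2 (esym e) nz.
by case/eqP: ne; case: h e1 e2 {e nz} => h1 h2 /= e1 e2; congr pair; exact: val_inj.
Qed.

Definition mtr M f : {mpoly k[n]} :=
  \sum_(m : 'X_{1..n < M}) mfps_coef f m *: 'X_[m].

(** Any polynomial that is right below degree [M] is accepted, not just the truncation [mtr M f]:
    truncations are not closed under products, whereas this relation is. *)
Definition agree M (p : {mpoly k[n]}) f :=
  forall m, (mdeg m < M)%N -> p@_m = mfps_coef f m.

Lemma mtr_agree M f : agree M (mtr M f) f.
Proof. by move=> m hm; exact: mcoeff_mpoly. Qed.

Lemma mtr_coef_ge M f m : (M <= mdeg m)%N -> (mtr M f)@_m = 0.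
Proof.
move=> hm; rewrite /mtr raddf_sum big1 //= => -[b /= lb] _.
rewrite linearZ /= mcoeffX; case: eqP => [e|_]; last by rewrite mulr0.
by move: lb; rewrite e ltnNge hm.
Qed.

Lemma agreeD M p q f g : agree M p f -> agree M q g -> agree M (p + q) (f + g).
Proof. by move=> Hp Hq m hm; rewrite mcoeffD Hp ?Hq. Qed.

Lemma agreeM M p q f g : agree M p f -> agree M q g -> agree M (p * q) (f * g).
Proof.
move=> Hp Hq m hm; rewrite mcoeffM mfps_coefM.
by apply: eq_bigr => -[[a /= la] [b /= lb]] _; rewrite Hp ?Hq // (leq_trans _ hm).
Qed.

Lemma agree1 M : agree M 1 1.
Proof. by move=> m _; rewrite mcoeff1. Qed.

Lemma agree_inj f g : (forall M p, agree M p f -> agree M p g) -> f = g.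
Proof.
move=> H; apply: mfpsP => m; have mS := ltnSn (mdeg m).
by rewrite -(H _ _ (mtr_agree f) m mS) mtr_agree.
Qed.

Definition mfpsC (c : k) : mfps k n := Mfps (fun m => c * (m == 0%MM)%:R).
Definition mfpsXm a : mfps k n := Mfps (fun m => (m == a)%:R).
Definition mfpsX i : mfps k n := mfpsXm U_(i).

Lemma mfps_coefXm a m : mfps_coef (mfpsXm a) m = (m == a)%:R.
Proof. by []. Qed.

Lemma agreeC M c : agree M c%:MP (mfpsC c).
Proof. by move=> m _; rewrite mcoeffC. Qed.

Lemma agreeXm M a : agree M 'X_[a] (mfpsXm a).
Proof. by move=> m _; rewrite mcoeffX eq_sym. Qed.

Lemma mfpsC_is_zmod : zmod_morphism mfpsC.
Proof. by move=> c d; apply: mfpsP => m; rewrite mfps_coefB /mfpsC !mfps_coefE mulrBl. Qed.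

Lemma mfpsC_is_monoid : monoid_morphism mfpsC.
Proof.
split; first by apply: mfpsP => m; rewrite /mfpsC mfps_coefE mul1r.
move=> c d; apply: agree_inj => M p H.
have E : agree M (c * d)%:MP (mfpsC (c * d)) by exact: agreeC.
move=> m hm; rewrite H // -E //.
rewrite mpolyCM; exact: (agreeM (@agreeC M c) (@agreeC M d)).
Qed.

HB.instance Definition _ :=
  GRing.isZmodMorphism.Build k (mfps k n) mfpsC mfpsC_is_zmod.
HB.instance Definition _ :=
  GRing.isMonoidMorphism.Build k (mfps k n) mfpsC mfpsC_is_monoid.

Lemma mfps_coefC c m : mfps_coef (mfpsC c) m = c * (m == 0%MM)%:R.
Proof. by []. Qed.

Lemma mfps_coefCM c f m : mfps_coef (mfpsC c * f) m = c * mfps_coef f m.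
Proof.
rewrite -{1}[m]add0m mfps_coefM_unique; first by rewrite mfps_coefC eqxx mulr1.
move=> a b e; rewrite mfps_coefC.
case: (eqVneq a 0%MM) => [a0 _|_]; last by rewrite mulr0 mul0r.
by move: e; rewrite a0 !add0m.
Qed.

Lemma mfps_coefXMl a f b : mfps_coef (mfpsXm a * f) (a + b)%MM = mfps_coef f b.
Proof.
rewrite mfps_coefM_unique; first by rewrite mfps_coefXm eqxx mul1r.
move=> a' b' e; rewrite mfps_coefXm.
case: (eqVneq a' a) => [ea _|_]; last by rewrite mul0r.
by rewrite ea; split=> //; move: e; rewrite ea => /addmI.
Qed.

Lemma mfps_coefXM_eq0 a f m : ~~ (a <= m)%MM -> mfps_coef (mfpsXm a * f) m = 0.
Proof.
move=> nam; apply: mfps_coefM_eq0 => a' b' e; rewrite mfps_coefXm.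
case: (eqVneq a' a) => [ea|_]; last by rewrite mul0r.
by case/negP: nam; rewrite -e ea lem_addr.
Qed.

Lemma mfpsXmM a b : mfpsXm a * mfpsXm b = mfpsXm (a + b)%MM.
Proof.
apply: mfpsP => m; have [le|nle] := boolP (a <= m)%MM.
  have e : m = (a + (m - a))%MM by rewrite addmC submK.
  rewrite {1}e mfps_coefXMl !mfps_coefXm {2}e; congr (_ %:R); congr nat_of_bool.
  by apply/eqP/eqP => [->//|/addmI].
rewrite mfps_coefXM_eq0 // mfps_coefXm; case: eqP => // e; case/negP: nle.
by rewrite e lem_addr.
Qed.

Lemma mfpsXn i e : mfpsX i ^+ e = mfpsXm (U_(i) *+ e)%MM.
Proof.
elim: e => [|e IH]; first by rewrite expr0 mulm0n.
by rewrite exprS IH mfpsXmM mulmS.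
Qed.

Lemma mfpsXmE a : mfpsXm a = \prod_(i < n) mfpsX i ^+ a i.
Proof.
rewrite (eq_bigr (fun i => mfpsXm (U_(i) *+ a i)%MM)); last by move=> i _; exact: mfpsXn.
have big_X (I : Type) (r : seq I) (F : I -> 'X_{1..n}) :
   \prod_(i <- r) mfpsXm (F i) = mfpsXm (\sum_(i <- r) F i)%MM.
  by elim/big_rec2: _ => // i x y _ ->; rewrite mfpsXmM.
rewrite big_X; congr mfpsXm; exact: multinomUE_id.
Qed.

Lemma mmap1_mfpsX a : mmap1 mfpsX a = mfpsXm a.
Proof. by rewrite mfpsXmE. Qed.

Definition mord M f := forall m, (mdeg m < M)%N -> mfps_coef f m = 0.

End PowerSeriesCoefficients.

(** One notion for the m-adic filtration of a complete local ring and for the order filtration of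
    power series, so that substitution into a series is defined once for both. *)
Record cfilt (A : comNzRingType) := CFilt {
  fil :> nat -> A -> Prop;
  fil_0 : forall x, fil 0 x;
  filD : forall n x y, fil n x -> fil n y -> fil n (x + y);
  filM : forall i j x y, fil i x -> fil j y -> fil (i + j) (x * y);
  fil0 : forall n, fil n 0;
  filS : forall n x, fil n.+1 x -> fil n x;
  fil_sep : forall x, (forall n, fil n x) -> x = 0;
  fil_complete : forall a : nat -> A, (forall n, fil n (a n.+1 - a n)) ->
    exists l, forall n, fil n (a n - l) }.

Section FilteredRing.
Variables (A : comNzRingType) (F : cfilt A).
Implicit Types (x y : A) (i j n : nat).

Lemma filMr n x y : F n x -> F n (x * y).
Proof. by move=> h; rewrite -[n]addn0; apply: filM => //; apply: fil_0. Qed.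

Lemma filMl n x y : F n y -> F n (x * y).
Proof. by move=> h; rewrite mulrC; apply: filMr. Qed.

Lemma filN n x : F n x -> F n (- x).
Proof. by move=> h; rewrite -mulN1r; apply: filMl. Qed.

Lemma filB n x y : F n x -> F n y -> F n (x - y).
Proof. by move=> h1 h2; apply: filD => //; apply: filN. Qed.

Lemma filW i j x : (i <= j)%N -> F j x -> F i x.
Proof.
move=> /subnK <-; elim: (j - i)%N => // d IH; rewrite addSn => /(@filS _ F).
exact: IH.
Qed.

Lemma fil_sum n (I : Type) (r : seq I) (P : pred I) (G : I -> A) :
  (forall t, P t -> F n (G t)) -> F n (\sum_(t <- r | P t) G t).
Proof. by move=> H; elim/big_ind: _ => //; [exact: fil0 | exact: filD]. Qed.

Lemma filX n x : F 1 x -> F n (x ^+ n).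
Proof.
move=> h; elim: n => [|n IH]; first exact: fil_0.
by rewrite exprS -add1n; apply: filM.
Qed.

Lemma fil_sep_eq x y : (forall n, F n (x - y)) -> x = y.
Proof. by move=> H; apply/eqP; rewrite -subr_eq0; apply/eqP/(fil_sep H). Qed.

(** The inverse is the limit of the partial sums of the geometric series. *)
Lemma fil1_unit x : F 1 x -> exists y, (1 - x) * y = 1.
Proof.
move=> hx; pose a n := \sum_(i < n) x ^+ i.
have [n|l hl] := @fil_complete _ F a.
  by rewrite /a big_ord_recr /= addrAC subrr add0r; apply: filX.
exists l; apply: fil_sep_eq => n.
have -> : (1 - x) * l - 1 = - ((1 - x) * (a n - l)) - x ^+ n.
  have := subrX1 x n; rewrite -/(a n) => e.
  have e2 : (1 - x) * a n = 1 - x ^+ n by rewrite -opprB mulNr -e opprB.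
  by rewrite mulrBr e2 opprB; ring.
by apply: filB; [apply/filN/filMl | apply: filX].
Qed.

End FilteredRing.

Section OrderFiltration.
Variables (k : comNzRingType) (n : nat).

Lemma mord_complete (a : nat -> mfps k n) :
  (forall i, mord i (a i.+1 - a i)) -> exists l, forall i, mord i (a i - l).
Proof.
move=> H; exists (Mfps (fun m => mfps_coef (a (mdeg m).+1) m)) => i m hm.
rewrite mfps_coefB /=; rewrite -(subnK hm).
elim: (i - _)%N => [|j IH]; first by rewrite add0n subrr.
have := H (j + (mdeg m).+1)%N m; rewrite -addSn mfps_coefB => /(_ (leq_addl _ _)) /eqP.
by rewrite subr_eq0 => /eqP ->.
Qed.

Definition mfps_filt : cfilt (mfps k n).
Proof.
apply: (@CFilt _ (@mord k n)).
- by [].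
- by move=> i f g Hf Hg m hm; rewrite mfps_coefD Hf ?Hg ?addr0.
- move=> i j f g Hf Hg m hm; apply: mfps_coefM_eq0 => a b e.
  have [la|la] := ltnP (mdeg a) i; first by rewrite Hf ?mul0r.
  rewrite Hg ?mulr0 //; move: hm; rewrite -e mdegD => hm.
  by rewrite -(ltn_add2l i); apply: leq_ltn_trans hm; rewrite leq_add2r.
- by move=> i m.
- by move=> i f H m hm; apply: H; apply: ltnW.
- by move=> f H; apply: mfpsP => m; apply: (H (mdeg m).+1).
- exact: mord_complete.
Defined.

Lemma mfpsX_fil i : mfps_filt 1 (mfpsX k i).
Proof.
move=> m; rewrite ltnS leqn0 mdeg_eq0 => /eqP -> /=.
by rewrite mfps_coefXm eq_sym mnm1_eq0.
Qed.

Lemma mord1P (f : mfps k n) : mfps_coef f 0%MM = 0 -> mfps_filt 1 f.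
Proof. by move=> h m; rewrite ltnS leqn0 mdeg_eq0 => /eqP ->. Qed.

End OrderFiltration.
Arguments mfps_filt {k n}.

Section Evaluation.
Variables (A : comNzRingType) (F : cfilt A) (K : comNzRingType).
Variables (io : {rmorphism K -> A}) (n : nat) (y : 'I_n -> A).
Hypothesis hy : forall i, F 1 (y i).

Lemma mmap1_fil (m : 'X_{1..n}) : F (mdeg m) (mmap1 y m).
Proof.
rewrite mdegE /mmap1; elim/big_rec2: _ => [|i a e _ h]; first exact: fil_0.
by apply: filM h; apply: filX.
Qed.

Lemma mmap_fil M (p : {mpoly K[n]}) :
  (forall m, (mdeg m < M)%N -> p@_m = 0) -> F M (mmap io y p).
Proof.
move=> H; rewrite /mmap; apply: fil_sum => m _.
have [lt|le] := ltnP (mdeg m) M; first by rewrite H // rmorph0 mul0r; apply: fil0.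
by apply: filMl; apply: filW le (mmap1_fil m).
Qed.

Lemma ev_exists (f : mfps K n) : exists l, forall M, F M (mmap io y (mtr M f) - l).
Proof.
apply: (@fil_complete _ F) => M; rewrite -rmorphB; apply: mmap_fil => m hm.
by rewrite mcoeffB !mtr_agree ?subrr // ltnW.
Qed.

Definition ev (f : mfps K n) : A := projT1 (cid (ev_exists f)).

Lemma evP M p f : agree M p f -> F M (mmap io y p - ev f).
Proof.
move=> H; rewrite -(subrK (mmap io y (mtr M f)) (mmap io y p)) -addrA.
apply: filD; last by rewrite /ev; case: cid => l /= hl; apply: hl.
by rewrite -rmorphB; apply: mmap_fil => m hm; rewrite mcoeffB H ?mtr_agree ?subrr.
Qed.

(** Reduces a statement about the chosen limit [ev f] to polynomials approximating [f], on which
    [mmap] is already a ring morphism. *)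
Lemma ev_char (f : mfps K n) (l : A) :
  (forall M, exists2 p, agree M p f & F M (mmap io y p - l)) -> ev f = l.
Proof.
move=> H; apply: (@fil_sep_eq _ F) => M; have [p Hp Hl] := H M.
by rewrite -(subrK (mmap io y p) (ev f)) -addrA; apply: filD => //;
   rewrite -opprB; apply: filN; apply: evP.
Qed.

Lemma ev_is_zmod : zmod_morphism ev.
Proof.
move=> f g; apply: ev_char => M; exists (mtr M f - mtr M g).
  by move=> m hm; rewrite mcoeffB mfps_coefB !mtr_agree.
rewrite rmorphB /=; set a := mmap _ _ _; set b := mmap _ _ _.
have -> : a - b - (ev f - ev g) = (a - ev f) - (b - ev g) by ring.
by apply: filB; apply: evP; apply: mtr_agree.
Qed.

Lemma ev_is_monoid : monoid_morphism ev.
Proof.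
split.
  apply: ev_char => M; exists 1; first exact: agree1.
  by rewrite rmorph1 subrr; apply: fil0.
move=> f g; apply: ev_char => M; exists (mtr M f * mtr M g).
  by apply: agreeM; apply: mtr_agree.
rewrite rmorphM /=; set a := mmap _ _ _; set b := mmap _ _ _.
have -> : a * b - ev f * ev g = (a - ev f) * b + ev f * (b - ev g).
  by rewrite mulrBl mulrBr addrA subrK.
by apply: filD; [apply: filMr|apply: filMl]; apply: evP; apply: mtr_agree.
Qed.

HB.instance Definition _ :=
  GRing.isZmodMorphism.Build (mfps K n) A ev ev_is_zmod.
HB.instance Definition _ :=
  GRing.isMonoidMorphism.Build (mfps K n) A ev ev_is_monoid.

Lemma ev_C c : ev (mfpsC n c) = io c.
Proof.
apply: ev_char => M; exists c%:MP; first exact: agreeC.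
by rewrite mmapC subrr; apply: fil0.
Qed.

Lemma ev_Xm a : ev (mfpsXm K a) = mmap1 y a.
Proof.
apply: ev_char => M; exists 'X_[a]; first exact: agreeXm.
by rewrite mmapX subrr; apply: fil0.
Qed.

Lemma ev_X i : ev (mfpsX K i) = y i.
Proof. by rewrite ev_Xm mmap1U. Qed.

Lemma ev_fil M f : mfps_filt M f -> F M (ev f).
Proof.
move=> H; rewrite -[ev f]opprK; apply: filN; rewrite -[- ev f]add0r.
rewrite -(rmorph0 (mmap io y)); apply: evP => m hm.
by rewrite mcoeff0 H.
Qed.

End Evaluation.

(* A ring morphism respecting the filtrations commutes with infinite sums. *)
Lemma ev_comp (A B : comNzRingType) (F : cfilt A) (G : cfilt B)
    (K : comNzRingType) (io : {rmorphism K -> A}) (io' : {rmorphism K -> B})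
    n (y : 'I_n -> A) (z : 'I_n -> B) hy hz (phi : {rmorphism A -> B}) f :
  (forall M x, F M x -> G M (phi x)) ->
  (forall c, phi (io c) = io' c) -> (forall i, phi (y i) = z i) ->
  phi (@ev A F K io n y hy f) = @ev B G K io' n z hz f.
Proof.
move=> Hc e1 e2; symmetry; apply: ev_char => M; exists (mtr M f); first exact: mtr_agree.
have -> : mmap io' z (mtr M f) = phi (mmap io y (mtr M f)).
  rewrite /mmap rmorph_sum; apply: eq_bigr => m _; rewrite rmorphM e1; congr (_ * _).
  by rewrite /mmap1 rmorph_prod; apply: eq_bigr => i _; rewrite rmorphXn e2.
by rewrite -rmorphB; apply: Hc; apply: evP; exact: mtr_agree.
Qed.

Lemma ev_id (K : comNzRingType) n (f : mfps K n) :
  @ev _ mfps_filt K (@mfpsC K n) n (@mfpsX K n) (@mfpsX_fil K n) f = f.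
Proof.
apply: ev_char => M; exists (mtr M f); first exact: mtr_agree.
move=> m hm; rewrite mfps_coefB -(mtr_agree f hm); apply/eqP; rewrite subr_eq0; apply/eqP.
have H : agree M (mtr M f) (mmap (@mfpsC K n) (@mfpsX K n) (mtr M f)); last by rewrite H.
elim/mpolyind: (mtr M f) => [|c a p _ _ IH]; first by rewrite rmorph0 => ? _; rewrite mcoeff0.
rewrite rmorphD /=; apply: agreeD => //; rewrite mmapZ mmapX mmap1_mfpsX.
by rewrite -mul_mpolyC; apply: agreeM; [exact: agreeC | exact: agreeXm].
Qed.

Section PowerSeriesDomain.
Variables (k : fieldType) (n : nat).
Implicit Types f g : mfps k n.

Lemma mfps_low_degree f : f != 0 ->
  exists2 r, mord r f & exists2 a, mdeg a = r & mfps_coef f a != 0.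
Proof.
move=> nz; pose P r := `[< exists2 a, mdeg a = r & mfps_coef f a != 0 >].
have exP : exists r, P r.
  apply: contrapT => H; case/eqP: nz; apply: mfpsP => m; apply/eqP/negP => /negP h.
  by apply: H; exists (mdeg m); apply/asboolP; exists m.
case: (ex_minnP exP) => r /asboolP Pr min; exists r => // m lt.
apply/eqP/negP => /negP h; have : P (mdeg m) by apply/asboolP; exists m.
by move/min; rewrite leqNgt lt.
Qed.

(** Initial forms multiply. Cut just above the lowest degrees [r] and [s], the series become
    homogeneous polynomials; their product is nonzero because polynomials form a domain, and in
    degree r + s it has the coefficients of [f * g]. *)
Lemma mfps_mulf_eq0 f g : f * g = 0 -> (f == 0) || (g == 0).
Proof.
move=> fg0; apply/norP => -[/mfps_low_degree[r fr [a da fa]] /mfps_low_degree[s gs [b db gb]]].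
pose p := mtr r.+1 f; pose q := mtr s.+1 g.
have pa : p@_a = mfps_coef f a by rewrite mtr_agree ?da.
have qb : q@_b = mfps_coef g b by rewrite mtr_agree ?db.
have nzp : p != 0 by apply: contraNneq fa => p0; rewrite -pa p0 mcoeff0.
have nzq : q != 0 by apply: contraNneq gb => q0; rewrite -qb q0 mcoeff0.
have : p * q != 0 by rewrite mulf_neq0.
case/eqP; apply/mpolyP => m; rewrite mcoeff0 mcoeffM.
have hp c : (p@_c != 0) -> mdeg c = r.
  move=> nz; apply/eqP; rewrite eqn_leq -ltnS ltnNge.
  have [|lt] := leqP r.+1 (mdeg c); first by move=> h; rewrite mtr_coef_ge ?eqxx in nz.
  rewrite leqNgt; apply: contra_neqN nz => h; by rewrite mtr_agree ?fr // ltnW.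
have hq c : (q@_c != 0) -> mdeg c = s.
  move=> nz; apply/eqP; rewrite eqn_leq -ltnS ltnNge.
  have [|lt] := leqP s.+1 (mdeg c); first by move=> h; rewrite mtr_coef_ge ?eqxx in nz.
  rewrite leqNgt; apply: contra_neqN nz => h; by rewrite mtr_agree ?gs // ltnW.
have [e|ne] := eqVneq (mdeg m) (r + s)%N; last first.
  rewrite big1 // => h /eqP e.
  have [->|/hp e1] := eqVneq p@_h.1 0; first by rewrite mul0r.
  have [->|/hq e2] := eqVneq q@_h.2 0; first by rewrite mulr0.
  by case/eqP: ne; rewrite e mdegD e1 e2.
rewrite -[RHS](congr1 (fun u => mfps_coef u m) fg0) mfps_coefM.
apply: eq_bigr => -[[c /= lc] [d /= ld]] /eqP /= ecd.
move: e; rewrite ecd mdegD => e.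
have [lt|] := ltnP (mdeg c) r.
  by rewrite mtr_agree ?ltnS 1?ltnW // fr // !mul0r.
rewrite leq_eqVlt => /orP[/eqP e1|lt].
  have dd : mdeg d = s by apply/eqP; rewrite -(eqn_add2l r) {1}e1 e.
  by rewrite !mtr_agree ?dd -?e1.
have lts : (mdeg d < s)%N by rewrite -(ltn_add2l r) -e ltn_add2r.
by rewrite [q@_d]mtr_agree ?ltnS 1?ltnW // gs // !mulr0.
Qed.

Definition mfps_unit : pred (mfps k n) := fun f => `[< exists g, g * f = 1 >].
Definition mfps_inv f : mfps k n :=
  if pselect (exists g, g * f = 1) is left h then projT1 (cid h) else f.

Lemma mfps_mulVf : {in mfps_unit, left_inverse 1 mfps_inv *%R}.
Proof.
move=> f /asboolP h; rewrite /mfps_inv; case: pselect => // h'.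
by case: cid.
Qed.

Lemma mfps_unitPl f g : g * f = 1 -> mfps_unit f.
Proof. by move=> h; apply/asboolP; exists g. Qed.

Lemma mfps_inv_out : {in [predC mfps_unit], mfps_inv =1 id}.
Proof.
by move=> f /asboolPn h; rewrite /mfps_inv; case: pselect.
Qed.

HB.instance Definition _ := GRing.ComNzRing_hasMulInverse.Build (mfps k n)
  mfps_mulVf mfps_unitPl mfps_inv_out.
HB.instance Definition _ := GRing.ComUnitRing_isIntegral.Build (mfps k n)
  mfps_mulf_eq0.

Lemma mfps_inverse f : mfps_coef f 0%MM != 0 -> exists g, f * g = 1.
Proof.
move=> nz; set c := mfps_coef f 0%MM in nz.
have h1 : mfps_filt 1 (1 - mfpsC n c^-1 * f).
  by apply: mord1P; rewrite mfps_coefB mfps_coefCM mfps_coef1 eqxx mulVf // subrr.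
have [g] := fil1_unit h1; rewrite opprB addrCA subrr addr0 => e.
by exists (mfpsC n c^-1 * g); rewrite mulrCA mulrA.
Qed.

End PowerSeriesDomain.

Section Finiteness.
Variables (A : comNzRingType) (F : cfilt A) (K : comNzRingType).
Variables (io : {rmorphism K -> A}) (n : nat) (y : 'I_n -> A).
Hypothesis hy : forall i, F 1 (y i).
Variables (l r : nat) (s : 'I_l -> A) (z : 'I_r -> A).
Hypothesis span1 : forall a, exists (c : 'I_l -> K) (b : 'I_n -> A) (q : 'I_r -> A),
  a = \sum_j io (c j) * s j + \sum_i y i * b i + \sum_j z j * q j.

(* Iterating span1 replaces a homogeneous polynomial p of degree M in y with
   coefficients in A by one of degree M + 1; the error terms add up to power
   series. *)
Lemma complete_span a : exists (g : 'I_l -> mfps K n) (q : 'I_r -> A),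
  a = \sum_j ev io hy (g j) * s j + \sum_j z j * q j.
Proof.
have span2 a' : exists t : ('I_l -> K) * ('I_n -> A) * ('I_r -> A),
    a' = \sum_j io (t.1.1 j) * s j + \sum_i y i * t.1.2 i + \sum_j z j * t.2 j.
  by have [c [b [q e]]] := span1 a'; exists (c, b, q).
have [t ht] := choice span2.
pose cc a' := (t a').1.1; pose bb a' := (t a').1.2; pose qq a' := (t a').2.
pose next (p : {mpoly A[n]}) : {mpoly A[n]} :=
  \sum_(m <- msupp p) \sum_i bb p@_m i *: 'X_[m + U_(i)].
pose P M := iter M next (a%:MP).
pose C j M : {mpoly K[n]} := \sum_(m <- msupp (P M)) cc (P M)@_m j *: 'X_[m].
pose Q j M : {mpoly A[n]} := \sum_(m <- msupp (P M)) qq (P M)@_m j *: 'X_[m].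
have hP M m : m \in msupp (P M) -> mdeg m = M.
  elim: M m => [|M IH] m.
    rewrite /P /= msuppC; case: ifP => // _; rewrite inE => /eqP ->; exact: mdeg0.
  rewrite /P iterS -/(P M); apply: contraTeq => ne; rewrite -mcoeff_eq0 /next raddf_sum /=.
  rewrite big_seq big1 // => m' /IH e.
  rewrite raddf_sum big1 //= => i _; rewrite linearZ /= mcoeffX.
  case: eqP => [e'|_]; last by rewrite mulr0.
  by case/eqP: ne; rewrite -e' mdegD mdeg1 e addn1.
have hC j M m : mdeg m != M -> (C j M)@_m = 0.
  move=> ne; rewrite /C raddf_sum /= big_seq big1 // => m' /hP e.
  rewrite linearZ /= mcoeffX; case: eqP => [e'|_]; last by rewrite mulr0.
  by case/eqP: ne; rewrite -e'.
have hQ j M m : mdeg m != M -> (Q j M)@_m = 0.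
  move=> ne; rewrite /Q raddf_sum /= big_seq big1 // => m' /hP e.
  rewrite linearZ /= mcoeffX; case: eqP => [e'|_]; last by rewrite mulr0.
  by case/eqP: ne; rewrite -e'.
have [evp evpmE] : exists evp : {rmorphism {mpoly A[n]} -> A}, forall p, evp p = mmap idfun y p.
  by exists (mmap idfun y).
have evpX b m : evp (b *: 'X_[m]) = b * mmap1 y m by rewrite evpmE mmapZ mmapX.
have evpE p : evp p = \sum_(m <- msupp p) p@_m * mmap1 y m by rewrite evpmE.
have mmap1MU m i : mmap1 y (m + U_(i))%MM = mmap1 y m * y i.
  by rewrite -[LHS](mmapX y idfun) mpolyXD rmorphM /= !mmapX mmap1U.
have step M : evp (P M) = \sum_j mmap io y (C j M) * s j + \sum_j z j * evp (Q j M) + evp (P M.+1).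
  rewrite /P iterS -/(P M) [evp (P M)]evpE [evp (next _)]raddf_sum.
  rewrite (eq_bigr (fun j => \sum_(m <- msupp (P M)) io (cc (P M)@_m j) * mmap1 y m * s j)); last first.
    move=> j _; rewrite /C raddf_sum mulr_suml; apply: eq_bigr => m _.
    by rewrite /= mmapZ mmapX.
  rewrite [X in _ + X + _](eq_bigr (fun j =>
    \sum_(m <- msupp (P M)) z j * (qq (P M)@_m j * mmap1 y m))); last first.
    move=> j _; rewrite /Q raddf_sum mulr_sumr; apply: eq_bigr => m _.
    by rewrite /= evpX.
  rewrite exchange_big /= [X in _ + X + _]exchange_big /= -!big_split /=.
  apply: eq_bigr => m _.
  rewrite {1}(ht (P M)@_m) -/(cc _) -/(bb _) -/(qq _) raddf_sum /=.
  rewrite [X in _ = _ + X](eq_bigr (fun i => bb (P M)@_m i * (mmap1 y m * y i))); last first.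
    by move=> i _; rewrite /= evpX mmap1MU.
  rewrite !mulrDl !mulr_suml addrAC; congr (_ + _ + _); apply: eq_bigr => j _; ring.
(* [C j M] and [Q j M] are homogeneous of degree [M], so in their sum over all [M] the coefficient
   of [m] comes from the term of index [mdeg m] alone. *)
pose g j := Mfps (fun m => (C j (mdeg m))@_m).
pose Qs j := Mfps (fun m => (Q j (mdeg m))@_m).
exists g, (fun j => ev idfun hy (Qs j)).
have ag j M : agree M (\sum_(i < M) C j i) (g j).
  move=> m hm; rewrite raddf_sum /= (bigD1 (Ordinal hm)) //= big1 ?addr0 //.
  by move=> i ne; apply: hC; apply: contraNneq ne => e; apply/eqP/val_inj.
have aQ j M : agree M (\sum_(i < M) Q j i) (Qs j).
  move=> m hm; rewrite raddf_sum /= (bigD1 (Ordinal hm)) //= big1 ?addr0 //.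
  by move=> i ne; apply: hQ; apply: contraNneq ne => e; apply/eqP/val_inj.
apply: (@fil_sep_eq _ F) => M.
have tel : a = \sum_j mmap io y (\sum_(i < M) C j i) * s j
             + \sum_j z j * evp (\sum_(i < M) Q j i) + evp (P M).
  elim: M => [|M ->].
    rewrite !big1 => [|j _|j _]; rewrite ?big_ord0 ?rmorph0 ?mul0r ?mulr0 //.
    by rewrite !add0r /P evpmE /= mmapC.
  rewrite step; set u := \sum_j _ ; set v := \sum_j _; set u' := \sum_j _; set v' := \sum_j _.
  have -> : u + v + (u' + v' + evp (P M.+1)) = (u + u') + (v + v') + evp (P M.+1) by ring.
  congr (_ + _ + _); rewrite -big_split; apply: eq_bigr => j _ /=.
    by rewrite big_ord_recr rmorphD mulrDl.
  by rewrite big_ord_recr rmorphD mulrDr.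
rewrite {1}tel; set u := \sum_j _ ; set v := \sum_j _; set u' := \sum_j _; set v' := \sum_j _.
have -> : u + v + evp (P M) - (u' + v') = (u - u') + (v - v') + evp (P M) by ring.
apply: filD; last first.
  by rewrite evpmE; apply: mmap_fil => // m hm; apply: memN_msupp_eq0; apply/negP => /hP e; rewrite e ltnn in hm.
apply: filD.
  rewrite /u /u' -sumrB; apply: fil_sum => j _; rewrite -mulrBl; apply: filMr.
  exact: evP.
rewrite /v /v' -sumrB; apply: fil_sum => j _; rewrite -mulrBr; apply: filMl.
by rewrite evpmE; apply: evP.
Qed.

End Finiteness.

(** * Weierstrass division *)

Section CoordinateIdeals.
Variables (k : comNzRingType) (n : nat).

Lemma mfps_coef_sumXM (I : pred 'I_n) (h : 'I_n -> mfps k n) m :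
  mfps_coef (\sum_(i | I i) mfpsX k i * h i) m =
  \sum_(i | I i && (0 < m i)%N) mfps_coef (h i) (m - U_(i))%MM.
Proof.
rewrite mfps_coef_sum big_mkcondr; apply: eq_bigr => i _.
case: ifP => [gt|/negbT ng]; last first.
  rewrite mfps_coefXM_eq0 //; apply: contra ng => /mnm_lepP/(_ i).
  by rewrite mnm1E eqxx.
have le : (U_(i) <= m)%MM by apply/mnm_lepP => j; rewrite mnm1E; case: eqP => // <-.
by rewrite -{1}(submK le) addmC mfps_coefXMl.
Qed.

(** Every monomial of [f] involves a variable indexed by [I]; [pk] picks one of them and thereby
    decides which [h i] receives the monomial. *)
Lemma mfps_ideal_X (I : pred 'I_n) (f : mfps k n) :
  (forall m : 'X_{1..n}, (forall i, I i -> m i = 0%N) -> mfps_coef f m = 0) ->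
  exists h : 'I_n -> mfps k n, f = \sum_(i | I i) mfpsX k i * h i.
Proof.
move=> H; pose pk (m : 'X_{1..n}) := [pick i | I i && (0 < m i)%N].
exists (fun i => Mfps (fun m => if pk (m + U_(i))%MM == Some i
                                then mfps_coef f (m + U_(i))%MM else 0)).
apply: mfpsP => m; rewrite mfps_coef_sumXM /=.
rewrite (eq_bigr (fun i => if pk m == Some i then mfps_coef f m else 0)); last first.
  move=> i /andP[_ gt].
  by rewrite mfps_coefE submK //; apply/mnm_lepP => j; rewrite mnm1E; case: eqP => // <-.
case e : (pk m) => [i|]; last first.
  rewrite big1 // H // => i Ii; move: e; rewrite /pk; case: pickP => // /(_ i).
  by rewrite Ii /= lt0n => /negbFE/eqP.
have Pi : I i && (0 < m i)%N by move: e; rewrite /pk; case: pickP => // j Pj [<-].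
rewrite (bigD1 i) //= eqxx big1 ?addr0 // => j /andP[_ ne].
by case: eqP => // -[ej]; rewrite ej eqxx in ne.
Qed.

Lemma mord1_ideal (f : mfps k n) : mfps_filt 1 f ->
  exists h : 'I_n -> mfps k n, f = \sum_i mfpsX k i * h i.
Proof.
move=> H; apply: (@mfps_ideal_X predT) => m hm; apply: H.
by rewrite mdegE big1 // => i _; apply: hm.
Qed.

End CoordinateIdeals.

Section OneVariable.
Variable k : comNzRingType.
Notation O := (mfps k 1).

Definition mpow (i : nat) : 'X_{1..1} := (U_(ord0) *+ i)%MM.
Definition cf (f : O) i := mfps_coef f (mpow i).
Definition tO : O := mfpsX k ord0.

Lemma mpow_ord0 (m : 'X_{1..1}) : m = mpow (m ord0).
Proof.
by apply/mnmP => j; rewrite (ord1 j) mulmnE mnm1E eqxx mul1n.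
Qed.

Lemma mpow0 i : mpow i ord0 = i.
Proof. by rewrite mulmnE mnm1E eqxx mul1n. Qed.

Lemma cfP (f g : O) : (forall i, cf f i = cf g i) -> f = g.
Proof. by move=> H; apply: mfpsP => m; rewrite (mpow_ord0 m); apply: H. Qed.

Lemma cf_tM i f j : cf (tO ^+ i * f) j = if (i <= j)%N then cf f (j - i) else 0.
Proof.
rewrite /cf /tO mfpsXn; case: leqP => h.
  have -> : mpow j = (mpow i + mpow (j - i))%MM.
    by apply/mnmP => a; rewrite (ord1 a) mnmDE !mpow0 subnKC.
  by rewrite mfps_coefXMl.
rewrite mfps_coefXM_eq0 //; apply/negP => /mnm_lepP/(_ ord0).
by rewrite mpow0 leqNgt; rewrite mulmnE mnm1E eqxx mul1n h.
Qed.

Lemma cf_t i j : cf (tO ^+ i) j = (i == j)%:R.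
Proof.
rewrite -[tO ^+ i]mulr1 cf_tM; case: leqP => h.
  rewrite /cf mfps_coef1 -mdeg_eq0 /mpow mdegMn mdeg1 mul1n subn_eq0 eqn_leq h /=.
  by rewrite leqNgt; rewrite -leqNgt.
by rewrite gtn_eqF.
Qed.

Lemma cfC c i : cf (mfpsC 1 c) i = if i == 0%N then c else 0.
Proof.
by rewrite /cf mfps_coefC -mdeg_eq0 /mpow mdegMn mdeg1 mul1n; case: eqP; rewrite ?mulr1 ?mulr0.
Qed.

Lemma cf_shift D (f : O) : exists g, (forall i, cf g i = cf f (i + D)) /\
  f = \sum_(i < D) mfpsC 1 (cf f i) * tO ^+ i + tO ^+ D * g.
Proof.
exists (Mfps (fun m => cf f (m ord0 + D))).
have h i : cf (Mfps (fun m : 'X_{1..1} => cf f (m ord0 + D))) i = cf f (i + D).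
  by rewrite {1}/cf mfps_coefE mpow0.
split=> //; apply: cfP => j; rewrite {2}/cf mfps_coefD mfps_coef_sum -/(cf _ j) cf_tM h.
under eq_bigr do rewrite mfps_coefCM -/(cf _ j) cf_t.
case: leqP => hj.
  by rewrite subnK // big1 ?add0r // => i _; rewrite ltn_eqF ?mulr0 // (leq_trans (ltn_ord i)).
rewrite addr0 (bigD1 (Ordinal hj)) //= eqxx mulr1 big1 ?addr0 // => i ne.
by rewrite -val_eqE /= in ne; rewrite (negbTE ne) mulr0.
Qed.

Lemma cf_D (f g : O) i : cf (f + g) i = cf f i + cf g i.
Proof. by []. Qed.

Lemma cf_dvd D (f : O) : (forall i, (i < D)%N -> cf f i = 0) -> exists g, f = tO ^+ D * g.
Proof.
move=> H; have [g [_ e]] := cf_shift D f; exists g.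
by rewrite {1}e big1 ?add0r // => i _; rewrite H // rmorph0 mul0r.
Qed.

End OneVariable.
Arguments tO {k}.

Lemma mfps_inverse1 (k : fieldType) (f : mfps k 1) : cf f 0 != 0 -> exists g, f * g = 1.
Proof.
move=> h; apply: mfps_inverse.
by have <- : mpow 0 = 0%MM by rewrite /mpow mulm0n.
Qed.

Section Axis.
Variables (k : comNzRingType) (n : nat) (j : 'I_n).

Definition axis_pt (i : 'I_n) : mfps k 1 := if i == j then tO else 0.

Lemma axis_pt_fil i : mfps_filt 1 (axis_pt i).
Proof. by rewrite /axis_pt; case: ifP => _; [exact: mfpsX_fil | exact: fil0]. Qed.

(* Restriction of a power series to the j-th coordinate axis. *)
Definition rho : {rmorphism mfps k n -> mfps k 1} := ev (@mfpsC k 1) axis_pt_fil.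

Lemma rho_coef f i : cf (rho f) i = mfps_coef f (U_(j) *+ i)%MM.
Proof.
have H : rho f = Mfps (fun m => mfps_coef f (U_(j) *+ m ord0)%MM).
  apply: ev_char => M; exists (mtr M f); first exact: mtr_agree.
  move=> m; rewrite (mpow_ord0 m); move: (m ord0) => {m} i hi.
  rewrite mfps_coefB mfps_coefE mpow0 -(@mtr_agree _ _ M f); last first.
    by move: hi; rewrite /mpow !mdegMn !mdeg1.
  apply/eqP; rewrite subr_eq0; apply/eqP; rewrite -/(cf _ i).
  elim/mpolyind: (mtr M f) => [|c a p _ _ IH]; first by rewrite rmorph0 mcoeff0.
  rewrite rmorphD mcoeffD cf_D IH; congr (_ + _).
  rewrite [X in cf X _](_ : _ = mfpsC 1 c * mmap1 axis_pt a); last by rewrite /= mmapZ mmapX.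
  rewrite mcoeffZ mcoeffX {1}/cf mfps_coefCM -/(cf _ i); congr (_ * _).
  have [e|ne] := eqVneq a (U_(j) *+ a j)%MM.
    rewrite e /mmap1 (bigD1 j) //= big1 ?mulr1; last first.
      by move=> l ne; rewrite mulmnE mnm1E eq_sym (negbTE ne) mul0n expr0.
    rewrite /axis_pt eqxx mulmnE mnm1E eqxx mul1n cf_t; congr (_ %:R).
    congr nat_of_bool; apply/eqP/eqP => [->//|/mnmP/(_ j)].
    by rewrite !mulmnE !mnm1E eqxx !mul1n.
  have [l lj al] : exists2 l, l != j & a l != 0%N.
    apply: contrapT => H; case/eqP: ne; apply/mnmP => l; rewrite mulmnE mnm1E.
    case: (eqVneq j l) => [<-|lj]; first by rewrite mul1n.
    rewrite mul0n; apply/eqP/negP => /negP al; apply: H; exists l => //.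
    by rewrite eq_sym.
  rewrite /mmap1 (bigD1 l) //= /axis_pt (negbTE lj) expr0n (negbTE al) mul0r.
  case: eqP => [e|//]; case/eqP: al; rewrite e mulmnE mnm1E eq_sym (negbTE lj).
  by rewrite mul0n.
by rewrite H /cf mfps_coefE mpow0.
Qed.

Lemma axis_in_fil (i : 'I_1) : mfps_filt 1 (mfpsX k j).
Proof. exact: mfpsX_fil. Qed.

Definition axis_in : {rmorphism mfps k 1 -> mfps k n} :=
  ev (@mfpsC k n) axis_in_fil.

Lemma axis_inK f : rho (axis_in f) = f.
Proof.
rewrite -[RHS]ev_id /axis_in; apply: ev_comp => [M x|c|i]; first exact: ev_fil.
  by rewrite /rho /= ev_C.
by rewrite /rho /= ev_X /axis_pt eqxx (ord1 i).
Qed.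

Lemma rho_eq0 f : rho f = 0 ->
  exists h : 'I_n -> mfps k n, f = \sum_(i | i != j) mfpsX k i * h i.
Proof.
move=> r0; apply: mfps_ideal_X => m H.
have -> : m = (U_(j) *+ m j)%MM.
  apply/mnmP => l; rewrite mulmnE mnm1E; case: (eqVneq j l) => [<-|lj]; first by rewrite mul1n.
  by rewrite mul0n H // eq_sym.
by rewrite -rho_coef r0.
Qed.

End Axis.
Arguments rho {k n} j.
Arguments axis_in {k n} j.

Section Lift.
Variables (k : comNzRingType) (n : nat) (j : 'I_n.+1).

Definition lift_pt (i : 'I_n) : mfps k n.+1 := mfpsX k (lift j i).

Lemma lift_pt_fil i : mfps_filt 1 (lift_pt i).
Proof. exact: mfpsX_fil. Qed.

Definition emb : {rmorphism mfps k n -> mfps k n.+1} := ev (@mfpsC k n.+1) lift_pt_fil.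

Definition mrestr (m : 'X_{1..n.+1}) : 'X_{1..n} := [multinom m (lift j i) | i < n].

Definition mlift (a : 'X_{1..n}) : 'X_{1..n.+1} :=
  [multinom (if unlift j i is Some i' then a i' else 0%N) | i < n.+1].

Lemma mliftK a : mrestr (mlift a) = a.
Proof. by apply/mnmP => i; rewrite !mnmE liftK. Qed.

Lemma mlift_j a : mlift a j = 0%N.
Proof. by rewrite mnmE unlift_none. Qed.

Lemma mrestrK (m : 'X_{1..n.+1}) : m j = 0%N -> mlift (mrestr m) = m.
Proof. by move=> e; apply/mnmP => i; rewrite !mnmE; case: unliftP => [i' ->|->//]; rewrite mnmE. Qed.

Lemma mdeg_mrestr m : mdeg m = (m j + mdeg (mrestr m))%N.
Proof.
rewrite !mdegE (bigD1_ord j) //=; congr addn; apply: eq_bigr => i _.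
by rewrite mnmE.
Qed.

Lemma emb_coef f m : mfps_coef (emb f) m = if m j == 0%N then mfps_coef f (mrestr m) else 0.
Proof.
suff -> : emb f = Mfps (fun m => if m j == 0%N then mfps_coef f (mrestr m) else 0) by [].
apply: ev_char => M; exists (mtr M f); first exact: mtr_agree.
move=> {}m hm; rewrite mfps_coefB mfps_coefE; apply/eqP; rewrite subr_eq0; apply/eqP.
rewrite -(@mtr_agree _ _ M f); last by apply: leq_ltn_trans hm; rewrite mdeg_mrestr leq_addl.
elim/mpolyind: (mtr M f) => [|c a p _ _ IH]; first by rewrite rmorph0 mcoeff0; case: ifP.
rewrite rmorphD mcoeffD mfps_coefD IH.
rewrite [X in mfps_coef X _](_ : _ = mfpsC n.+1 c * mmap1 lift_pt a); last by rewrite /= mmapZ mmapX.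
rewrite mcoeffZ mcoeffX mfps_coefCM.
have -> : mmap1 lift_pt a = mfpsXm k (mlift a).
  rewrite mfpsXmE (bigD1_ord j) //= mlift_j expr0 mul1r; apply: eq_bigr => i _.
  by rewrite mnmE liftK.
rewrite mfps_coefXm; have [mj|mj] := eqVneq (m j) 0%N.
  congr (c * (_ %:R) + _); congr nat_of_bool.
  by apply/eqP/eqP => [->|->]; rewrite ?mliftK ?mrestrK.
rewrite addr0; case: eqP => [e|]; last by rewrite mulr0.
by rewrite e mlift_j in mj.
Qed.

Lemma emb_coefT f i m : mfps_coef (emb f * mfpsX k j ^+ i) m =
  if m j == i then mfps_coef f (mrestr m) else 0.
Proof.
rewrite mulrC mfpsXn; have [le|gt] := leqP i (m j).
  have le' : (U_(j) *+ i <= m)%MM.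
    by apply/mnm_lepP => l; rewrite mulmnE mnm1E; case: eqP => [<-|]; rewrite ?mul1n.
  rewrite -{1}(submK le') addmC mfps_coefXMl emb_coef mnmBE mulmnE mnm1E eqxx mul1n.
  rewrite subn_eq0 eqn_leq le andbT; case: ifP => // _; congr mfps_coef.
  by apply/mnmP => l; rewrite !mnmE mulmnE mnm1E (negbTE (neq_lift _ _)) mul0n subn0.
rewrite mfps_coefXM_eq0 ?(ltn_eqF gt) //; apply/negP => /mnm_lepP/(_ j).
by rewrite mulmnE mnm1E eqxx mul1n leqNgt gt.
Qed.

End Lift.
Arguments emb {k n} j.
Arguments lift_pt k {n} j i.
Arguments lift_pt_fil k {n} j i.

Section Weierstrass.
Variables (k : fieldType) (n : nat) (j : 'I_n.+1).
Notation E := (mfps k n.+1).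
Notation T := (mfpsX k j).
Variables (chi : E) (D : nat).
Hypothesis chi_lt : forall i, (i < D)%N -> cf (rho j chi) i = 0.
Hypothesis chi_D : cf (rho j chi) D != 0.

(** On the j-th axis [chi] is T^D times a unit, so modulo [chi] and the other variables the powers
    of T below D span over [k]. Completeness, in the form of [complete_span], lifts this to the
    series in the other variables. *)
Lemma weierstrass_div (a : E) : exists (g : 'I_D -> mfps k n) (q : E),
  a = \sum_i emb j (g i) * T ^+ i + chi * q.
Proof.
have [u [hu eu]] := cf_shift D (rho j chi).
have eu' : rho j chi = tO ^+ D * u.
  by rewrite {1}eu big1 ?add0r // => i _; rewrite chi_lt // rmorph0 mul0r.
have [v uv] : exists v, u * v = 1 by apply: mfps_inverse1; rewrite hu.
have span b : exists (c : 'I_D -> k) (r : 'I_n -> E) (q : 'I_1 -> E),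
    b = \sum_i mfpsC n.+1 (c i) * T ^+ i + \sum_i lift_pt k j i * r i + \sum_i chi * q i.
  have [b' [_ eb]] := cf_shift D (rho j b).
  pose b0 := \sum_(i < D) mfpsC n.+1 (cf (rho j b) i) * T ^+ i.
  (* The quotient of the division on the axis, where it removes the terms of order at least D,
     viewed as a series in all the variables. *)
  pose q := axis_in j (v * b').
  have /rho_eq0[h eh] : rho j (b - b0 - chi * q) = 0.
    rewrite !rmorphB rmorphM axis_inK eu' mulrA -[_ * u * v]mulrA uv mulr1 {1}eb.
    rewrite /b0 rmorph_sum /= -addrA -opprD; apply/eqP; rewrite subr_eq0; apply/eqP.
    congr (_ + _); apply: eq_bigr => i _.
    by rewrite rmorphM rmorphXn /rho /= ev_C ev_X /axis_pt eqxx.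
  exists (fun i => cf (rho j b) i), (fun i => h (lift j i)), (fun=> q).
  rewrite big_ord1 -/b0.
  have <- : \sum_(i | i != j) mfpsX k i * h i = \sum_i lift_pt k j i * h (lift j i).
    by rewrite big_mkcond (bigD1_ord j) //= eqxx add0r; apply: eq_bigr => i _; rewrite eq_sym neq_lift.
  by rewrite -eh; ring.
have [g [q e]] := complete_span (lift_pt_fil k j) span a.
by exists g, (q ord0); rewrite e big_ord1.
Qed.

Let dg (m : 'X_{1..n.+1}) := mdeg (mrestr j m).

(** If [q] is nonzero, take a monomial [b] of [q] of least degree [r] in the variables other than T
    and, among these, of least exponent in T. The coefficient of T^D b in [chi * q] is a product of
    two nonzero coefficients, while on the right no exponent of T reaches D. *)
Lemma weierstrass_uniq (q : E) (g : 'I_D -> mfps k n) :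
  chi * q = \sum_i emb j (g i) * T ^+ i -> q = 0 /\ forall i, g i = 0.
Proof.
move=> e; have q0 : q = 0.
  apply/eqP/negP => /negP nz.
  pose P r := `[< exists2 m, dg m = r & mfps_coef q m != 0 >].
  have exP : exists r, P r.
    have [r _ [a _ qa]] := mfps_low_degree nz.
    by exists (dg a); apply/asboolP; exists a.
  case: (ex_minnP exP) => r /asboolP[m0 dm0 qm0] minr.
  pose Q i := `[< exists m, [/\ dg m = r, m j = i & mfps_coef q m != 0] >].
  have exQ : exists i, Q i by exists (m0 j); apply/asboolP; exists m0.
  case: (ex_minnP exQ) => i /asboolP[b [db bj qb]] mini.
  have dgD m m' : dg (m + m')%MM = (dg m + dg m')%N.
    by rewrite /dg -mdegD; congr mdeg; apply/mnmP => l; rewrite !mnmE.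
  have coef : mfps_coef (chi * q) (U_(j) *+ D + b)%MM = mfps_coef chi (U_(j) *+ D)%MM * mfps_coef q b.
    apply: mfps_coefM_unique => a' b' eab nz'.
    have [qb' ca'] : mfps_coef q b' != 0 /\ mfps_coef chi a' != 0.
      by split; apply/negP => /eqP h; apply: nz'; rewrite h ?mul0r ?mulr0.
    have le_r : (r <= dg b')%N by apply: minr; apply/asboolP; exists b'.
    have dT : dg (U_(j) *+ D)%MM = 0%N.
      apply/eqP; rewrite mdeg_eq0; apply/eqP/mnmP => l.
      by rewrite mnmE mulmnE mnm1E (negbTE (neq_lift _ _)) mnm0E.
    have sumdg : (dg a' + dg b' = r)%N by rewrite -dgD eab dgD dT db.
    have [da' db'] : dg a' = 0%N /\ dg b' = r.
      have eb : dg b' = r by apply/eqP; rewrite eqn_leq le_r andbT -sumdg leq_addl.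
      by split=> //; apply/eqP; rewrite -(eqn_add2r r) -{1}eb sumdg.
    have a'E : a' = (U_(j) *+ a' j)%MM.
      apply/mnmP => l; rewrite mulmnE mnm1E; case: (unliftP j l) => [l' ->|->].
        rewrite (negbTE (neq_lift _ _)) mul0n; move/eqP: da'; rewrite mdeg_eq0 => /eqP/mnmP/(_ l').
        by rewrite mnmE mnm0E.
      by rewrite eqxx mul1n.
    have leD : (D <= a' j)%N.
      rewrite leqNgt; apply/negP => lt; case/eqP: ca'.
      by rewrite a'E -rho_coef chi_lt.
    have lei : (i <= b' j)%N by apply: mini; apply/asboolP; exists b'.
    have sumj : (a' j + b' j = D + i)%N.
      by rewrite -mnmDE eab mnmDE mulmnE mnm1E eqxx mul1n bj.
    have aj : a' j = D.
      apply/eqP; rewrite eqn_leq leD andbT -(leq_add2r i) -sumj leq_add2l //.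
    have ea : a' = (U_(j) *+ D)%MM by rewrite a'E aj.
    by split=> //; move: eab; rewrite ea => /addmI.
  have : mfps_coef (chi * q) (U_(j) *+ D + b)%MM = 0.
    rewrite e mfps_coef_sum big1 // => l _; rewrite emb_coefT mnmDE mulmnE mnm1E eqxx mul1n.
    case: eqP => // el; have := ltn_ord l; rewrite -el ltnNge leq_addr //.
  rewrite coef -rho_coef => /eqP; rewrite mulf_eq0 (negbTE chi_D) /= => /eqP h.
  by rewrite h eqxx in qb.
split=> // i; apply: mfpsP => a.
have := congr1 (fun f => mfps_coef f (mlift j a + U_(j) *+ i)%MM) e.
rewrite q0 mulr0 mfps_coef_sum (bigD1 i) //= big1 ?addr0.
  rewrite emb_coefT mnmDE mlift_j mulmnE mnm1E eqxx mul1n eqxx mfps_coef0 => h; rewrite mfps_coef0 h.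
  congr mfps_coef; apply/mnmP => l; rewrite mnmE mnmDE mulmnE mnm1E.
  by rewrite (negbTE (neq_lift _ _)) mul0n addn0 mnmE liftK.
move=> l ne; rewrite emb_coefT mnmDE mlift_j mulmnE mnm1E eqxx mul1n add0n.
by case: eqP => // /val_inj el; rewrite el eqxx in ne.
Qed.

End Weierstrass.

(** * Coordinate changes *)

(** Weights with a unique lightest exponent, so that nothing cancels when each variable is replaced
    by a power of t. The first coordinate is made so heavy that its least value wins outright; the
    last one keeps weight 1 and can serve as parameter of the curve. *)
Lemma unique_min_weight n (S : ('I_n.+1 -> nat) -> Prop) m : S m ->
  exists e : 'I_n.+1 -> nat, [/\ e ord_max = 1%N, forall i, (0 < e i)%N &
    exists2 m0, S m0 & forall m', S m' -> m' <> m0 ->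
      (\sum_i e i * m0 i < \sum_i e i * m' i)%N].
Proof.
elim: n S m => [|n IH] S m Sm.
  pose P i := `[< exists2 m, S m & m ord0 = i >].
  have exP : exists i, P i by exists (m ord0); apply/asboolP; exists m.
  case: (ex_minnP exP) => i /asboolP[m0 Sm0 m0i] min.
  exists (fun=> 1%N); split=> //; exists m0 => // m' Sm' ne.
  rewrite !big_ord1 !mul1n m0i ltn_neqAle; apply/andP; split.
    by apply/eqP => e; apply: ne; apply/funext => j; rewrite (ord1 j) m0i.
  by apply: min; apply/asboolP; exists m'.
pose P i := `[< exists2 m, S m & m ord0 = i >].
have exP : exists i, P i by exists (m ord0); apply/asboolP; exists m.
case: (ex_minnP exP) => a /asboolP[m1 Sm1 m1a] min.
pose tl (u : 'I_n.+2 -> nat) (i : 'I_n.+1) := u (lift ord0 i).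
have [|e [e1 epos [m0 [m2 [Sm2 m2a <-]] hm0]]] :=
  IH (fun u => exists v, [/\ S v, v ord0 = a & tl v = u]) (tl m1).
  by exists m1.
(* The weight of the chosen tail: with D + 1 on the first coordinate, a larger first exponent costs
   more than any tail can save. *)
pose D := (\sum_i e i * tl m2 i)%N.
exists (fun i => if unlift ord0 i is Some i' then e i' else D.+1); split.
- by have -> : ord_max = lift ord0 (@ord_max n) by [apply: val_inj]; rewrite liftK.
- by move=> i; case: unliftP.
exists m2 => // m' Sm' ne; rewrite big_ord_recl [X in (_ < X)%N]big_ord_recl !unlift_none m2a.
under eq_bigr do rewrite liftK.
under [X in (_ < _ + X)%N]eq_bigr do rewrite liftK.
rewrite -/(tl m2) -/(tl m'); have le : (a <= m' ord0)%N.
  by apply: min; apply/asboolP; exists m'.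
rewrite -[X in (_ + X < _)%N]/D.
move: le; rewrite leq_eqVlt => /orP[/eqP ea|lt].
  rewrite -ea ltn_add2l; apply: hm0; first by exists m'.
  move=> et; apply: ne; apply/funext => i; case: (unliftP ord0 i) => [i' ->|->].
    by have := congr1 (fun u => u i') et.
  by rewrite m2a -ea.
apply: leq_trans (leq_addr _ _); nia.
Qed.

Section CoordinateChange.
Variables (k : fieldType) (n : nat) (e : 'I_n.+1 -> nat).
Hypotheses (e_max : e ord_max = 1%N) (e_gt0 : forall i, (0 < e i)%N).
Notation E := (mfps k n.+1).

Definition curve_pt (i : 'I_n.+1) : mfps k 1 := tO ^+ e i.

Lemma filX_gt0 (A : comNzRingType) (F : cfilt A) x i : F 1 x -> (0 < i)%N -> F 1 (x ^+ i).
Proof. by case: i => // i h _; rewrite exprS; apply: filMr. Qed.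

Lemma curve_pt_fil i : mfps_filt 1 (curve_pt i).
Proof. by apply: filX_gt0 => //; apply: mfpsX_fil. Qed.

Definition curve : {rmorphism E -> mfps k 1} := ev (@mfpsC k 1) curve_pt_fil.

(* The new coordinates X_i - X_n^(e_i) vanish on the curve X_i = t^(e_i). *)
Definition straight_pt (i : 'I_n.+1) : E :=
  if i == ord_max then mfpsX k ord_max else mfpsX k i - mfpsX k ord_max ^+ e i.

Lemma straight_pt_fil i : mfps_filt 1 (straight_pt i).
Proof.
rewrite /straight_pt; case: ifP => _; first exact: mfpsX_fil.
by apply: filB; [|apply: filX_gt0 => //]; apply: mfpsX_fil.
Qed.

Definition straight : {rmorphism E -> E} := ev (@mfpsC k n.+1) straight_pt_fil.

(** The purpose of the coordinate change: restriction to the curve becomes restriction to the last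
    axis. *)
Lemma curve_straight f : curve (straight f) = rho ord_max f.
Proof.
rewrite /straight /rho; apply: ev_comp => [M x|c|i]; first exact: ev_fil.
  by rewrite /curve /= ev_C.
rewrite /curve /= /straight_pt /axis_pt; case: eqP => _.
  by rewrite ev_X /curve_pt e_max expr1.
by rewrite rmorphB rmorphXn /= !ev_X /curve_pt e_max expr1 subrr.
Qed.

(** The new coordinates generate the same maximal ideal, so [complete_span] with the single
    generator 1 writes every series in them. *)
Lemma straight_surj f : exists f', straight f' = f.
Proof.
have span b : exists (c : 'I_1 -> k) (r : 'I_n.+1 -> E) (q : 'I_0 -> E),
    b = \sum_j mfpsC n.+1 (c j) * 1 + \sum_i straight_pt i * r i + \sum_(j < 0) 0 * q j.
  pose c := mfps_coef b 0%MM.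
  have [h eh] : exists h : 'I_n.+1 -> E, b - mfpsC n.+1 c = \sum_i mfpsX k i * h i.
    apply: mord1_ideal; apply: mord1P; rewrite mfps_coefB mfps_coefC eqxx mulr1.
    exact: subrr.
  have hX i : exists r : 'I_n.+1 -> E, mfpsX k i = \sum_l straight_pt l * r l.
    have [->|ne] := eqVneq i ord_max.
      exists (fun l => (l == ord_max)%:R); rewrite (bigD1 ord_max) //= eqxx mulr1.
      by rewrite /straight_pt eqxx big1 ?addr0 // => l /negbTE ->; rewrite mulr0.
    exists (fun l => if l == ord_max then mfpsX k ord_max ^+ (e i).-1 else (l == i)%:R).
    rewrite (bigD1 ord_max) //= eqxx /straight_pt eqxx -exprS prednK //.
    rewrite (bigD1 i) //= (negbTE ne) eqxx mulr1 big1 ?addr0 1?addrC ?subrK //.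
    by move=> l /andP[/negbTE -> /negbTE ->]; rewrite mulr0.
  have [r hr] := choice hX.
  exists (fun=> c), (fun l => \sum_i r i l * h i), (fun=> 0).
  rewrite big_ord0 addr0 big_ord1 mulr1; apply/eqP; rewrite addrC -subr_eq eh.
  apply/eqP; under eq_bigr do rewrite hr mulr_suml.
  rewrite exchange_big /=; apply: eq_bigr => l _; rewrite mulr_sumr.
  by apply: eq_bigr => i _; rewrite mulrA.
have [g [q ->]] := complete_span straight_pt_fil span f.
by exists (g ord0); rewrite big_ord1 big_ord0 addr0 mulr1.
Qed.

End CoordinateChange.

(** The weights are chosen so that a single monomial [m0] of [f] has least weight; its coefficient
    survives as the coefficient of order [w m0] in the image. *)
Lemma curve_neq0 (k : fieldType) n (f : mfps k n.+1) : f != 0 ->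
  exists e : 'I_n.+1 -> nat, [/\ e ord_max = 1%N, forall i, (0 < e i)%N &
    forall e_gt0 : (forall i, (0 < e i)%N), curve k e_gt0 f != 0].
Proof.
move=> /mfps_low_degree[_ _ [a _ fa]].
pose S (u : 'I_n.+1 -> nat) := exists2 m : 'X_{1..n.+1}, mfps_coef f m != 0 & u = m.
have [e [e1 epos [_ [m0 fm0 ->] min]]] := @unique_min_weight n S a (ex_intro2 _ _ a fa erefl).
exists e; split=> // e_gt0.
pose w (m : 'X_{1..n.+1}) := (\sum_i e i * m i)%N.
have wdeg m : (mdeg m <= w m)%N.
  by rewrite mdegE; apply: leq_sum => i _; rewrite leq_pmull.
have cw m : mmap1 (curve_pt k e) m = tO ^+ w m.
  rewrite /mmap1 /w /curve_pt; elim/big_rec2: _ => [|i x y _ ->]; first by rewrite expr0.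
  by rewrite exprD -exprM.
(* The weights being positive, degrees are bounded by weights, so truncating at this degree loses no
   monomial of weight at most [w m0]. *)
pose M := (w m0).+1.
have := evP (@mfpsC k 1) (curve_pt_fil k e_gt0) (@mtr_agree _ _ M f) (mpow (w m0)).
rewrite mfps_coefB /mpow mdegMn mdeg1 mul1n => /(_ (ltnSn _)).
set v := mmap _ _ _; move=> ev0; apply/eqP => c0.
have : cf v (w m0) = 0.
  have := ev0; rewrite -/(curve k e_gt0) (_ : ev _ _ f = 0) ?mfps_coef0 ?subr0 //.
rewrite /v /mtr raddf_sum /cf mfps_coef_sum.
pose B0 : 'X_{1..n.+1 < M} := BMultinom (wdeg m0 : (mdeg m0 < M)%N).
rewrite (bigD1 B0) //= big1.
  rewrite mmapZ mmapX cw mfps_coefCM -/(cf _ _) cf_t eqxx mulr1 addr0 => h.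
  by rewrite h eqxx in fm0.
move=> b ne; rewrite mmapZ mmapX cw mfps_coefCM -/(cf _ _) cf_t.
have [->|fb] := eqVneq (mfps_coef f b) 0; first by rewrite mul0r.
have : (w m0 < w b)%N.
  apply: min; first by exists (val b).
  move=> eb; case/eqP: ne; apply: val_inj; apply/mnmP => i.
  by have := congr1 (fun u => u i) eb.
by move=> lt; rewrite gtn_eqF ?mulr0.
Qed.

Section DetTrick.
Variables (A : comNzRingType) (P : A -> Prop).
Hypotheses (P0 : P 0) (PD : forall x y, P x -> P y -> P (x + y)).
Hypothesis (PM : forall a x, P x -> P (a * x)).

Lemma idl_sum (I : Type) (r : seq I) (Q : pred I) (f : I -> A) :
  (forall i, Q i -> P (f i)) -> P (\sum_(i <- r | Q i) f i).
Proof. by move=> H; elim/big_ind: _. Qed.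

(** Cramer's rule modulo an ideal, through the adjugate. It is the source of the integral equations
    below. *)
Lemma idl_det N (M : 'M[A]_N) (s : 'I_N -> A) :
  (forall i, P (\sum_j M i j * s j)) -> forall j, P (\det M * s j).
Proof.
move=> H j.
have -> : \det M * s j = \sum_i \adj M j i * (\sum_l M i l * s l).
  under eq_bigr do rewrite mulr_sumr.
  rewrite exchange_big /=.
  have e l : \sum_i \adj M j i * (M i l * s l) = (j == l)%:R * (\det M * s l).
    have := congr1 (fun X : 'M_N => X j l) (mul_adj_mx M); rewrite !mxE => h.
    by rewrite mulrA mulr_natl -h mulr_suml; apply: eq_bigr => i _; rewrite mulrA.
  under eq_bigr do rewrite e.
  rewrite (bigD1 j) //= eqxx mul1r big1 ?addr0 // => l ne.
  by rewrite eq_sym (negbTE ne) mul0r.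
by apply: idl_sum => i _; apply: PM.
Qed.

Lemma idl_cgM a b c d : P (a - b) -> P (c - d) -> P (a * c - b * d).
Proof.
move=> h1 h2; have -> : a * c - b * d = c * (a - b) + b * (c - d) by ring.
by apply: PD; apply: PM.
Qed.

Lemma idl_cg_det N (M M' : 'M[A]_N) : (forall i j, P (M i j - M' i j)) ->
  P (\det M - \det M').
Proof.
move=> H; rewrite /determinant -sumrB; apply: idl_sum => s _.
rewrite -mulrBr; apply: PM; elim/big_rec2: _ => [|i x y _ IH]; first by rewrite subrr.
exact: idl_cgM.
Qed.

End DetTrick.

(** * Systems of parameters and dimension *)

(** What dimension theory and the choice of parameters use of a complete local ring: a filtration
    whose first step plays the maximal ideal and whose higher steps are its powers, and a field
    [la_io] of representatives of the residues. *)
Record local_alg (k : fieldType) (A : comNzRingType) := LocalAlg {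
  la_fil :> cfilt A;
  la_io : {rmorphism k -> A};
  la_prod : forall i j x, la_fil (i + j)%N x -> exists2 s : seq (A * A),
    forall u, u \in s -> la_fil i u.1 /\ la_fil j u.2 & x = \sum_(u <- s) u.1 * u.2;
  la_unit : forall x, ~ la_fil 1 x -> exists y, x * y = 1;
  la_res : forall a, exists c, la_fil 1 (a - la_io c);
  la_gen : exists l (x : 'I_l -> A), (forall i, la_fil 1 (x i)) /\
    forall a, la_fil 1 a -> exists b : 'I_l -> A, a = \sum_i x i * b i;
  la_proper : ~ la_fil 1 1 }.

(** Unlike [idealr_closed], this admits the unit ideal, which may arise when generators are
    added. *)
Definition isid (A : comNzRingType) (P : A -> Prop) :=
  [/\ P 0, forall x y, P x -> P y -> P (x + y) & forall a x, P x -> P (a * x)].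

(** For an ideal [P], this is the ideal of the [y i] in the quotient by [P], without forming that
    quotient. *)
Definition idgen (A : comNzRingType) n (y : 'I_n -> A) (P : A -> Prop) (x : A) :=
  exists c : 'I_n -> A, P (x - \sum_i y i * c i).

Lemma idgen_isid (A : comNzRingType) n (y : 'I_n -> A) P : isid P -> isid (idgen y P).
Proof.
case=> P0 PD PM; split.
- by exists (fun=> 0); rewrite big1 ?subr0 // => i _; rewrite mulr0.
- move=> a b [c hc] [d hd]; exists (fun i => c i + d i).
  under eq_bigr do rewrite mulrDr.
  by rewrite big_split /= opprD addrACA; apply: PD.
- move=> a x [c hc]; exists (fun i => a * c i).
  under eq_bigr do rewrite mulrCA.
  by rewrite -mulr_sumr -mulrBr; apply: PM.
Qed.

Lemma idgen_y (A : comNzRingType) n (y : 'I_n -> A) P i : isid P -> idgen y P (y i).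
Proof.
case=> P0 _ _; exists (fun j => (j == i)%:R); rewrite (bigD1 i) //= eqxx mulr1 big1 ?addr0 ?subrr //.
by move=> j /negbTE ->; rewrite mulr0.
Qed.

Lemma idgen_P (A : comNzRingType) n (y : 'I_n -> A) (P : A -> Prop) x : P x -> idgen y P x.
Proof. by move=> h; exists (fun=> 0); rewrite big1 ?subr0 // => i _; rewrite mulr0. Qed.

Lemma isidN (A : comNzRingType) (P : A -> Prop) x : isid P -> P x -> P (- x).
Proof. by case=> _ _ PM h; rewrite -mulN1r; apply: PM. Qed.

Lemma isidB (A : comNzRingType) (P : A -> Prop) x y : isid P -> P x -> P y -> P (x - y).
Proof. by move=> h h1 h2; have [_ PD _] := h; apply: PD => //; apply: isidN. Qed.

Lemma isid_sum (A : comNzRingType) (P : A -> Prop) I (r : seq I) (Q : pred I) (f : I -> A) :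
  isid P -> (forall i, Q i -> P (f i)) -> P (\sum_(i <- r | Q i) f i).
Proof. by case=> *; apply: idl_sum. Qed.

Lemma isid0 (A : comNzRingType) : isid (fun x : A => x = 0).
Proof.
by split=> [//|x y -> ->|a x ->]; rewrite ?addr0 ?mulr0.
Qed.

Lemma prime_isid (A : comNzRingType) (P : {pred A}) : prime_ideal P -> isid (fun x => x \in P).
Proof.
case=> -[P0 _ PM] _; split=> // [x y hx hy|a x hx].
  by rewrite -[x]mul1r; apply: PM.
by rewrite -[_ * _]addr0; apply: PM.
Qed.

Section Dimension.
Variables (k : fieldType) (A : comNzRingType) (L : local_alg k A).
Notation io := (la_io L).

(** The [y i] generate an ideal of definition of the quotient by [P]; no minimality of their number
    is asked. *)
Definition sopP n (y : 'I_n -> A) (P : A -> Prop) :=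
  exists e, forall x, L e x -> idgen y P x.

(** Every element of [A] is a series over [k] in generators [x] of the maximal ideal, so modulo [y]
    and [z] the finitely many monomials in [x] of degree below [e] span over [k]; [complete_span]
    lifts this. The [z j] stand for an ideal modulo which the finiteness holds. *)
Lemma la_finite n (y : 'I_n -> A) (hy : forall i, L 1 (y i)) r (z : 'I_r -> A) :
  sopP y (idgen z (fun x => x = 0)) ->
  exists N (s : 'I_N -> A), forall a, exists (g : 'I_N -> mfps k n) (q : 'I_r -> A),
    a = \sum_j ev io hy (g j) * s j + \sum_j z j * q j.
Proof.
case=> e he; have [l [x [hx xgen]]] := la_gen L.
pose N := #|{: 'X_{1..l < e}}|.
pose s (j : 'I_N) := mmap1 x (enum_val j : 'X_{1..l < e}).
exists N, s; apply: complete_span => a.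
have span1 b : exists (c : 'I_1 -> k) (r : 'I_l -> A) (q : 'I_0 -> A),
    b = \sum_j io (c j) * 1 + \sum_i x i * r i + \sum_(j < 0) 0 * q j.
  have [c /xgen[h eh]] := la_res L b; exists (fun=> c), h, (fun=> 0).
  by rewrite big_ord1 big_ord0 mulr1 addr0 -eh addrC subrK.
have [g [q0 ea]] := complete_span hx span1 a.
move: ea; rewrite big_ord1 big_ord0 addr0 mulr1 => ea.
have /he[c [d hd]] : L e (a - mmap io x (mtr e (g ord0))).
  rewrite {1}ea -opprB; apply: filN; apply: evP; exact: mtr_agree.
exists (fun j => mfps_coef (g ord0) (enum_val j : 'X_{1..l < e})), c, d.
have -> : \sum_j io (mfps_coef (g ord0) (enum_val j : 'X_{1..l < e})) * s j = mmap io x (mtr e (g ord0)).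
  rewrite /s -(big_enum_val (fun m : 'X_{1..l < e} => io (mfps_coef (g ord0) m) * mmap1 x m)).
  rewrite /mtr raddf_sum /=.
  rewrite [RHS](eq_bigr (fun m : 'X_{1..l < e} => io (mfps_coef (g ord0) m) * mmap1 x m));
    last by move=> m _; rewrite mmapZ mmapX.
  by apply: eq_bigl => m.
move/eqP: hd; rewrite subr_eq0 => /eqP <-.
ring.
Qed.

(** [L (e * D)] is spanned by multiples of D-fold products from [L e]. Factors are split off one by
    one and collected in [xs]. *)
Lemma la_exp_sub (P Q : A -> Prop) e D : isid P ->
  (forall x, L e x -> Q x) ->
  (forall xs : seq A, size xs = D -> (forall x, x \in xs -> Q x) -> P (\prod_(x <- xs) x)) ->
  forall x, L (e * D)%N x -> P x.
Proof.
move=> idP HQ HP.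
suff H d (xs : seq A) : (size xs + d = D)%N -> (forall x, x \in xs -> Q x) ->
    forall x, L (e * d)%N x -> P (x * \prod_(x <- xs) x).
  by move=> x hx; have := H D [::] erefl (fun=> ltac:(by [])) x hx; rewrite big_nil mulr1.
elim: d xs => [|d IH] xs hs hxs x hx.
  have [_ _ PM] := idP; apply: PM; apply: HP => //; by rewrite addn0 in hs.
move: hx; rewrite mulnS => /la_prod[s hs' ->].
rewrite mulr_suml big_seq; apply: isid_sum => // u /hs'[h1 h2].
rewrite [u.1 * u.2]mulrC -mulrA.
have := IH (u.1 :: xs); rewrite big_cons; apply => //; first by rewrite /= addSnnS.
by move=> v; rewrite inE => /orP[/eqP ->|]; [apply: HQ | apply: hxs].
Qed.

Lemma la_nilpotent (I : A -> Prop) e D t : isid I -> I (t ^+ D) ->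
  (forall x, L e x -> exists b, I (x - t * b)) -> exists e', forall x, L e' x -> I x.
Proof.
move=> idI tD HQ; have [I0 ID IM] := idI.
pose Q x := exists b, I (x - t * b).
exists (e * D.+1)%N; apply: (la_exp_sub idI (Q := Q)) => // xs hs hxs.
have [b hb] : exists b, I (\prod_(x <- xs) x - t ^+ size xs * b).
  elim: xs {hs} hxs => [|x xs IH] hxs.
    by exists 1; rewrite big_nil expr0 mulr1 subrr.
  have [b hb] : exists b, I (\prod_(x <- xs) x - t ^+ size xs * b).
    by apply: IH => v hv; apply: hxs; rewrite inE hv orbT.
  have [c hc] := hxs x (mem_head _ _).
  exists (c * b); rewrite big_cons /= exprS.
  have -> : t * t ^+ size xs * (c * b) = (t * c) * (t ^+ size xs * b) by ring.
  exact: idl_cgM.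
rewrite -(subrK (t ^+ size xs * b) (\prod_(x <- xs) x)); apply: ID => //.
rewrite mulrC; apply: (IM); rewrite hs exprS; exact: IM.
Qed.

(** The generators are disposed of one at a time: the first is nilpotent modulo [I] and the
    remaining ones. *)
Lemma la_nilpotent_gen n (x : 'I_n -> A) (I : A -> Prop) e q : isid I ->
  (forall i, I (x i ^+ q)) -> (forall a, L e a -> idgen x I a) ->
  exists e', forall a, L e' a -> I a.
Proof.
elim: n x I e => [|n IH] x I e idI xq hx.
  by exists e => a /hx[c]; rewrite big_ord0 subr0.
pose I' := idgen (fun i => x (lift ord0 i)) I.
have [] := @la_nilpotent I' e q (x ord0) (idgen_isid _ idI).
- exact/idgen_P/xq.
- move=> a /hx[c hc]; exists (c ord0), (fun i => c (lift ord0 i)).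
  by move: hc; rewrite big_ord_recl opprD addrA.
by move=> e' he'; apply: IH he' => // i; apply: xq.
Qed.

(* One coordinate fewer: if f(y) lies in P, then after the change of
   coordinates of straight_pt a power of the last coordinate lies in the ideal
   generated by P and the remaining ones. *)
Lemma noether_step n (y : 'I_n.+1 -> A) (hy : forall i, L 1 (y i)) (P : A -> Prop) f :
  isid P -> sopP y P -> f != 0 -> P (ev io hy f) ->
  exists2 y' : 'I_n -> A, forall i, L 1 (y' i) & sopP y' P.
Proof.
move=> idP [e0 he0] nzf Pf.
have [e [e1 egt cnz]] := curve_neq0 nzf; have {cnz} cnz := cnz egt.
have [f' ef] := straight_surj egt f.
pose t := y ord_max.
pose y' (i : 'I_n.+1) := if i == ord_max then t else y i - t ^+ e i.
have hy' i : L 1 (y' i).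
  rewrite /y'; case: ifP => _; first exact: hy.
  apply: filB; first exact: hy.
  by apply: filX_gt0 => //; exact: hy.
have ev' : ev io hy f = ev io hy' f'.
  rewrite -ef /straight; apply: ev_comp => [M x|c|i]; first exact: ev_fil.
    exact: ev_C.
  rewrite /straight_pt /y'; case: eqP => _; first by rewrite /= ev_X.
  by rewrite rmorphB rmorphXn /= !ev_X.
have rnz : rho ord_max f' != 0 by rewrite -(curve_straight e1 egt) ef.
pose z (i : 'I_n) := y' (lift ord_max i).
exists z; first by move=> i; exact: hy'.
have idI := idgen_isid z idP; have [I0 ID IM] := idI.
(* On the last axis [f'] is t^D times a unit for some D. Multiplying by a lift of the inverse unit
   shows that t^D is a multiple of [f] plus terms in the remaining coordinates. *)
have [D tD] : exists D, idgen z P (t ^+ D).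
  pose Q i := cf (rho ord_max f') i != 0.
  have exQ : exists i, Q i.
    apply: contrapT => H; case/eqP: rnz; apply: cfP => i; apply/eqP/negP => /negP h.
    by apply: H; exists i; rewrite /Q h.
  case: (ex_minnP exQ) => D QD minD; exists D.
  have [u [hu _]] := cf_shift D (rho ord_max f').
  have [|u' eu'] := @cf_dvd _ D (rho ord_max f').
    move=> i lt; apply/eqP/negP => /negP h; have := minD i h; by rewrite leqNgt lt.
  have [v uv] : exists v, u' * v = 1.
    apply: mfps_inverse1; move: QD; rewrite /Q eu' cf_tM leqnn subnn; exact.
  have /rho_eq0[h eh] : rho ord_max (f' * axis_in ord_max v - mfpsX k ord_max ^+ D) = 0.
    rewrite rmorphB rmorphM axis_inK rmorphXn /= [ev _ _ (mfpsX _ _)]ev_X /axis_pt eqxx.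
    by rewrite eu' -mulrA uv mulr1 subrr.
  have := congr1 (ev io hy') eh.
  rewrite rmorphB rmorphM rmorphXn /= ev_X -ev' {2}/y' eqxx => e2.
  have -> : t ^+ D = ev io hy f * ev io hy' (axis_in ord_max v) -
     ev io hy' (\sum_(i | i != ord_max) mfpsX k i * h i) by rewrite -e2; ring.
  apply: isidB => //; first by rewrite mulrC; apply: IM; apply: idgen_P.
  rewrite rmorph_sum; apply: isid_sum => // i; case: (unliftP ord_max i) => [i' -> _|-> /eqP //].
  by rewrite rmorphM /= ev_X mulrC; apply: IM; apply: (@idgen_y _ _ z P i').
(* Modulo the new coordinates [z] each [y i] equals t^(e i), hence is a multiple of t. *)
pose Q x := exists b, idgen z P (x - t * b).
have HQ x : L e0 x -> Q x.
  case/he0 => c hc; exists (\sum_i t ^+ (e i).-1 * c i).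
  have -> : x - t * \sum_i t ^+ (e i).-1 * c i = (x - \sum_i y i * c i) + \sum_i (y i - t ^+ e i) * c i.
    rewrite mulr_sumr -addrA; congr (_ + _); rewrite -sumrN -sumrN -big_split /=.
    by apply: eq_bigr => i _; rewrite mulrA -exprS prednK // mulrBl addrA addNr add0r.
  apply: ID; first exact: idgen_P.
  apply: isid_sum => // i _; rewrite mulrC; apply: IM.
  case: (unliftP ord_max i) => [i' ->|->].
    have := @idgen_y _ _ z P i' idP; rewrite /z /y'.
    by rewrite eq_sym (negbTE (neq_lift _ _)).
  by rewrite -/t e1 expr1 subrr.
exact: (la_nilpotent idI tD HQ).
Qed.

End Dimension.

Lemma char_poly_horner (R : comNzRingType) N (M : 'M[R]_N) a :
  (char_poly M).[a] = \det (a%:M - M).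
Proof.
rewrite -[LHS]/(horner_eval a _) /char_poly -det_map_mx; congr (\det _).
by apply/matrixP => i j; rewrite !mxE /= /horner_eval !(hornerE, hornerMn).
Qed.

Section ChainBound.
Variables (k : fieldType) (A : comNzRingType) (L : local_alg k A).
Hypothesis noeth : noetherian_ring A.
Notation io := (la_io L).

Lemma prime_fg (P : {pred A}) : prime_ideal P ->
  exists r (z : 'I_r -> A), forall x, x \in P <-> idgen z (fun x => x = 0) x.
Proof.
case=> /noeth[s hs] _; exists (size s), (fun i => s`_i) => x; rewrite hs; split.
  by case=> c _ ->; exists c; under eq_bigr do rewrite mulrC; rewrite subrr.
case=> c /eqP; rewrite subr_eq0 => /eqP ->; exists c => //.
by apply: eq_bigr => i _; rewrite mulrC.
Qed.

Lemma idgen_sub n (y : 'I_n -> A) (P Q : A -> Prop) x :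
  (forall x, P x -> Q x) -> idgen y P x -> idgen y Q x.
Proof. by move=> H [c hc]; exists c; apply: H. Qed.

Lemma prime_exp (P : {pred A}) x n : prime_ideal P -> x ^+ n \in P -> x \in P.
Proof.
move=> [[P0 P1 PM] Pp]; elim: n => [|n IH]; first by rewrite expr0 (negbTE P1).
by rewrite exprS => /Pp/orP[].
Qed.

(** Multiplication by [a] acts on the finitely many generators given by [la_finite]; the
    characteristic polynomial of its matrix kills [a] modulo [P]. *)
Lemma integral_mod n (y : 'I_n -> A) (hy : forall i, L 1 (y i)) (P : {pred A}) a :
  prime_ideal P -> sopP L y (fun x => x \in P) ->
  exists2 q : {poly mfps k n}, q \is monic & (map_poly (ev io hy) q).[a] \in P.
Proof.
move=> pP [e he]; have idP := prime_isid pP.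
have [r [z hz]] := prime_fg pP.
have [|N [s hs]] := @la_finite _ _ L n y hy r z.
  by exists e => x /he; apply: idgen_sub => v /hz.
have [g hg] := choice (fun i : 'I_N => hs (a * s i)).
pose M := \matrix_(i, j) g i j.
exists (char_poly M); first exact: char_poly_monic.
have dP j : \det (a%:M - map_mx (ev io hy) M) * s j \in P.
  have [P0 PD PM] := idP.
  apply: (@idl_det _ (fun x => x \in P) P0 PD PM) => i; apply/hz.
  have [q hq] := hg i; exists q.
  rewrite (eq_bigr (fun l => (if i == l then a * s l else 0) - ev io hy (g i l) * s l)); last first.
    by move=> l _; rewrite !mxE mulrBl; congr (_ - _); case: eqP; rewrite ?mulr1n // mul0r.
  rewrite sumrB -big_mkcond /= (big_pred1 i) => [|l]; last by rewrite eq_sym.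
  by rewrite hq; ring.
have [g1 [q1 e1]] := hs 1.
rewrite map_char_poly char_poly_horner; set D := \det _; rewrite -[D]mulr1 e1 mulrDr.
have [P0 PD PM] := idP; apply: (PD).
  rewrite mulr_sumr; elim/big_ind: _ => // j _; rewrite mulrCA.
  by apply: (PM _ _ (dP j)).
by apply: (PM D (\sum_j z j * q1 j)); apply/hz; exists q1; exact: subrr.
Qed.

Lemma chain_bound n (y : 'I_n -> A) (hy : forall i, L 1 (y i)) l c :
  prime_chain l c -> sopP L y (fun x => x \in c 0%N) -> (l <= n)%N.
Proof.
elim: n y hy l c => [|n IH] y hy [|l] c // [pc sc] sy.
  (* Without parameters [c 0] contains a power of the maximal ideal, hence all of it, so an element
     of [c 1] outside [c 0] would be a unit. *)
  have p0 := pc 0%N isT; have [s01 ns] := sc 0%N isT; case: ns => x x1.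
  have [//|x0] := boolP (x \in c 0%N).
  have p1 := pc 1%N isT.
  have [F1|nF1] := pselect (L 1 x).
    case: sy => e he; have [d] := he _ (filX e F1).
    by rewrite big_ord0 subr0 => /(prime_exp p0); rewrite (negbTE x0).
  have [v xv] := la_unit nF1; have [_ _ PM] := prime_isid p1.
  have : 1 \in c 1%N by rewrite -xv mulrC; apply: PM.
  by case: p1 => -[_ /negP].
have p0 := pc 0%N isT; have [s01 ns] := sc 0%N isT; have p1 := pc 1%N isT.
have [a [a1 a0]] : exists a, a \in c 1%N /\ a \notin c 0%N.
  apply: contrapT => H; apply: ns => x x1; apply/negP => /negP x0.
  by apply: H; exists x.
pose ph : {rmorphism mfps k n.+1 -> A} := ev io hy.
(* An equation of least size: if its constant term lay in [c 0], the factor [a], which is outside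
   that prime, could be cancelled. *)
pose Q s := `[< exists q : {poly mfps k n.+1},
   [/\ size q = s, (map_poly ph q).[a] \in c 0%N & ph (lead_coef q) \notin c 0%N] >].
have exQ : exists s, Q s.
  have [q mq hq] := integral_mod hy a p0 sy; exists (size q); apply/asboolP; exists q.
  split=> //; rewrite (eqP mq) rmorph1; by case: p0 => -[].
case: (ex_minnP exQ) => s /asboolP[q [sq q0 lq]] mins.
have id0 := prime_isid p0; have id1 := prime_isid p1.
have qdec : q = 'X * (\poly_(i < s.-1) q`_i.+1) + (q`_0)%:P.
  apply/polyP => -[|i]; rewrite coefD coefXM coefC /= ?add0r // addr0 coef_poly.
  case: ltnP => // h; rewrite nth_default // sq.
  by case: (s) h.
have hdec : (map_poly ph q).[a] = a * (map_poly ph (\poly_(i < s.-1) q`_i.+1)).[a] + ph q`_0.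
  by rewrite {1}qdec rmorphD rmorphM /= map_polyX map_polyC hornerD hornerM hornerX hornerC.
have nq0 : ph q`_0 \notin c 0%N.
  apply/negP => h0; case: p0 => [_ /(_ a (map_poly ph (\poly_(i < s.-1) q`_i.+1)).[a])].
  have -> : a * (map_poly ph (\poly_(i < s.-1) q`_i.+1)).[a] = (map_poly ph q).[a] - ph q`_0.
    by rewrite hdec addrK.
  have h1 : (map_poly ph q).[a] - ph q`_0 \in c 0%N by apply: (isidB id0).
  move=> /(_ h1); rewrite (negbTE a0) /= => h2.
  have [s1|s1] := leqP s 1.
    case/negP: lq; rewrite /lead_coef sq.
    by case: (s) s1 => [|[|]].
  suff /mins : Q s.-1 by rewrite leqNgt prednK ?leqnn // ltnW.
  apply/asboolP.
  have sz : size (\poly_(i < s.-1) q`_i.+1) = s.-1.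
    apply: size_poly_eq; case: (s) s1 sq => [|[|s']] // _ sq /=.
    by apply: contraNneq lq; rewrite /lead_coef sq /= => ->; rewrite rmorph0; case: id0.
  exists (\poly_(i < s.-1) q`_i.+1); split=> //.
  rewrite /lead_coef sz coef_poly; move: lq; rewrite /lead_coef sq.
  by case: (s) s1 => [|[|s']] //= _; rewrite ltnSn.
have q1 : ph q`_0 \in c 1%N.
  have -> : ph q`_0 = (map_poly ph q).[a] - a * (map_poly ph (\poly_(i < s.-1) q`_i.+1)).[a].
    by rewrite hdec; ring.
  by apply: (isidB id1); [apply: s01 | rewrite mulrC; case: id1 => _ _; apply].
have nz : q`_0 != 0.
  by apply: contraNneq nq0 => ->; rewrite rmorph0; case: id0.
have sy1 : sopP L y (fun x => x \in c 1%N).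
  by case: sy => e he; exists e => x /he; apply: idgen_sub => v; apply: s01.
have [y' hy' sy'] := noether_step id1 sy1 nz q1.
rewrite ltnS; apply: (IH y' hy' l (fun i => c i.+1)) => //.
by split=> i hi; [apply: pc | apply: sc].
Qed.

End ChainBound.

(* Zorn_bigcup also asks for the union of the empty chain. *)
Lemma zorn_sets (T : Type) (P : (T -> Prop) -> Prop) (X0 : T -> Prop) :
  (exists x, X0 x) -> P X0 ->
  (forall F : (T -> Prop) -> Prop, (exists X, F X) -> (forall X, F X -> P X) ->
     (forall X Y, F X -> F Y -> (forall x, X x -> Y x) \/ (forall x, Y x -> X x)) ->
     P (fun x => exists2 X, F X & X x)) ->
  exists2 X, P X & forall Y, P Y -> (forall x, X x -> Y x) -> forall x, Y x -> X x.
Proof.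
move=> [x0 Xx0] PX0 Hch.
have [|X [PX maxX]] := @classical_sets.Zorn_bigcup T (fun X => P X \/ (forall x, ~ X x)).
  move=> F FP Ftot; have [[X [FX PX]]|none] := pselect (exists X, F X /\ exists x, X x); last first.
    right=> x [X FX Xx]; apply: none; exists X; split=> //; by exists x.
  left; have e : classical_sets.bigcup F id = (fun x => exists2 Y, (F Y /\ exists x, Y x) & Y x).
    apply/funext => x; apply/propext; split=> [[Y FY Yx]|[Y [FY _] Yx]]; exists Y => //.
    by split=> //; exists x.
  rewrite e; apply: (Hch (fun Y => F Y /\ exists x, Y x)).
  - by exists X.
  - by move=> Y [FY [y Yy]]; case: (FP _ FY) => // /(_ y).
  - by move=> Y Z [FY _] [FZ _]; apply: Ftot.
have PX' : P X.
  case: PX => // Xe; exfalso; apply: (maxX X0); last by left.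
  by split=> [x /Xe|] // /(_ x0 Xx0)/Xe.
exists X => // Y PY XY x Yx; apply: contrapT => nX.
by apply: (maxX Y); [split=> // /(_ x Yx) | left].
Qed.

(** * Going up and the length of chains of primes *)

Section GoingUp.
Variables (B A : comNzRingType) (phi : {rmorphism B -> A}) (N : nat) (s : 'I_N -> A).
Hypothesis phi_fin : forall a, exists g : 'I_N -> B, a = \sum_j phi (g j) * s j.
Variables (p q : B -> Prop) (I : {pred A}).
Hypotheses (q_id : isid q) (q1 : ~ q 1) (q_prime : forall b c, q (b * c) -> q b \/ q c).
Hypotheses (pq : forall b, p b -> q b) (I_prime : prime_ideal I).
Hypothesis I_p : forall b, phi b \in I -> p b.

(** The ideal generated by [I] and the image of [q], with coefficients on the module generators [s]
    so that the determinant trick applies to it. *)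
Let J0 x := exists c : 'I_N -> B, (forall j, q (c j)) /\ x - \sum_j phi (c j) * s j \in I.

Let idI := prime_isid I_prime.

Let J0_id : isid J0.
Proof.
have [I0 ID IM] := idI; have [q0 qD qM] := q_id; split.
- by exists (fun=> 0); split=> //; rewrite big1 ?subr0 // => j _; rewrite rmorph0 mul0r.
- move=> x y [c [qc hc]] [d [qd hd]]; exists (fun j => c j + d j).
  split=> [j|]; first exact: qD.
  under eq_bigr do rewrite rmorphD mulrDl.
  by rewrite big_split /= opprD addrACA; apply: (ID _ _ hc hd).
- move=> a x [c [qc hc]].
  have [g hg] := choice (fun j : 'I_N => phi_fin (a * s j)).
  exists (fun l => \sum_j g j l * c j); split=> [l|].
    by apply: (isid_sum _ q_id) => j _; apply: qM.
  have -> : a * x - \sum_l phi (\sum_j g j l * c j) * s l = a * (x - \sum_j phi (c j) * s j).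
    rewrite mulrBr; congr (_ - _); rewrite mulr_sumr.
    under eq_bigr do rewrite rmorph_sum mulr_suml.
    rewrite exchange_big /=; apply: eq_bigr => j _.
    rewrite mulrCA hg mulr_sumr; apply: eq_bigr => l _.
    by rewrite rmorphM; ring.
  exact: (IM a _ hc).
Qed.

(* An element of J0 coming from B is integral over q modulo I, hence lies in q. *)
Let J0_q b : J0 (phi b) -> q b.
Proof.
case=> c [qc hc]; have [I0 ID IM] := idI; have [q0 qD qM] := q_id.
pose x := \sum_j phi (c j) * s j.
have hs i : exists h : 'I_N -> 'I_N -> B, forall j, s i * s j = \sum_l phi (h j l) * s l.
  by have [h hh] := choice (fun j : 'I_N => phi_fin (s i * s j)); exists h.
have [h hh] := choice hs.
pose C : 'M[B]_N := \matrix_(i, l) \sum_j c j * h i j l.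
have xs i : x * s i = \sum_l phi (C i l) * s l.
  rewrite /x mulr_suml; under [RHS]eq_bigr do rewrite mxE rmorph_sum mulr_suml.
  rewrite exchange_big /=; apply: eq_bigr => j _.
  rewrite -mulrA [s j * s i]mulrC hh mulr_sumr; apply: eq_bigr => l _.
  by rewrite rmorphM mulrA.
have qC i l : q (C i l).
  by rewrite mxE; apply: (isid_sum _ q_id) => j _; rewrite mulrC; apply: (qM).
clearbody C.
have detI j : \det (map_mx phi (b%:M - C)) * s j \in I.
  apply: (@idl_det _ (fun x => x \in I) I0 ID IM) => i.
  have -> : \sum_l map_mx phi (b%:M - C) i l * s l = (phi b - x) * s i.
    rewrite mulrBl xs.
    rewrite (eq_bigr (fun l => (if i == l then phi b * s l else 0) - phi (C i l) * s l)).
      by rewrite sumrB -big_mkcond /= (big_pred1 i) // => l; rewrite eq_sym.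
    move=> l _; rewrite !mxE rmorphB mulrBl; congr (_ - _).
    by case: eqP; rewrite ?mulr1n // rmorph0 mul0r.
  by rewrite mulrC; apply: (IM (s i) _ hc).
have [g1 e1] := phi_fin 1.
have /I_p/pq : phi (\det (b%:M - C)) \in I.
  rewrite -det_map_mx -[X in X \in _]mulr1 e1 mulr_sumr.
  elim/big_ind: _ => // j _; rewrite mulrCA; exact: (IM _ _ (detI j)).
move=> qdet.
have /(qD _ _ qdet) : q (- (\det (b%:M - C) - \det (b%:M : 'M_N))).
  apply: (isidN q_id); apply: (idl_cg_det q0 qD qM) => i j.
  by rewrite !mxE addrAC subrr add0r; apply: (isidN q_id).
rewrite opprB addrCA subrr addr0 det_scalar.
elim: (N) => [|n IH]; first by rewrite expr0 => /q1.
by rewrite exprS => /q_prime[].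
Qed.

(** Zorn's lemma gives an ideal maximal among those that contain [J0] and contract into [q]. It is
    prime because elements outside it bring in, up to multiples, elements of [B] outside [q], and
    [q] is prime. *)
Lemma going_up : exists J : {pred A}, [/\ prime_ideal J, {subset I <= J}
  & forall b, phi b \in J <-> q b].
Proof.
have [q0 qD qM] := q_id; have [I0 ID IM] := idI.
pose good (X : A -> Prop) := [/\ isid X, forall x, J0 x -> X x & forall b, X (phi b) -> q b].
have [|||X [idX JX Xq] maxX] := @zorn_sets A good J0.
- by exists 0; case: J0_id.
- by split; [exact: J0_id | | exact: J0_q].
- move=> F [X0 FX0] Fg Fch; split.
  + split.
    * by exists X0 => //; case: (Fg _ FX0) => -[].
    * move=> x y [X FX Xx] [Y FY Yy]; case: (Fch _ _ FX FY) => H.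
        exists Y => //; case: (Fg _ FY) => -[_ YD _] _ _; apply: YD => //; exact: H.
      exists X => //; case: (Fg _ FX) => -[_ XD _] _ _; apply: XD => //; exact: H.
    * move=> a x [X FX Xx]; exists X => //; case: (Fg _ FX) => -[_ _ XM] _ _; exact: XM.
  + by move=> x Jx; exists X0 => //; case: (Fg _ FX0) => _ JX _; apply: JX.
  + by move=> b [X FX Xb]; case: (Fg _ FX) => _ _; apply.
have [X0 XD XM] := idX.
(* Maximality: the ideal generated by [X] and [u] no longer contracts into [q]. *)
have ext u : ~ X u -> exists a b, X (phi b - a * u) /\ ~ q b.
  move=> nXu; apply: contrapT => H; apply: nXu.
  apply: (maxX (fun x => exists a, X (x - a * u))).
  - split.
    + split.
      * by exists 0; rewrite mul0r subr0.
      * by move=> x y [a ha] [c hc]; exists (a + c); rewrite mulrDl opprD addrACA; apply: XD.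
      * by move=> a x [c hc]; exists (a * c); rewrite -mulrA -mulrBr; apply: XM.
    + by move=> x /JX Xx; exists 0; rewrite mul0r subr0.
    + by move=> b [a ha]; apply: contrapT => nq; apply: H; exists a, b.
  - by move=> x Xx; exists 0; rewrite mul0r subr0.
  - by exists 1; rewrite mul1r subrr.
exists ([pred x | `[< X x >]] : {pred A}); split.
- split; [split|].
  + by apply/asboolP.
  + apply/asboolP => X1; apply: q1; apply: Xq; by rewrite rmorph1.
  + by move=> a x y /asboolP Xx /asboolP Xy; apply/asboolP/XD => //; apply: XM.
  + move=> u v /asboolP Xuv; apply/negPn/negP; rewrite negb_or.
    move=> /andP[/asboolP/ext[a [b [hb nb]]] /asboolP/ext[a' [b' [hb' nb']]]].
    have : q (b * b').
      apply: Xq; rewrite rmorphM -(subrK (a * u * (a' * v)) (_ * _)); apply: (XD).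
        exact: (idl_cgM XD XM).
      have -> : a * u * (a' * v) = a * a' * (u * v) by ring.
      exact: XM.
    by case/q_prime.
- move=> x Ix; apply/asboolP/JX; exists (fun=> 0); split=> //.
  by rewrite big1 ?subr0 // => j _; rewrite rmorph0 mul0r.
- move=> b; split=> [/asboolP/Xq //|qb]; apply/asboolP/JX.
  have [g1 e1] := phi_fin 1; exists (fun j => g1 j * b); split=> [j|]; first exact: qM.
  have -> : \sum_j phi (g1 j * b) * s j = phi b.
    rewrite -[RHS]mulr1 e1 mulr_sumr; apply: eq_bigr => j _; rewrite rmorphM; ring.
  by rewrite subrr.
Qed.

End GoingUp.

Lemma pred1_prime (A : idomainType) : prime_ideal (pred1 (0 : A)).
Proof.
split; first split; rewrite ?inE ?eqxx ?oner_eq0 //.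
  by move=> a x y; rewrite !inE => /eqP -> /eqP ->; rewrite mulr0 addr0.
by move=> x y; rewrite !inE mulf_eq0.
Qed.

Section ChainExists.
Variables (k : fieldType) (n : nat).

(* Membership in the ideal of the last j variables, read off the coefficients. *)
Definition pX j (f : mfps k n) := forall m : 'X_{1..n},
  (forall i : 'I_n, (n - j <= i)%N -> m i = 0%N) -> mfps_coef f m = 0.

Lemma pX_isid j : isid (pX j).
Proof.
split=> [//|f g hf hg m hm|a f hf m hm]; first by rewrite mfps_coefD hf // hg // addr0.
apply: mfps_coefM_eq0 => c d e; rewrite [mfps_coef f d]hf ?mulr0 // => i hi.
by apply/eqP; rewrite -leqn0 -(hm i hi) -e mnmDE leq_addl.
Qed.

(** [rs] sets the last [j] variables to 0, so its kernel is the ideal in question, and its values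
    lie in a domain. *)
Lemma pX_prime j f g : pX j (f * g) -> pX j f \/ pX j g.
Proof.
move=> hfg.
pose ok (m : 'X_{1..n}) := [forall i : 'I_n, (n - j <= i)%N ==> (m i == 0%N)].
have okP (m : 'X_{1..n}) : reflect (forall i : 'I_n, (n - j <= i)%N -> m i = 0%N) (ok m).
  apply: (iffP forallP) => [H i hi|H i]; first by have := H i; rewrite hi => /eqP.
  by apply/implyP => hi; rewrite H.
pose rs (f : mfps k n) : mfps k n := Mfps (fun m => if ok m then mfps_coef f m else 0).
have rs0 f' : rs f' = 0 -> pX j f'.
  move=> e m /okP hm; have := congr1 (fun u => mfps_coef u m) e.
  by rewrite mfps_coefE hm.
have : rs f * rs g = 0.
  apply: mfpsP => m; have [hm|nhm] := boolP (ok m).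
    rewrite -[RHS](hfg m); last exact/okP.
    rewrite !mfps_coefM; apply: eq_bigr => h /eqP e.
    have okh : ok h.1 /\ ok h.2.
      have mi i : m i = (h.1 i + h.2 i)%N by rewrite -mnmDE -e.
      by split; apply/okP => i /(okP _ hm); rewrite mi => /eqP; rewrite addn_eq0 => /andP[/eqP ? /eqP ?].
    by rewrite !mfps_coefE; case: okh => -> ->.
  apply: mfps_coefM_eq0 => a b e; rewrite !mfps_coefE.
  case: ifP => [ha|_]; last by rewrite mul0r.
  case: ifP => [hb|_]; last by rewrite mulr0.
  case/negP: nhm; apply/okP => i hi; rewrite -e mnmDE.
  by rewrite (okP _ ha) // (okP _ hb).
by move/eqP; rewrite mulf_eq0 => /orP[] /eqP /rs0; [left | right].
Qed.

Lemma pX_proper j : ~ pX j 1.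
Proof.
move=> h; have /eqP := h 0%MM (fun i _ => mnm0E i).
by rewrite mfps_coef1 eqxx oner_eq0.
Qed.

Lemma pX_sub j f : pX j f -> pX j.+1 f.
Proof.
move=> h m hm; apply: h => i hi; apply: hm; apply: leq_trans hi.
by rewrite leq_sub2l.
Qed.

Lemma pX_strict j : (j < n)%N -> exists2 f, pX j.+1 f & ~ pX j f.
Proof.
move=> lt; have li : (n - j.+1 < n)%N by lia.
pose i := Ordinal li; exists (mfpsX k i).
  move=> m hm; rewrite mfps_coefXm; case: eqP => // e.
  by have := hm i (leqnn _); rewrite e mnm1E eqxx.
move=> h; have /eqP : mfps_coef (mfpsX k i) U_(i)%MM = 0.
  by apply: h => i0 hi0; rewrite mnm1E; case: eqP => // e; move: hi0; rewrite -e /=; lia.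
by rewrite mfps_coefXm eqxx oner_eq0.
Qed.

Variables (A : idomainType) (phi : {rmorphism mfps k n -> A}).
Hypothesis phi_inj : injective phi.
Variables (N : nat) (s : 'I_N -> A).
Hypothesis phi_fin : forall a, exists g : 'I_N -> mfps k n, a = \sum_j phi (g j) * s j.

(** Going up lifts the coordinate ideals one by one, starting from the zero ideal; the inclusions
    stay strict because the contractions are. *)
Lemma chain_exists : exists c : nat -> {pred A}, prime_chain n c.
Proof.
have H j : (j <= n)%N -> exists c : nat -> {pred A},
    [/\ forall i, (i <= j)%N -> prime_ideal (c i),
        forall i, (i <= j)%N -> forall b, phi b \in c i <-> pX i b
      & forall i, (i < j)%N -> {subset c i <= c i.+1}].
  elim: j => [|j IH] lej.
    exists (fun=> pred1 0 : {pred A}); split=> // i; rewrite leqn0 //; first by move=> _; exact: pred1_prime.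
    move=> /eqP -> b; rewrite inE -(rmorph0 phi) (inj_eq phi_inj); split=> [/eqP -> m //|h].
    by apply/eqP; apply: mfpsP => m; rewrite h // => l; rewrite subn0 leqNgt ltn_ord.
  have [c [pc hc sc]] := IH (ltnW lej).
  have [J [pJ IJ hJ]] := @going_up _ _ phi N s phi_fin (pX j) (pX j.+1) (c j)
     (pX_isid j.+1) (@pX_proper j.+1) (@pX_prime j.+1) (@pX_sub j) (pc j (leqnn j))
     (fun b => (hc j (leqnn j) b).1).
  exists (fun i => if (i <= j)%N then c i else J); split=> i hi.
  - by case: ifP => // h; apply: pc.
  - case: leqP => h; first exact: hc.
    by have -> : i = j.+1 by apply/eqP; rewrite eqn_leq hi h.
  - have ij : (i <= j)%N by rewrite -ltnS.
    rewrite ij; case: leqP => h; last exact: sc.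
    by have -> : i = j by apply/eqP; rewrite eqn_leq ij h.
have [c [pc hc sc]] := H n (leqnn n); exists c; split=> // i hi; split; first exact: sc.
move=> sub; have [f hf nf] := pX_strict hi; apply: nf.
by apply/hc; [exact: ltnW | apply: sub; apply/hc].
Qed.

End ChainExists.

Section DimensionTheorem.
Variables (k : fieldType) (A : idomainType) (L : local_alg k A) (d : nat).
Hypotheses (noeth : noetherian_ring A) (dimA : has_krull_dim A d).
Notation io := (la_io L).

Definition sop n (y : 'I_n -> A) := sopP L y (fun x => x = 0).

Lemma sop_dim_le n (y : 'I_n -> A) : (forall i, L 1 (y i)) -> sop y -> (d <= n)%N.
Proof.
move=> hy [e he]; have [[c hc] _] := dimA.
apply: (chain_bound noeth hy hc); exists e => x /he; apply: idgen_sub => v ->.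
by case: hc => /(_ 0%N isT) /prime_isid[].
Qed.

Lemma sop_finite n (y : 'I_n -> A) (hy : forall i, L 1 (y i)) : sop y ->
  exists N (s : 'I_N -> A), forall a, exists g : 'I_N -> mfps k n,
    a = \sum_j ev io hy (g j) * s j.
Proof.
move=> [e he]; have [|N [s hs]] := @la_finite _ _ L n y hy 0 (fun=> 0).
  exists e => x /he; apply: idgen_sub => v ->; exists (fun=> 0); by rewrite big_ord0 subrr.
exists N, s => a; have [g [q0 ->]] := hs a; exists g.
by rewrite big_ord0 addr0.
Qed.

Lemma ev0_inj (y : 'I_0 -> A) (hy : forall i, L 1 (y i)) : injective (ev io hy).
Proof.
have E (f : mfps k 0) : f = mfpsC 0 (mfps_coef f 0%MM).
  apply: mfpsP => m; have -> : m = 0%MM by apply/mnmP => -[].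
  by rewrite mfps_coefC eqxx mulr1.
by move=> f g; rewrite (E f) (E g) !ev_C => /fmorph_inj ->.
Qed.

Lemma ev_injP n (y : 'I_n -> A) (hy : forall i, L 1 (y i)) :
  (forall f, ev io hy f = 0 -> f = 0) -> injective (ev io hy).
Proof. by move=> H; apply: raddf_inj. Qed.

(** Take a system with the least number [n] of elements. A nonzero series vanishing on it would let
    [noether_step] remove one element, so the series in it embed into [A], and a chain of coordinate
    primes of length [n] lifts to [A]. *)
Lemma sop_exists : exists2 y : 'I_d -> A, forall i, L 1 (y i) & sop y.
Proof.
pose P n := `[< exists2 y : 'I_n -> A, forall i, L 1 (y i) & sop y >].
have exP : exists n, P n.
  have [l [x [hx xgen]]] := la_gen L; exists l; apply/asboolP; exists x => //.
  by exists 1%N => a /xgen[b ->]; exists b; rewrite subrr.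
case: (ex_minnP exP) => n /asboolP[y hy sy] minn.
suff -> : d = n by exists y.
apply/eqP; rewrite eqn_leq (sop_dim_le hy sy) /=.
have inj : injective (ev io hy).
  case: n y hy sy minn => [|n] y hy sy minn; first exact: ev0_inj.
  apply: ev_injP => f f0; apply/eqP/negP => /negP nz.
  have [y' hy' sy'] := noether_step (isid0 A) sy nz f0.
  by have := minn n; rewrite ltnn; apply/implyP/asboolP; exists y'.
have [N [s hs]] := sop_finite hy sy.
have [c hc] := chain_exists inj hs.
by have [_ /(_ _ _ hc)] := dimA.
Qed.

(** A relation would produce a system with fewer than [d] elements, against [sop_dim_le]. *)
Lemma sop_inj (y : 'I_d -> A) (hy : forall i, L 1 (y i)) : sop y -> injective (ev io hy).
Proof.
move=> sy; have := @sop_dim_le; move: y hy sy; case: (d) => [|n] y hy sy dimle; first exact: ev0_inj.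
apply: ev_injP => f f0; apply/eqP/negP => /negP nz.
have [y' hy' sy'] := noether_step (isid0 A) sy nz f0.
by have := dimle n y' hy' sy'; rewrite ltnn.
Qed.

End DimensionTheorem.

(** * Coefficient fields *)

Section Hensel.
Variables (A : comNzRingType) (F : cfilt A) (k : fieldType) (pi : {rmorphism A -> k}).
Hypothesis F1 : forall x, F 1 x <-> pi x = 0.
Hypothesis pi_unit : forall x, pi x != 0 -> exists y, x * y = 1.

Lemma horner_sub (p : {poly A}) x y : exists r, p.[x] - p.[y] = (x - y) * r.
Proof.
elim/poly_ind: p => [|p c [r hr]]; first by exists 0; rewrite !horner0 subrr mulr0.
exists (p.[x] + y * r); rewrite !hornerMXaddC.
have -> : p.[x] * x + c - (p.[y] * y + c) = (x - y) * p.[x] + y * (p.[x] - p.[y]) by ring.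
by rewrite hr; ring.
Qed.

Lemma horner_taylor2 (p : {poly A}) x e :
  exists r, p.[x + e] = p.[x] + p^`().[x] * e + e ^+ 2 * r.
Proof.
elim/poly_ind: p => [|p c [r hr]]; first by exists 0; rewrite linear0 !horner0; ring.
exists (r * (x + e) + p^`().[x]); rewrite derivD derivC addr0 derivM derivX mulr1.
by rewrite !hornerE hr; ring.
Qed.

Lemma hensel_root (p : {poly A}) a0 : pi p.[a0] = 0 -> pi p^`().[a0] != 0 ->
  exists2 a, p.[a] = 0 & pi a = pi a0.
Proof.
move=> p0 /pi_unit[u hu].
(* Newton's iteration with the slope frozen at [a0]; linear convergence is enough. *)
pose s := fix s n := if n is n'.+1 then s n' - p.[s n'] * u else a0.
have hs n : F n.+1 p.[s n] /\ pi (s n) = pi a0.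
  elim: n => [|n [IH1 IH2]]; first by split=> //; apply/F1.
  have pn0 : pi p.[s n] = 0 by apply/F1; apply: filW IH1.
  split; last by rewrite /= rmorphB rmorphM /= pn0 mul0r subr0.
  have [r hr] := horner_taylor2 p (s n) (- (p.[s n] * u)).
  have -> : p.[s n.+1] = (1 - p^`().[s n] * u) * p.[s n] + p.[s n] * (p.[s n] * (u ^+ 2 * r)).
    by rewrite /= hr; ring.
  apply: filD.
    rewrite -[n.+2]add1n; apply: filM => //; apply/F1.
    have [r' hr'] := horner_sub p^`() (s n) a0.
    have -> : p^`().[s n] = p^`().[a0] + (s n - a0) * r' by rewrite -hr'; ring.
    by rewrite mulrDl hu opprD addrA subrr sub0r rmorphN !rmorphM /= rmorphB /= IH2 subrr !mul0r oppr0.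
  rewrite -[n.+2]addn1; apply: filM => //; apply: filMr; exact/F1.
have [n|a ha] := @fil_complete _ F s.
  rewrite /= addrAC subrr add0r; apply: filN; apply: filMr.
  by apply: filW (hs n).1.
exists a.
  apply: (@fil_sep _ F) => n.
  have [r hr] := horner_sub p (s n) a.
  have -> : p.[a] = p.[s n] - (s n - a) * r by rewrite -hr; ring.
  by apply: filB; [apply: filW (hs n).1 | apply: filMr].
have := ha 1%N; rewrite F1 rmorphB /= (hs 1%N).2 => /eqP.
by rewrite subr_eq0 => /eqP.
Qed.

End Hensel.

Section CoefficientField.
Variables (A : idomainType) (F : cfilt A) (k : closedFieldType) (pi : {rmorphism A -> k}).
Hypothesis F1 : forall x, F 1 x <-> pi x = 0.
Hypothesis pi_surj : forall c, exists x, pi x = c.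
Hypothesis pi_unit : forall x, pi x != 0 -> exists y, x * y = 1.

Lemma closed_root (c : k) n : (0 < n)%N -> exists x, x ^+ n = c.
Proof.
move=> n0; have [x hx] := @solve_monicpoly k n (fun i => if i == 0%N then c else 0) n0.
exists x; rewrite hx; case: n n0 {hx} => // n _.
by rewrite big_ord_recl /= expr0 mulr1 big1 ?addr0 // => i _; rewrite mul0r.
Qed.

(** In both characteristics the lift of [c] is described by a property that determines it; [T] is
    the resulting graph. *)
Lemma coefficient_section (T : k -> A -> Prop) :
  (forall c, exists a, T c a) -> (forall c a, T c a -> pi a = c) ->
  (forall c a a', T c a -> T c a' -> a = a') ->
  T 1 1 -> (forall c a d b, T c a -> T d b -> T (c - d) (a - b)) ->
  (forall c a d b, T c a -> T d b -> T (c * d) (a * b)) ->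
  exists io : {rmorphism k -> A}, forall c, pi (io c) = c.
Proof.
move=> Tex Tpi Tun T1 TB TM; have [f hf] := choice Tex.
have fB : zmod_morphism f.
  by move=> c d; apply: Tun (hf _) _; apply: TB.
have fM : monoid_morphism f.
  split; first exact: Tun (hf _) T1.
  by move=> c d; apply: Tun (hf _) _; apply: TM.
pose B := GRing.isZmodMorphism.Build k A f fB.
pose M := GRing.isMonoidMorphism.Build k A f fM.
pose io : {rmorphism k -> A} := HB.pack f B M.
by exists io => c; apply: Tpi (hf c).
Qed.

(** The lift of [c] is the limit of the q^n-th powers of lifts of its q^n-th roots, which exist as
    [k] is closed. Changing such a lift by an element of [F 1] changes the power only within
    [F (q ^ n)], so the limit is unique; additivity comes from Frobenius. *)
Lemma coefficient_field_pchar q : q \in [pchar k] -> q \in [pchar A] ->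
  exists io : {rmorphism k -> A}, forall c, pi (io c) = c.
Proof.
move=> qk qA; have q_prime := pcharf_prime qA.
have qn n : [pchar A].-nat (q ^ n)%N.
  by rewrite pnatX; apply/orP; left; rewrite pnatE.
have qnk n : [pchar k].-nat (q ^ n)%N.
  by rewrite pnatX; apply/orP; left; rewrite pnatE.
have q0 n : (0 < q ^ n)%N by rewrite expn_gt0 prime_gt0.
have len n : (n <= q ^ n)%N by apply: ltnW; apply: ltn_expl; apply: prime_gt1.
pose T c a := forall n, exists2 b, pi b ^+ (q ^ n) = c & F n (a - b ^+ (q ^ n)).
have subX (R : comNzRingType) (x y : R) n : [pchar R].-nat (q ^ n)%N ->
    (x - y) ^+ (q ^ n) = x ^+ (q ^ n) - y ^+ (q ^ n).
  by move=> h; rewrite exprDn_pchar // exprNn_pchar.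
have powF b b' n : pi b ^+ (q ^ n) = pi b' ^+ (q ^ n) -> F n (b ^+ (q ^ n) - b' ^+ (q ^ n)).
  move=> e; rewrite -subX //; apply: (@filW _ F _ (q ^ n)) => //.
  apply: filX; apply/F1.
  have /eqP : pi (b - b') ^+ (q ^ n) = 0 by rewrite rmorphB subX // e subrr.
  by rewrite expf_eq0 q0 => /eqP.
apply: (@coefficient_section T).
- move=> c.
  have [rt hrt] := choice (fun n => closed_root c (q0 n)).
  have [b hb] := choice (fun n => pi_surj (rt n)).
  have hbn n : pi (b n) ^+ (q ^ n) = c by rewrite hb hrt.
  have [n|a ha] := @fil_complete _ F (fun n => b n ^+ (q ^ n)).
    rewrite expnS exprM; apply: powF.
    by rewrite rmorphXn -exprM -expnS !hbn.
  exists a => n; exists (b n) => //.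
  by rewrite -opprB; apply: filN.
- move=> c a /(_ 1%N)[b <- /F1]; rewrite rmorphB rmorphXn /= => /eqP.
  by rewrite subr_eq0 => /eqP.
- move=> c a a' Ta Ta'; apply: (@fil_sep_eq _ F) => n.
  have [b e h] := Ta n; have [b' e' h'] := Ta' n.
  have -> : a - a' = (a - b ^+ (q ^ n)) - (a' - b' ^+ (q ^ n)) + (b ^+ (q ^ n) - b' ^+ (q ^ n)) by ring.
  by apply: filD; [apply: filB | apply: powF; rewrite e].
- by move=> n; exists 1; rewrite ?rmorph1 !expr1n // subrr; apply: fil0.
- move=> c a d b Ta Tb n; have [u e h] := Ta n; have [v e' h'] := Tb n.
  exists (u - v); first by rewrite rmorphB subX // e e'.
  rewrite subX //.
  have -> : a - b - (u ^+ (q ^ n) - v ^+ (q ^ n)) = (a - u ^+ (q ^ n)) - (b - v ^+ (q ^ n)) by ring.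
  exact: filB.
- move=> c a d b Ta Tb n; have [u e h] := Ta n; have [v e' h'] := Tb n.
  exists (u * v); first by rewrite rmorphM exprMn e e'.
  rewrite exprMn.
  have -> : a * b - u ^+ (q ^ n) * v ^+ (q ^ n) =
    (a - u ^+ (q ^ n)) * b + u ^+ (q ^ n) * (b - v ^+ (q ^ n)) by ring.
  by apply: filD; [apply: filMr | apply: filMl].
Qed.

Let isfld (X : A -> Prop) := [/\ X 1, forall x y, X x -> X y -> X (x - y),
  forall x y, X x -> X y -> X (x * y), forall x, X x -> pi x = 0 -> x = 0 &
  forall x, X x -> x != 0 -> exists2 y, X y & x * y = 1].

Let pov (X : A -> Prop) (p : {poly A}) := forall i, X p`_i.

Section OverSubfield.
Variable X : A -> Prop.
Hypothesis fX : isfld X.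

Let X1 : X 1. Proof. by case: fX. Qed.
Let XB x y : X x -> X y -> X (x - y). Proof. by case: fX => _ h _ _ _; apply: h. Qed.
Let XM x y : X x -> X y -> X (x * y). Proof. by case: fX => _ _ h _ _; apply: h. Qed.
Let X0 : X 0. Proof. by rewrite -(subrr 1); apply: XB. Qed.
Let XD x y : X x -> X y -> X (x + y).
Proof. by move=> hx hy; rewrite -[y]opprK; apply: XB => //; rewrite -sub0r; apply: XB. Qed.

Lemma pov1 : pov X 1. Proof. by move=> i; rewrite coef1; case: eqP. Qed.
Lemma povB p q : pov X p -> pov X q -> pov X (p - q).
Proof. by move=> hp hq i; rewrite coefB; apply: XB. Qed.
Lemma povM p q : pov X p -> pov X q -> pov X (p * q).
Proof.
by move=> hp hq i; rewrite coefM; elim/big_ind: _ => // j _; apply: XM.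
Qed.
Lemma povC c : X c -> pov X c%:P.
Proof. by move=> hc i; rewrite coefC; case: eqP. Qed.
Lemma povX n : pov X 'X^n.
Proof. by move=> i; rewrite coefXn; case: eqP. Qed.

(** If [c] is algebraic over [X], Hensel lifts it to a root of its minimal equation, which is
    separable in characteristic 0; if it is transcendental, any lift will do. The second condition
    keeps [pi] injective once [ct] is adjoined. *)
Lemma subfield_lift (ch0 : [pchar k] =i pred0) c : exists2 ct, pi ct = c &
  forall h, pov X h -> pi h.[ct] = 0 -> h.[ct] = 0.
Proof.
have [x0 hx0] := pi_surj c.
pose P s := `[< exists h : {poly A}, [/\ pov X h, h != 0, (map_poly pi h).[c] = 0 & size h = s] >].
have [exP|nP] := pselect (exists s, P s); last first.
  exists x0 => // h hh h0; suff -> : h = 0 by rewrite horner0.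
  apply/eqP/negP => /negP nz; apply: nP; exists (size h); apply/asboolP; exists h.
  by split=> //; rewrite -hx0 horner_map.
case: (ex_minnP exP) => s /asboolP[h0 [ph0 nz0 r0 sz]] mins.
have lead_inv : exists2 l, X l & lead_coef h0 * l = 1.
  by case: fX => _ _ _ _; apply; [exact: ph0 | rewrite lead_coef_eq0].
have s1 : (1 < s)%N.
  rewrite ltnNge; apply/negP => le; have := size1_polyC (p := h0); rewrite sz => /(_ le) e.
  have h00 : h0`_0 = 0.
    case: fX => _ _ _ inj _; apply: inj => //.
    by move: r0; rewrite e map_polyC hornerC coefC.
  by move: nz0; rewrite e h00 eqxx.
have minh h : pov X h -> (map_poly pi h).[c] = 0 -> (size h < s)%N -> h = 0.
  move=> ph hr lt; apply/eqP/negP => /negP nz.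
  have : P (size h) by apply/asboolP; exists h.
  by move/mins; rewrite leqNgt lt.
have der : pi h0^`().[x0] != 0.
  rewrite -horner_map hx0; apply/negP => /eqP d0.
  have pd : pov X h0^`().
    move=> i; rewrite coef_deriv -mulr_natr; apply: XM => //.
    by elim: (i.+1) => // n IH; rewrite -addn1 natrD; apply: XD.
  have /minh : (map_poly pi h0^`()).[c] = 0 by [].
  move=> /(_ pd); rewrite -[X in (_ < X)%N]sz lt_size_deriv // => /(_ isT) e.
  have : (h0^`())`_s.-2 = 0 by rewrite e coef0.
  rewrite coef_deriv; have -> : s.-2.+1 = s.-1 by case: (s) s1 => [|[]].
  have -> : h0`_s.-1 = lead_coef h0 by rewrite /lead_coef sz.
  move/(congr1 pi)/eqP; rewrite rmorphMn rmorph0 /= -mulr_natr mulf_eq0.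
  have [l _ hl] := lead_inv.
  have /negbTE -> : pi (lead_coef h0) != 0.
    apply/eqP => z; have /eqP := congr1 pi hl.
    by rewrite rmorphM z mul0r rmorph1 eq_sym oner_eq0.
  have /pcharf0P -> := ch0.
  by case: (s) s1 => [|[]].
have [|//|ct hct hpi] := hensel_root F1 pi_unit (p := h0) (a0 := x0).
  by rewrite -horner_map hx0.
exists ct; first by rewrite hpi.
move=> h ph; rewrite -horner_map hpi hx0.
have [l Xl hl] := lead_inv.
(* Euclidean division by [h0], possible because its leading coefficient is invertible in [X]. *)
elim: {h}_.+1 {-2}h (ltnSn (size h)) ph => // n IH h lt ph hr.
have [ltS|leS] := ltnP (size h) s; first by rewrite (minh h) ?horner0.
pose g := h - (lead_coef h * l)%:P * 'X^(size h - s) * h0.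
have pg : pov X g.
  apply: povB => //; apply: povM => //; apply: povM; last exact: povX.
  by apply: povC; apply: XM => //; exact: ph.
have gr : (map_poly pi g).[c] = 0.
  by rewrite /g rmorphB !rmorphM /= hornerD hornerN !hornerM r0 mulr0 subr0.
have hg : h.[ct] = g.[ct] by rewrite /g hornerD hornerN !hornerM hct mulr0 subr0.
rewrite hg; apply: IH => //.
have hz : h != 0 by rewrite -size_poly_gt0; apply: leq_trans leS; apply: ltnW.
have szg : (size g < size h)%N.
  have -> : size h = (size h).-1.+1 by rewrite prednK // size_poly_gt0.
  rewrite ltnS; apply/leq_sizeP => j; rewrite leq_eqVlt => /orP[/eqP <-|gt].
    rewrite /g coefB -mulrA coefCM coefXnM.
    have [-> ->] : ((size h).-1 < size h - s)%N = false /\ ((size h).-1 - (size h - s))%N = s.-1.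
      by move: (size h) leS => a leS; lia.
    have -> : h0`_s.-1 = lead_coef h0 by rewrite /lead_coef sz.
    by rewrite -mulrA [l * _]mulrC hl mulr1 subrr.
  have hj : (size h <= j)%N by rewrite -(prednK (n := size h)) // size_poly_gt0.
  have -> : g`_j = h`_j - lead_coef h * l * (if (j < size h - s)%N then 0 else h0`_(j - (size h - s))).
    by rewrite /g coefB -mulrA coefCM coefXnM.
  rewrite nth_default //; case: ifP => _; first by rewrite mulr0 subrr.
  have h0j : h0`_(j - (size h - s)) = 0.
    by apply: nth_default; rewrite sz; move: (size h) leS hj => a leS hj; lia.
  by rewrite h0j mulr0 subrr.
by apply: leq_trans szg _; rewrite -ltnS.
Qed.

(** The field consists of fractions in [ct] whose denominator has nonzero residue; such denominators
    are units of [A], so it stays inside [A]. *)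
Lemma subfield_adjoin ct : (forall h, pov X h -> pi h.[ct] = 0 -> h.[ct] = 0) ->
  exists Y, [/\ isfld Y, forall x, X x -> Y x & Y ct].
Proof.
move=> hK; exists (fun a => exists h1 h2, [/\ pov X h1, pov X h2, pi h2.[ct] != 0 & a * h2.[ct] = h1.[ct]]).
split; first split.
- by exists 1, 1; split; rewrite ?hornerC ?rmorph1 ?oner_eq0 ?mulr1 //; apply: pov1.
- move=> x y [h1 [h2 [p1 p2 n2 e]]] [g1 [g2 [q1 q2 m2 e']]].
  exists (h1 * g2 - g1 * h2), (h2 * g2); split; try by [apply: povB; apply: povM | apply: povM].
    by rewrite hornerM rmorphM mulf_neq0.
  by rewrite hornerD hornerN !hornerM -e -e'; ring.
- move=> x y [h1 [h2 [p1 p2 n2 e]]] [g1 [g2 [q1 q2 m2 e']]].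
  exists (h1 * g1), (h2 * g2); split; try by apply: povM.
    by rewrite hornerM rmorphM mulf_neq0.
  by rewrite !hornerM -e -e'; ring.
- move=> x [h1 [h2 [p1 p2 n2 e]]] x0.
  have h10 : h1.[ct] = 0 by apply: hK => //; rewrite -e rmorphM x0 mul0r.
  move/eqP: e; rewrite h10 mulf_eq0 => /orP[/eqP //|/eqP h20].
  by rewrite h20 rmorph0 eqxx in n2.
- move=> x [h1 [h2 [p1 p2 n2 e]]] xn0.
  have px : pi h1.[ct] != 0.
    apply/negP => /eqP /(hK _ p1) h10; move/eqP: e; rewrite h10 mulf_eq0 (negbTE xn0) => /eqP h20.
    by rewrite h20 rmorph0 eqxx in n2.
  have [y hy] := pi_unit px; exists (h2.[ct] * y); last by rewrite mulrA e.
  by exists h2, h1; split=> //; rewrite -mulrA [y * _]mulrC hy mulr1.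
- move=> x Xx; exists x%:P, 1; split; first exact: povC.
  + exact: pov1.
  + by rewrite hornerC rmorph1 oner_eq0.
  + by rewrite !hornerC mulr1.
- exists 'X, 1; split; first by rewrite -['X]expr1; apply: povX.
  + exact: pov1.
  + by rewrite hornerC rmorph1 oner_eq0.
  + by rewrite hornerX hornerC mulr1.
Qed.

End OverSubfield.

(** A maximal subfield of [A] maps onto [k], as any missing residue could be lifted and adjoined. *)
Lemma coefficient_field_pchar0 : [pchar k] =i pred0 ->
  exists io : {rmorphism k -> A}, forall c, pi (io c) = c.
Proof.
move=> ch0; have /pcharf0P nat_eq0 := ch0.
have int_eq0 (a : int) : pi a%:~R = 0 -> a = 0.
  rewrite rmorph_int; case: a => n /eqP; first by rewrite nat_eq0 => /eqP ->.
  by rewrite NegzE rmorphN oppr_eq0 /= nat_eq0.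
have intA (a : int) : a != 0 -> (a%:~R : A) != 0.
  by apply: contra_neq => a0; apply: int_eq0; rewrite a0 rmorph0.
(* The rational numbers, which lie in [A] because nonzero integers have nonzero residue; they start
   Zorn's lemma. *)
pose Q (x : A) := exists b : int, b != 0 /\ exists a : int, x * b%:~R = a%:~R.
have fQ : isfld Q.
  split.
  - by exists 1; split=> //; exists 1; rewrite mulr1.
  - move=> x y [b [nb [a e]]] [b' [nb' [a' e']]].
    exists (b * b'); split; first by rewrite mulf_neq0.
    exists (a * b' - a' * b); rewrite !(rmorphB, rmorphM) /= -e -e'; ring.
  - move=> x y [b [nb [a e]]] [b' [nb' [a' e']]].
    exists (b * b'); split; first by rewrite mulf_neq0.
    exists (a * a'); rewrite !rmorphM /= -e -e'; ring.
  - move=> x [b [nb [a e]]] x0.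
    have a0 : a = 0 by apply: int_eq0; rewrite -e rmorphM x0 mul0r.
    by move/eqP: e; rewrite a0 mulf_eq0 (negbTE (intA _ nb)) orbF => /eqP.
  - move=> x [b [nb [a e]]] nx.
    have na : a != 0.
      by apply: contraNneq nx => a0; move/eqP: e; rewrite a0 mulf_eq0 (negbTE (intA _ nb)) orbF.
    have [y hy] : exists y, (a%:~R : A) * y = 1.
      by apply: pi_unit; apply: contra_neq na; apply: int_eq0.
    exists (b%:~R * y); last by rewrite mulrA e.
    by exists a; split=> //; exists b; rewrite -mulrA [y * _]mulrC hy mulr1.
have [|//||X fX maxX] := @zorn_sets A isfld Q.
- by exists 1; case: fQ.
- move=> C [Y0 CY0] CF Cch.
  have two x y : (exists2 X, C X & X x) -> (exists2 X, C X & X y) ->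
      exists X, [/\ C X, X x & X y].
    move=> [X CX Xx] [Y CY Yy]; case: (Cch _ _ CX CY) => H; last by exists X; split=> //; apply: H.
    by exists Y; split=> //; apply: H.
  split.
  + by exists Y0 => //; case: (CF _ CY0).
  + move=> x y hx hy; have [X [CX Xx Xy]] := two _ _ hx hy.
    by exists X => //; case: (CF _ CX) => _ h _ _ _; apply: h.
  + move=> x y hx hy; have [X [CX Xx Xy]] := two _ _ hx hy.
    by exists X => //; case: (CF _ CX) => _ _ h _ _; apply: h.
  + by move=> x [X CX Xx]; case: (CF _ CX) => _ _ _ h _; apply: h.
  + move=> x [X CX Xx] nx; case: (CF _ CX) => _ _ _ _ /(_ x Xx nx)[y Xy e].
    by exists y => //; exists X.
apply: (@coefficient_section (fun c a => X a /\ pi a = c)).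
- move=> c; have [ct e hK] := subfield_lift fX ch0 c.
  have [Y [fY XY Yc]] := subfield_adjoin fX hK.
  by exists ct; split=> //; apply: (maxX Y).
- by move=> c a [].
- case: fX => _ XB _ inj _ c a a' [Xa e] [Xa' e'].
  apply/eqP; rewrite -subr_eq0; apply/eqP/inj; first exact: XB.
  by rewrite rmorphB /= e e' subrr.
- by case: fX => X1 *; rewrite rmorph1.
- case: fX => _ XB _ _ _ c a d b [Xa <-] [Xb <-]; split; first exact: XB.
  by rewrite rmorphB.
- case: fX => _ _ XM _ _ c a d b [Xa <-] [Xb <-]; split; first exact: XM.
  by rewrite rmorphM.
Qed.

End CoefficientField.

Section AdicFiltration.
Variables (A : comNzRingType) (m : {pred A}).
Hypothesis m_ideal : idealr_closed m.

Lemma ideal_mulP (I J : {pred A}) x : reflect (exists2 s : seq (A * A),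
   forall uv, uv \in s -> uv.1 \in I /\ uv.2 \in J & x = \sum_(uv <- s) uv.1 * uv.2)
  (x \in ideal_mul I J).
Proof. exact: asboolP. Qed.

Let mM a x : x \in m -> a * x \in m.
Proof. by case: m_ideal => m0 _ h hx; rewrite -[_ * _]addr0; apply: h. Qed.

Lemma ideal_exp_add n x y : x \in ideal_exp m n -> y \in ideal_exp m n ->
  x + y \in ideal_exp m n.
Proof.
case: n => // n /ideal_mulP[s hs ->] /ideal_mulP[t ht ->]; apply/ideal_mulP.
exists (s ++ t); last by rewrite big_cat.
by move=> u; rewrite mem_cat => /orP[/hs | /ht].
Qed.

Lemma ideal_exp_mull n a x : x \in ideal_exp m n -> a * x \in ideal_exp m n.
Proof.
case: n => // n /ideal_mulP[s hs ->]; apply/ideal_mulP.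
exists [seq (a * u.1, u.2) | u <- s].
  by move=> _ /mapP[u /hs[h1 h2] ->]; split=> //; apply: mM.
by rewrite big_map mulr_sumr; apply: eq_bigr => u _; rewrite mulrA.
Qed.

Lemma ideal_exp0 n : 0 \in ideal_exp m n.
Proof. by case: n => // n; apply/ideal_mulP; exists [::]; rewrite ?big_nil. Qed.

Lemma ideal_exp_sum n (I : eqType) (r : seq I) (G : I -> A) :
  (forall i, i \in r -> G i \in ideal_exp m n) -> \sum_(i <- r) G i \in ideal_exp m n.
Proof.
move=> H; rewrite big_seq; elim/big_ind: _ => //; first exact: ideal_exp0.
exact: ideal_exp_add.
Qed.

Lemma ideal_exp_mulS n x y : x \in m -> y \in ideal_exp m n -> x * y \in ideal_exp m n.+1.
Proof.
move=> hx hy; apply/ideal_mulP; exists [:: (x, y)]; last by rewrite big_seq1.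
by move=> u; rewrite inE => /eqP ->.
Qed.

Lemma ideal_exp_mul i j x y : x \in ideal_exp m i -> y \in ideal_exp m j ->
  x * y \in ideal_exp m (i + j).
Proof.
elim: i x => [|i IH] x; first by move=> _; apply: ideal_exp_mull.
move=> /ideal_mulP[s hs ->] hy; rewrite mulr_suml; apply: ideal_exp_sum => u /hs[h1 h2].
by rewrite -mulrA addSn; apply: ideal_exp_mulS => //; apply: IH.
Qed.

Lemma ideal_expS n x : x \in ideal_exp m n.+1 -> x \in ideal_exp m n.
Proof.
by move=> /ideal_mulP[s hs ->]; apply: ideal_exp_sum => u /hs[_]; apply: ideal_exp_mull.
Qed.

Lemma ideal_exp1 x : x \in ideal_exp m 1 <-> x \in m.
Proof.
split=> [/ideal_mulP[s hs ->]|hx].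
  rewrite big_seq; case: m_ideal => m0 _ mD; elim/big_ind: _ => // [a b ha hb|u /hs[h _]].
    by rewrite -[a]mul1r; apply: mD.
  by rewrite mulrC; apply: mM.
by rewrite -[x]mulr1; apply: ideal_exp_mulS.
Qed.

Lemma ideal_exp_split i j x : x \in ideal_exp m (i + j) -> exists2 s : seq (A * A),
  forall u, u \in s -> u.1 \in ideal_exp m i /\ u.2 \in ideal_exp m j
  & x = \sum_(u <- s) u.1 * u.2.
Proof.
elim: i x => [|i IH] x hx.
  exists [:: (1, x)]; last by rewrite big_seq1 mul1r.
  by move=> u; rewrite inE => /eqP ->.
move: hx; rewrite addSn => /ideal_mulP[s].
elim: s x => [|[u v] s IHs] x hs ->; first by exists [::]; rewrite ?big_nil.
have [t ht et] := IHs _ (fun w hw => hs w (mem_behead (s := (u, v) :: s) hw)) erefl.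
have [/= hu /IH[t' ht' ev]] := hs _ (mem_head _ _).
exists ([seq (u * w.1, w.2) | w <- t'] ++ t); last first.
  rewrite big_cons big_cat big_map /= et ev mulr_sumr; congr (_ + _).
  by apply: eq_bigr => w _; rewrite mulrA.
move=> w; rewrite mem_cat => /orP[|/ht //] /mapP[w' /ht'[h1 h2] ->]; split=> //=.
exact: ideal_exp_mulS.
Qed.

Hypothesis m_complete : adic_complete m.

Definition adic_filt : cfilt A.
Proof.
apply: (@CFilt _ (fun n x => x \in ideal_exp m n)) => //.
- by move=> *; apply: ideal_exp_add.
- by move=> *; apply: ideal_exp_mul.
- exact: ideal_exp0.
- exact: ideal_expS.
(* Separation: an element of all the powers is, like 0, a limit of the zero sequence. *)
- move=> x hx; have [n|l [_ uni]] := m_complete (a := fun=> 0).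
    by rewrite subrr; apply: ideal_exp0.
  have <- : l = x by apply: uni => n; rewrite sub0r -mulN1r; apply: ideal_exp_mull.
  by apply: uni => n; rewrite subrr; apply: ideal_exp0.
- by move=> a /m_complete[l [hl _]]; exists l.
Defined.

End AdicFiltration.

Lemma local_alg_exists (A : idomainType) (m : {pred A}) (k : closedFieldType)
    (pi : {rmorphism A -> k}) :
  noetherian_ring A -> local_ring_with m -> is_residue_field m pi ->
  adic_complete m -> equicharacteristic A k -> exists L : local_alg k A, True.
Proof.
move=> noeth [[m_id _] _] [pi_surj mE] m_compl eqc.
pose F := adic_filt m_id m_compl.
have F1 x : F 1 x <-> pi x = 0 by rewrite -mE; apply: ideal_exp1.
have pi_unit x : pi x != 0 -> exists y, x * y = 1.
  move=> nz; have [y hy] := pi_surj (pi x)^-1.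
  have h1 : F 1 (1 - x * y) by apply/F1; rewrite rmorphB rmorphM rmorph1 /= hy divff // subrr.
  have [z] := fil1_unit h1; rewrite opprB addrCA subrr addr0 => e.
  by exists (y * z); rewrite mulrA.
have [io hio] : exists io : {rmorphism k -> A}, forall c, pi (io c) = c.
  have [[q qk]|nq] := pselect (exists q, q \in [pchar k]).
    apply: (@coefficient_field_pchar A F k pi F1 pi_surj q qk).
    by rewrite eqc.
  apply: (coefficient_field_pchar0 F1 pi_surj pi_unit) => q.
  by apply/negP => h; apply: nq; exists q.
have [s hs] := noeth _ m_id.
suff L : local_alg k A by exists L.
apply: (@LocalAlg k A F io).
- by move=> i j x; apply: ideal_exp_split.
- by move=> x nF; apply: pi_unit; apply/eqP => h; apply: nF; apply/F1.
- by move=> a; exists (pi a); apply/F1; rewrite rmorphB /= hio subrr.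
- exists (size s), (fun i => s`_i); split=> [i|a].
    apply/F1; rewrite -mE; apply/hs; exists (fun j => (j == i)%:R) => //.
    by rewrite (bigD1 i) //= eqxx mul1r big1 ?addr0 // => j /negbTE ->; rewrite mul0r.
  rewrite F1 -mE hs => -[c _ ->]; exists c.
  by apply: eq_bigr => i _; rewrite mulrC.
- by rewrite F1 rmorph1 => /eqP; rewrite oner_eq0.
Qed.

(** * Separable systems of parameters *)

Section FieldLinearAlgebra.
Variables (F L : fieldType) (iota : {rmorphism F -> L}).

Definition fspan (I : finType) (b : I -> L) :=
  forall x, exists c : I -> F, x = \sum_i iota (c i) * b i.
Definition findep (I : finType) (b : I -> L) :=
  forall c : I -> F, \sum_i iota (c i) * b i = 0 -> forall i, c i = 0.

Lemma findep_row_free (I J : finType) (u : I -> L) (b : J -> L) (M : I -> J -> F) :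
  (forall i, u i = \sum_j iota (M i j) * b j) -> findep u ->
  row_free (\matrix_(i < #|I|, j < #|J|) M (enum_val i) (enum_val j)).
Proof.
move=> hM ind; rewrite -kermx_eq0; apply/rowV0P => v /sub_kermxP hv.
pose c i := v 0 (enum_rank i).
have c0 : forall i, c i = 0.
  apply: ind; under eq_bigr do rewrite hM mulr_sumr.
  rewrite exchange_big big1 // => j _.
  have := congr1 (fun X : 'rV_ _ => X 0 (enum_rank j)) hv; rewrite !mxE => /(congr1 iota).
  rewrite rmorph0 rmorph_sum (reindex (@enum_rank I)) /=; last first.
    by exists enum_val => x _; rewrite ?enum_rankK ?enum_valK.
  move=> e; transitivity (b j * \sum_i iota (v 0 (enum_rank i) * (\matrix_(i < #|I|, j < #|J|) M (enum_val i) (enum_val j)) (enum_rank i) (enum_rank j))); last by rewrite e mulr0.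
  rewrite mulr_sumr; apply: eq_bigr => i _; rewrite mxE !enum_rankK rmorphM /c; ring.
apply/rowP => i; rewrite mxE -(enum_valK i); exact: c0.
Qed.

Lemma findep_le_span (I J : finType) (u : I -> L) (b : J -> L) :
  findep u -> fspan b -> (#|I| <= #|J|)%N.
Proof.
move=> ind sp; have [M hM] := choice (fun i : I => sp (u i)).
have := findep_row_free hM ind; rewrite /row_free => /eqP <-; exact: rank_leq_col.
Qed.

Lemma fspan_drop n (b : 'I_n.+1 -> L) (c : 'I_n.+1 -> F) i0 :
  fspan b -> \sum_i iota (c i) * b i = 0 -> c i0 != 0 -> fspan (fun i => b (lift i0 i)).
Proof.
move=> sp; rewrite (bigD1_ord i0) //= => e nz x; have [g ->] := sp x.
exists (fun i => g (lift i0 i) - g i0 * (c i0)^-1 * c (lift i0 i)).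
rewrite (bigD1_ord i0) //=.
have nzi : iota (c i0) != 0 by rewrite fmorph_eq0.
have -> : b i0 = - (iota (c i0))^-1 * \sum_i iota (c (lift i0 i)) * b (lift i0 i).
  move/eqP: e; rewrite addr_eq0 => /eqP e; apply: (mulfI nzi).
  by rewrite e mulrA mulrN divff // mulN1r.
rewrite mulrA mulr_sumr -big_split; apply: eq_bigr => i _ /=.
rewrite rmorphB !rmorphM fmorphV; ring.
Qed.

Lemma fbasis_exists n (b : 'I_n -> L) : fspan b ->
  exists N (b' : 'I_N -> L), fspan b' /\ findep b'.
Proof.
move=> sp; pose P N := `[< exists b' : 'I_N -> L, fspan b' >].
have exP : exists N, P N by exists n; apply/asboolP; exists b.
case: (ex_minnP exP) => N /asboolP[b' sp'] minN; exists N, b'; split=> // c e i.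
apply/eqP/negP => /negP nz; case: N b' sp' minN c e i nz => [|N] b' sp' minN c e i nz.
  by case: i nz.
have : P N by apply/asboolP; exists (fun j => b' (lift i j)); apply: fspan_drop sp' e nz.
by move/minN; rewrite ltnn.
Qed.

Lemma fspan_card_indep n (b : 'I_n -> L) (J : finType) (b' : J -> L) :
  fspan b -> findep b' -> #|J| = n -> findep b.
Proof.
move=> sp ind eJ c e i; apply/eqP/negP => /negP nz.
case: n b sp eJ c e i nz => [|n] b sp eJ c e i nz; first by case: i nz.
by have := findep_le_span ind (fspan_drop sp e nz); rewrite eJ card_ord ltnn.
Qed.

Section MinimalPolynomial.
Variables (N : nat) (b : 'I_N -> L).
Hypothesis sp : fspan b.

Lemma minpoly_exists a : exists mu : {poly F}, [/\ mu != 0, root (map_poly iota mu) a &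
  forall p, p != 0 -> root (map_poly iota p) a -> (size mu <= size p)%N].
Proof.
pose P s := `[< exists p : {poly F}, [/\ p != 0, root (map_poly iota p) a & size p = s] >].
have exP : exists s, P s.
  apply: contrapT => H.
  have ind : findep (fun i : 'I_N.+1 => a ^+ i).
    move=> c e i; apply/eqP/negP => /negP nz; apply: H.
    pose p := \poly_(i < N.+1) c (inord i).
    exists (size p); apply/asboolP; exists p; split=> //.
      by apply: contraNneq nz => p0; have := coef_poly N.+1 (fun i => c (inord i)) i;
         rewrite -/p p0 coef0 ltn_ord inord_val => <-.
    rewrite /root /p (@horner_coef_wide _ N.+1); last by rewrite (leq_trans (size_poly _ _)) // size_poly.
    apply/eqP; rewrite -[RHS]e; apply: eq_bigr => j _.
    by rewrite coef_map coef_poly ltn_ord inord_val.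
  by have := findep_le_span ind sp; rewrite !card_ord ltnn.
case: (ex_minnP exP) => s /asboolP[mu [nz r sz]] mins.
by exists mu; split=> // p np rp; rewrite sz; apply: mins; apply/asboolP; exists p.
Qed.

Lemma minpoly_dvd (mu : {poly F}) a : mu != 0 -> root (map_poly iota mu) a ->
  (forall p, p != 0 -> root (map_poly iota p) a -> (size mu <= size p)%N) ->
  forall p, root (map_poly iota p) a -> mu %| p.
Proof.
move=> nz r mn p rp; apply/modp_eq0P; apply/eqP/negP => /negP nzr.
have : root (map_poly iota (p %% mu)) a.
  have e : p %% mu = p - p %/ mu * mu by rewrite {2}(divp_eq p mu) addrAC subrr add0r.
  by rewrite /root e rmorphB rmorphM /= hornerD hornerN hornerM (eqP r) mulr0 subr0 (eqP rp).
by move/(mn _ nzr); rewrite leqNgt ltn_modp nz.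
Qed.

(** [a] is a root of the gcd of [mu] and its derivative, or of the cofactor. The gcd is smaller than
    [mu], so minimality excludes it; the cofactor is then as large as [mu], and the gcd is
    constant. *)
Lemma minpoly_separable (mu : {poly F}) a : mu != 0 -> root (map_poly iota mu) a ->
  (forall p, p != 0 -> root (map_poly iota p) a -> (size mu <= size p)%N) ->
  mu^`() != 0 -> separable_poly mu.
Proof.
move=> nz r mn nd; rewrite unlock /coprimep; set g := gcdp _ _.
have gm : g %| mu by apply: dvdp_gcdl.
have gd : g %| mu^`() by apply: dvdp_gcdr.
have nzg : g != 0 by rewrite gcdp_eq0 negb_and nz.
have [h eh] := dvdpP _ _ gm.
have nzh : h != 0 by apply: contraNneq nz => h0; rewrite eh h0 mul0r.
have : root (map_poly iota h) a || root (map_poly iota g) a.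
  by rewrite -rootM -rmorphM -eh.
case/orP => [/(mn _ nzh)|/(mn _ nzg)].
  rewrite {1}eh size_mul // => le.
  have g0 : (0 < size g)%N by rewrite size_poly_gt0.
  have h0 : (0 < size h)%N by rewrite size_poly_gt0.
  rewrite eqn_leq g0 andbT; move: le; move: (size h) (size g) h0 g0 => x z; lia.
move=> le; have := dvdp_leq nd gd; have := lt_size_deriv nz => lt le2.
by have := leq_ltn_trans (leq_trans le le2) lt; rewrite ltnn.
Qed.

End MinimalPolynomial.

End FieldLinearAlgebra.

Section FractionMap.

Lemma fracP (R : idomainType) (x : {fraction R}) :
  exists a b : R, b != 0 /\ x = tofrac a / tofrac b.
Proof.
elim/quotW: x => r; exists (frac r).1, (frac r).2; split; first exact: denom_ratioP.
have nz : tofrac (frac r).2 != 0 :> {fraction R} by rewrite tofrac_eq0 denom_ratioP.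
apply: (mulIf nz); rewrite divfK //.
unlock tofrac; rewrite -[LHS]FracField.pi_mul; apply/eqmodP.
by rewrite /= FracField.equivfE /FracField.mulf !numden_Ratio ?mulr1 ?mulf_neq0 ?oner_neq0 ?denom_ratioP //; rewrite mulrC.
Qed.

Variables (R A : idomainType) (phi : {rmorphism R -> A}).
Hypothesis phi_inj : injective phi.

Lemma fracmap_exists : exists f : {rmorphism {fraction R} -> {fraction A}},
  forall r, f (tofrac r) = tofrac (phi r).
Proof.
have nzphi b : b != 0 -> tofrac (phi b) != 0 :> {fraction A}.
  by rewrite tofrac_eq0 -(rmorph0 phi) (inj_eq phi_inj).
pose T x z := exists a b : R, [/\ b != 0, x = tofrac a / tofrac b & z = tofrac (phi a) / tofrac (phi b)].
have Tex x : exists z, T x z.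
  have [a [b [nb e]]] := fracP x.
  by exists (tofrac (phi a) / tofrac (phi b)), a, b.
have [f hf] := choice Tex.
have uniq x z z' : T x z -> T x z' -> z = z'.
  move=> [a [b [nb e ->]]] [a' [b' [nb' e' ->]]].
  have : tofrac a / tofrac b = tofrac a' / tofrac b' by rewrite -e.
  move/eqP; rewrite eqr_div ?tofrac_eq0 // -!tofracM tofrac_eq => /eqP h.
  by apply/eqP; rewrite eqr_div ?nzphi // -!tofracM -!rmorphM h.
have Tr r : T (tofrac r) (tofrac (phi r)).
  by exists r, 1; split; rewrite ?oner_eq0 // !rmorph1 divr1.
have fB : zmod_morphism f.
  move=> x x'; apply: uniq (hf _) _.
  have [a [b [nb e ->]]] := hf x; have [a' [b' [nb' e' ->]]] := hf x'.
  exists (a * b' - a' * b), (b * b'); split; first by rewrite mulf_neq0.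
    by rewrite {}e {}e' -mulNr addf_div ?tofrac_eq0 // mulNr tofracB !tofracM.
  by rewrite -mulNr addf_div ?nzphi // mulNr rmorphB !rmorphM tofracB !tofracM.
have fM : monoid_morphism f.
  split; first by apply: uniq (hf _) _; rewrite -[1]tofrac1 -[X in T _ (tofrac X)](rmorph1 phi).
  move=> x x'; apply: uniq (hf _) _.
  have [a [b [nb e ->]]] := hf x; have [a' [b' [nb' e' ->]]] := hf x'.
  exists (a * a'), (b * b'); split; first by rewrite mulf_neq0.
    by rewrite {}e {}e' mulf_div !tofracM.
  by rewrite mulf_div !rmorphM.
pose B := GRing.isZmodMorphism.Build _ _ f fB.
pose M := GRing.isMonoidMorphism.Build _ _ f fM.
pose g : {rmorphism {fraction R} -> {fraction A}} := HB.pack f B M.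
by exists g => r; apply: uniq (hf _) (Tr _).
Qed.

Variables (N : nat) (s : 'I_N -> A).
Hypothesis phi_fin : forall a, exists g : 'I_N -> R, a = \sum_j phi (g j) * s j.

Lemma integral_over a : exists2 q : {poly R}, q \is monic & (map_poly phi q).[a] = 0.
Proof.
have [g hg] := choice (fun i : 'I_N => phi_fin (a * s i)).
pose M := \matrix_(i, j) g i j; exists (char_poly M); first exact: char_poly_monic.
rewrite map_char_poly char_poly_horner; set D := \det _.
have hD j : D * s j = 0.
  have [Z0 ZD ZM] := isid0 A; apply: (@idl_det A (fun x => x = 0) Z0 ZD ZM) => i.
  rewrite (eq_bigr (fun l => (if i == l then a * s l else 0) - phi (g i l) * s l)); last first.
    by move=> l _; rewrite !mxE mulrBl; congr (_ - _); case: eqP; rewrite ?mulr1n // mul0r.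
  rewrite sumrB -big_mkcond /= (big_pred1 i) => [|l]; last by rewrite eq_sym.
  by rewrite hg subrr.
have [g1 e1] := phi_fin 1; rewrite -[D]mulr1 e1 mulr_sumr big1 // => j _.
by rewrite mulrCA hD mulr0.
Qed.

(** A monic equation of [b] is divided by X until its constant term is nonzero; that term is then a
    multiple of [b]. The cofactor is kept as a polynomial in [b], which matters when it has to stay
    in a given subring. *)
Lemma divides_base_poly b : b != 0 -> exists (q : {poly R}) r,
  r != 0 /\ b * (map_poly phi q).[b] = phi r.
Proof.
move=> nb; have [q /monic_neq0] := integral_over b.
elim/poly_ind: q => [|q c IH]; first by rewrite eqxx.
have [->|nc] := eqVneq c 0; last first.
  move=> _; rewrite rmorphD rmorphM /= map_polyX map_polyC hornerMXaddC => /eqP.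
  rewrite addr_eq0 => /eqP e; exists (- q), c; split=> //.
  by rewrite rmorphN hornerN mulrN mulrC e opprK.
rewrite polyC0 addr0 mulf_eq0 negb_or => /andP[nq _].
rewrite rmorphM /= map_polyX hornerMX => /eqP; rewrite mulf_eq0 (negbTE nb) orbF => /eqP.
exact: IH.
Qed.

Lemma divides_base b : b != 0 -> exists b' r, r != 0 /\ b * b' = phi r.
Proof. by move=> /divides_base_poly[q [r [nr e]]]; exists (map_poly phi q).[b], r. Qed.

Variable iota : {rmorphism {fraction R} -> {fraction A}}.
Hypothesis iotaE : forall r, iota (tofrac r) = tofrac (phi r).

Lemma frac_common_denom x : exists a r, [/\ r != 0 :> R & x = tofrac a / iota (tofrac r) :> {fraction A}].
Proof.
have [a [b [nb ->]]] := fracP x; have [b' [r [nr e]]] := divides_base nb.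
have nb' : b' != 0.
  by apply: contraNneq nr => b0; rewrite -(inj_eq phi_inj) -e b0 mulr0 rmorph0.
exists (a * b'), r; split=> //; rewrite iotaE -e !tofracM -mulf_div divff ?mulr1 //.
by rewrite tofrac_eq0.
Qed.

Lemma frac_fspan : fspan iota (fun j => tofrac (s j)).
Proof.
move=> x; have [a [r [nr ->]]] := frac_common_denom x; have [g ->] := phi_fin a.
exists (fun j => tofrac (g j) / tofrac r); rewrite rmorph_sum mulr_suml.
by apply: eq_bigr => j _; rewrite rmorphM fmorph_div !iotaE mulrAC.
Qed.

End FractionMap.

(** * Inseparability and p-bases in characteristic q *)

Section PerfectCoefficients.
Variables (k : closedFieldType) (d q : nat).
Hypothesis qk : q \in [pchar k].

Let q_prime : prime q. Proof. exact: pcharf_prime qk. Qed.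
Let q_gt0 : (0 < q)%N. Proof. exact: prime_gt0. Qed.

Lemma pchar_sumX (R : comNzRingType) (I : Type) (r : seq I) (P : pred I) (f : I -> R) :
  q \in [pchar R] -> (\sum_(i <- r | P i) f i) ^+ q = \sum_(i <- r | P i) f i ^+ q.
Proof.
move=> qR; rewrite -(pFrobenius_autE qR) rmorph_sum.
by apply: eq_bigr => i _; rewrite /= pFrobenius_autE.
Qed.

Lemma mfps_coefXq (g : mfps k d) m : mfps_coef (g ^+ q) (m *+ q)%MM = mfps_coef g m ^+ q.
Proof.
have ag n M : agree M (mtr M g ^+ n) (g ^+ n).
  elim: n => [|j IH]; first by rewrite !expr0; apply: agree1.
  by rewrite !exprS; apply: agreeM => //; apply: mtr_agree.
have qM : q \in [pchar {mpoly k[d]}] by apply: (rmorph_pchar (@mpolyC d k)).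
have lt : (mdeg m < (mdeg (m *+ q)%MM).+1)%N by rewrite mdegMn ltnS leq_pmulr.
rewrite -(ag q (mdeg (m *+ q)%MM).+1) // /mtr pchar_sumX // raddf_sum /=.
rewrite (bigD1 (BMultinom lt)) //= big1 ?addr0.
  by rewrite exprZn mcoeffZ mpolyXn mcoeffX eqxx mulr1.
move=> b ne; rewrite exprZn mcoeffZ mpolyXn mcoeffX; case: eqP => [e|]; last by rewrite mulr0.
case/eqP: ne; apply: val_inj; apply/mnmP => i; have := congr1 (fun u : 'X_{1..d} => u i) e.
by rewrite !mulmnE => /eqP; rewrite eqn_pmul2r // => /eqP.
Qed.

Lemma mfps_coefXq_eq0 (g : mfps k d) m : (forall a, m <> (a *+ q)%MM) ->
  mfps_coef (g ^+ q) m = 0.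
Proof.
move=> hm.
have ag n M : agree M (mtr M g ^+ n) (g ^+ n).
  elim: n => [|j IH]; first by rewrite !expr0; apply: agree1.
  by rewrite !exprS; apply: agreeM => //; apply: mtr_agree.
have qM : q \in [pchar {mpoly k[d]}] by apply: (rmorph_pchar (@mpolyC d k)).
rewrite -(ag q (mdeg m).+1) // /mtr pchar_sumX // raddf_sum /= big1 // => b _.
rewrite exprZn mcoeffZ mpolyXn mcoeffX; case: eqP => [e|]; last by rewrite mulr0.
by case: (hm b).
Qed.

Definition mres (al : {ffun 'I_d -> 'I_q}) : 'X_{1..d} := [multinom (al i : nat) | i < d].

(** Dividing exponents by [q] with remainder splits [f] into [q ^ d] pieces, and each is a q-th
    power times a monomial because [k] has q-th roots. *)
Lemma mfps_pbasis (f : mfps k d) : exists g : {ffun 'I_d -> 'I_q} -> mfps k d,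
  f = \sum_al g al ^+ q * mfpsXm k (mres al).
Proof.
have [rt hrt] := choice (fun c : k => closed_root c q_gt0).
exists (fun al => Mfps (fun m => rt (mfps_coef f (mres al + m *+ q)%MM))).
apply: mfpsP => m; rewrite mfps_coef_sum.
pose al0 : {ffun 'I_d -> 'I_q} := [ffun i => Ordinal (ltn_pmod (m i) q_gt0)].
pose m1 : 'X_{1..d} := [multinom (m i %/ q)%N | i < d].
have em : m = (mres al0 + m1 *+ q)%MM.
  by apply/mnmP => i; rewrite mnmDE mulmnE !mnmE ffunE /= addnC -divn_eq.
rewrite (bigD1 al0) //= big1 ?addr0.
  by rewrite mulrC {2}em mfps_coefXMl mfps_coefXq mfps_coefE hrt -em.
move=> al ne; rewrite mulrC; have [le|nle] := boolP (mres al <= m)%MM; last first.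
  by rewrite mfps_coefXM_eq0.
rewrite -(submK le) addmC mfps_coefXMl mfps_coefXq_eq0 // => a e.
case/eqP: ne; apply/ffunP => i; apply: val_inj; rewrite ffunE /=.
have -> : m = (mres al + a *+ q)%MM by rewrite -e addmC submK.
by rewrite mnmDE mulmnE !mnmE addnC modnMDl modn_small.
Qed.

End PerfectCoefficients.

(* In characteristic q a subring containing all q-th powers is a subfield. *)
Definition qsub (K : fieldType) (q : nat) (W : K -> Prop) :=
  [/\ forall x y, W x -> W y -> W (x - y), forall x y, W x -> W y -> W (x * y) &
      forall c, W (c ^+ q)].

Section PBasis.
Variables (K : fieldType) (q : nat).
Hypothesis qK : q \in [pchar K].

Let q_prime : prime q. Proof. exact: pcharf_prime qK. Qed.
Let q_gt0 : (0 < q)%N. Proof. exact: prime_gt0. Qed.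

(** Linear independence over the subfield of q-th powers. *)
Definition qindep (J : finType) (u : J -> K) :=
  forall c : J -> K, \sum_j c j ^+ q * u j = 0 -> forall j, c j = 0.

Definition generates (w : seq K) := forall W, qsub q W -> (forall a, a \in w -> W a) ->
  forall x, W x.

Section Extend.
Variable V : K -> Prop.
Hypothesis qV : qsub q V.

Let VB x y : V x -> V y -> V (x - y). Proof. by case: qV => h _ _; apply: h. Qed.
Let VM x y : V x -> V y -> V (x * y). Proof. by case: qV => _ h _; apply: h. Qed.
Let Vq c : V (c ^+ q). Proof. by case: qV => _ _ h; apply: h. Qed.
Let V1 : V 1. Proof. by rewrite -(expr1n K q); apply: Vq. Qed.
Let V0 : V 0. Proof. by rewrite -(subrr 1); apply: VB. Qed.
Let VD x y : V x -> V y -> V (x + y).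
Proof. by move=> hx hy; rewrite -[y]opprK; apply: VB => //; rewrite -sub0r; apply: VB. Qed.
Let VX x n : V x -> V (x ^+ n).
Proof. by move=> h; elim: n => [|n IH]; [rewrite expr0 | rewrite exprS; apply: VM]. Qed.
Let VV x : V x -> V x^-1.
Proof.
move=> h; have [->|nz] := eqVneq x 0; first by rewrite invr0.
have -> : x^-1 = x ^+ q.-1 * x^-1 ^+ q.
  by rewrite -{2}(prednK q_gt0) exprS mulrCA -exprMn divff // expr1n mulr1.
by apply: VM => //; apply: VX.
Qed.

Variable t : K.
Hypothesis nVt : ~ V t.

Definition vpol (p : {poly K}) := forall i, V p`_i.

(** A nonzero relation of size at most [q] would give a minimal polynomial of degree r < q dividing
    (X - t)^q, hence proportional to (X - t)^r. For r = 1 this puts [t] in [V]; for r > 1 the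
    derivative is nonzero, shorter, over [V], and still vanishes at [t]. *)
Lemma vpol_indep p : vpol p -> (size p <= q)%N -> p.[t] = 0 -> p = 0.
Proof.
move=> vp szp rp; apply/eqP/negP => /negP nzp.
pose P s := `[< exists p, [/\ vpol p, p != 0, p.[t] = 0 & size p = s] >].
have exP : exists s, P s by exists (size p); apply/asboolP; exists p.
case: (ex_minnP exP) => s /asboolP[b [vb nb rb sb]] mins.
have minb h : vpol h -> h.[t] = 0 -> (size h < s)%N -> h = 0.
  move=> vh hr lt; apply/eqP/negP => /negP nz.
  have /mins : P (size h) by apply/asboolP; exists h.
  by rewrite leqNgt lt.
have sq : (s <= q)%N by apply: leq_trans szp; apply: mins; apply/asboolP; exists p.
have s1 : (1 < s)%N.
  rewrite ltnNge -sb; apply/negP => le; have e := size1_polyC le.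
  by move: nb rb; rewrite e hornerC => nb b0; rewrite b0 eqxx in nb.
have dvd n (h : {poly K}) : (size h < n)%N -> vpol h -> h.[t] = 0 -> b %| h.
  elim: n h => // n IH h lt vh hr.
  have [ltS|leS] := ltnP (size h) s; first by rewrite (minb h) ?dvdp0.
  pose g := h - (lead_coef h / lead_coef b)%:P * 'X^(size h - s) * b.
  have hz : h != 0 by rewrite -size_poly_gt0; apply: leq_trans leS; apply: ltnW.
  have cg j : g`_j = h`_j - lead_coef h / lead_coef b * (if (j < size h - s)%N then 0 else b`_(j - (size h - s))).
    by rewrite /g coefB -mulrA coefCM coefXnM.
  have vg : vpol g.
    move=> j; rewrite cg; apply: VB => //; apply: VM; last by case: ifP.
    by apply: VM; [exact: vh | apply: VV; exact: vb].
  have gr : g.[t] = 0 by rewrite /g hornerD hornerN hornerM hr rb mulr0 subr0.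
  have szg : (size g < size h)%N.
    have -> : size h = (size h).-1.+1 by rewrite prednK // size_poly_gt0.
    rewrite ltnS; apply/leq_sizeP => j; rewrite leq_eqVlt cg => /orP[/eqP <-|gt].
      have [-> ->] : ((size h).-1 < size h - s)%N = false /\ ((size h).-1 - (size h - s))%N = s.-1.
        by move: (size h) leS => a leS; lia.
      have -> : b`_s.-1 = lead_coef b by rewrite /lead_coef sb.
      by rewrite divfK ?lead_coef_eq0 // subrr.
    have hj : (size h <= j)%N by rewrite -(prednK (n := size h)) // size_poly_gt0.
    rewrite nth_default //; case: ifP => _; first by rewrite mulr0 subrr.
    have h0j : b`_(j - (size h - s)) = 0.
      by apply: nth_default; rewrite sb; move: (size h) leS hj => a leS hj; lia.
    by rewrite h0j mulr0 subrr.
  have -> : h = g + (lead_coef h / lead_coef b)%:P * 'X^(size h - s) * b by rewrite /g subrK.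
  rewrite dvdp_add // ?dvdp_mull //; apply: IH => //.
  by apply: leq_trans szg _; rewrite -ltnS.
have qP : q \in [pchar {poly K}] by apply: (rmorph_pchar (@polyC K)).
have : b %| ('X - t%:P) ^+ q.
  have -> : ('X - t%:P) ^+ q = 'X^q - (t ^+ q)%:P.
    by rewrite -(pFrobenius_autE qP) rmorphB /= !pFrobenius_autE polyC_exp.
  apply: (dvd _ _ (ltnSn _)); last by rewrite hornerD hornerN hornerXn hornerC subrr.
  by move=> i; rewrite coefB coefXn coefC; apply: VB; case: eqP.
case/dvdp_exp_XsubCP => r _ /eqpf_eq[c nc eb].
have sr : s = r.+1 by rewrite -sb eb size_scale // size_exp_XsubC.
case: r eb sr => [|[|r]] eb sr; first by move: s1; rewrite sr.
  apply: nVt; have b1 : b`_1 = c by rewrite eb expr1 coefZ coefB coefX coefC subr0 mulr1.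
  have -> : t = 0 - b`_0 / b`_1.
    have b0 : b`_0 = - (c * t) by rewrite eb expr1 coefZ coefB coefX coefC /= sub0r mulrN.
    by rewrite b0 b1 mulNr sub0r opprK mulrAC divff // mul1r.
  by apply: VB => //; apply: VM; [exact: vb | apply: VV; exact: vb].
have db0 : b^`() = 0.
  apply: minb.
  - move=> i; rewrite coef_deriv; elim: {2}(i.+1) => [|l IH]; first by rewrite mulr0n.
    by rewrite mulrS; apply: VD => //; exact: vb.
  - rewrite eb derivZ hornerZ deriv_exp derivXsubC mul1r hornerMn horner_exp hornerXsubC.
    by rewrite subrr expr0n /= mul0rn mulr0.
  - by rewrite -sb; apply: lt_size_deriv.
have := congr1 (fun u : {poly K} => u`_r.+1) db0; rewrite coef_deriv coef0 => /eqP.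
rewrite -mulr_natr mulf_eq0; have -> : b`_r.+2 = lead_coef b by rewrite /lead_coef sb sr.
rewrite lead_coef_eq0 (negbTE nb) /= -(dvdn_pcharf qK) => /dvdn_leq.
by move=> /(_ isT); rewrite leqNgt -sr sq.
Qed.

Lemma qsub_adjoin : let V' x := exists2 p, vpol p & x = p.[t] in
  [/\ qsub q V', forall x, V x -> V' x & V' t].
Proof.
have vC c : V c -> vpol c%:P by move=> hc i; rewrite coefC; case: eqP.
split; first split.
- move=> _ _ [p vp ->] [p' vp' ->]; exists (p - p'); last by rewrite hornerD hornerN.
  by move=> i; rewrite coefB; apply: VB; [apply: vp | apply: vp'].
- move=> _ _ [p vp ->] [p' vp' ->]; exists (p * p'); last by rewrite hornerM.
  move=> i; rewrite coefM; elim/big_ind: _ => // j _.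
  by apply: VM; [apply: vp | apply: vp'].
- by move=> c; exists (c ^+ q)%:P; [apply: vC | rewrite hornerC].
- by move=> x Vx; exists x%:P; [apply: vC | rewrite hornerC].
- exists 'X; last by rewrite hornerX.
  by move=> i; rewrite coefX; case: eqP.
Qed.

Lemma qindep_adjoin (J : finType) (u : J -> K) : qindep u -> (forall j, V (u j)) ->
  qindep (fun jl : J * 'I_q => u jl.1 * t ^+ jl.2).
Proof.
move=> ind Vu c e [j l] /=.
pose a l := \sum_j c (j, l) ^+ q * u j.
pose p := \poly_(i < q) oapp a 0 (insub i : option 'I_q).
have Va l' : V (a l').
  by rewrite /a; elim/big_ind: _ => // i _; exact: VM.
have p0 : p = 0.
  apply: vpol_indep; rewrite ?size_poly //.
    by move=> i; rewrite coef_poly; case: ifP => // _; case: insubP => [l0 _ _|_] /=; [exact: Va | exact: V0].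
  have e' : \sum_jl c (jl.1, jl.2) ^+ q * (u jl.1 * t ^+ jl.2) = 0.
    by rewrite -[RHS]e; apply: eq_bigr => -[].
  rewrite horner_poly -[RHS]e' -(pair_bigA _ (fun j l => c (j, l) ^+ q * (u j * t ^+ l))).
  rewrite [RHS]exchange_big /=.
  apply: eq_bigr => l' _; rewrite valK /= mulr_suml; apply: eq_bigr => i _.
  by rewrite mulrA.
have al : a l = 0.
  by have := congr1 (fun r : {poly K} => r`_l) p0; rewrite coef_poly ltn_ord valK coef0.
exact: (ind (fun j => c (j, l)) al).
Qed.

End Extend.
End PBasis.

Section PBasisExists.
Variables (K : fieldType) (q : nat).
Hypothesis qK : q \in [pchar K].
Variables (T : K -> Prop) (d : nat).
Hypothesis T_full : forall V, qsub q V -> (forall x, T x -> V x) -> forall x, V x.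
Hypothesis q_bound : forall (J : finType) (u : J -> K), qindep q u -> (#|J| <= q ^ d)%N.

(** Elements of [T] outside the subfield reached so far are adjoined one at a time; each multiplies
    the size of an independent family by [q], so [q_bound] stops the process after at most [d]
    steps. *)
Lemma pbasis_exists : exists w : seq K,
  [/\ (size w <= d)%N, forall a, a \in w -> T a & generates q w].
Proof.
have q_prime := pcharf_prime qK; have q_gt1 := prime_gt1 q_prime.
apply: contrapT => none.
have H i : exists w V (J : finType) (u : J -> K),
  [/\ size w = i, forall a, a \in w -> T a &
      forall W, qsub q W -> (forall a, a \in w -> W a) -> forall x, V x -> W x] /\
  [/\ qsub q V, qindep q u, forall j, V (u j) & #|J| = (q ^ i)%N].
  elim: i => [|i [w [V [J [u [[sw wT Vmin] [qV ind Vu cJ]]]]]]].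
    exists [::], (fun x => exists c, x = c ^+ q), unit, (fun=> 1); split; split=> //.
    - by move=> W [_ _ Wq] _ _ [c ->].
    - split.
      + move=> _ _ [x ->] [y ->]; exists (x - y).
        by rewrite -!(pFrobenius_autE qK) rmorphB.
      + by move=> _ _ [x ->] [y ->]; exists (x * y); rewrite exprMn.
      + by move=> c; exists c.
    - move=> c e []; move: e; rewrite (big_pred1 tt) => [|[]//]; rewrite mulr1 => /eqP.
      by rewrite expf_eq0 prime_gt0 // => /eqP.
    - by exists 1; rewrite expr1n.
    - by rewrite card_unit expn0.
  have led : (i <= d)%N by have := q_bound ind; rewrite cJ leq_exp2l.
  have [t [Tt nVt]] : exists t, T t /\ ~ V t.
    apply: contrapT => all; apply: none; exists w; split=> //; first by rewrite sw.
    move=> W qW wW x; apply: (Vmin W qW wW); apply: T_full => // y Ty.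
    by apply: contrapT => nV; apply: all; exists y.
  have [qV' VV' V't] := qsub_adjoin qV t.
  exists (t :: w), (fun x => exists2 p, vpol V p & x = p.[t]), (J * 'I_q)%type,
    (fun jl : J * 'I_q => u jl.1 * t ^+ jl.2); split; split.
  - by rewrite /= sw.
  - by move=> a; rewrite inE => /orP[/eqP ->|/wT].
  - move=> W qW wW _ [p vp ->].
    have [WB WM Wq] := qW.
    have W1 : W 1 by rewrite -(expr1n K q).
    have W0 : W 0 by rewrite -(subrr 1); apply: WB.
    have WD x y : W x -> W y -> W (x + y).
      by move=> hx hy; rewrite -[y]opprK; apply: (WB) => //; rewrite -sub0r; apply: WB.
    rewrite horner_coef; elim/big_ind: _ => // l _; apply: (WM).
      by apply: Vmin (vp l) => // a ha; apply: wW; rewrite inE ha orbT.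
    elim: (l : nat) => [|n IH]; rewrite ?expr0 // exprS; apply: (WM) => //.
    by apply: wW; rewrite mem_head.
  - exact: qV'.
  - exact: (qindep_adjoin qK qV nVt ind Vu).
  - move=> [j l]; exists ((u j)%:P * 'X^l); last by rewrite hornerM hornerC hornerXn.
    move=> n; rewrite coefCM coefXn; case: eqP => _; first by rewrite mulr1.
    rewrite mulr0; case: qV => VB _ _; rewrite -(subrr (u j)); exact: VB.
  - by rewrite card_prod cJ card_ord expnSr.
have [w [V [J [u [_ [_ ind _ cJ]]]]]] := H d.+1.
by have := q_bound ind; rewrite cJ leq_exp2l // ltnn.
Qed.

End PBasisExists.

Section FrobeniusIndependence.
Variables (F K : fieldType) (iota : {rmorphism F -> K}) (q : nat).
Hypothesis qK : q \in [pchar K].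
Variables (n : nat) (a0 : 'I_n -> K).
Hypothesis sp0 : fspan iota a0.

(** A degree count over the q-th powers of [F]: with N = [K : F], [K] is spanned over them by |I| N
    elements, while multiplying [u] by the q-th powers of a basis gives |J| N independent ones. *)
Lemma qindep_bound (I : finType) (X : I -> F) (J : finType) (u : J -> K) :
  (forall f, exists g : I -> F, f = \sum_i g i ^+ q * X i) ->
  qindep q u -> (#|J| <= #|I|)%N.
Proof.
move=> hX ind; have [N [a [sp ia]]] := fbasis_exists sp0.
pose iotaq : {rmorphism F -> K} := pFrobenius_aut qK \o iota.
have iE c : iotaq c = iota c ^+ q by rewrite /= pFrobenius_autE.
have i1 : findep iotaq (fun p : 'I_N * J => a p.1 ^+ q * u p.2).
  move=> c e [i j].
  have : \sum_j (\sum_i iota (c (i, j)) * a i) ^+ q * u j = 0.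
    rewrite -[RHS]e; transitivity (\sum_(p : 'I_N * J) iotaq (c (p.1, p.2)) * (a p.1 ^+ q * u p.2)).
      rewrite -(pair_bigA _ (fun i j => iotaq (c (i, j)) * (a i ^+ q * u j))) exchange_big /=.
      apply: eq_bigr => j' _; rewrite pchar_sumX // mulr_suml; apply: eq_bigr => i' _.
      by rewrite exprMn pFrobenius_autE mulrA.
    by apply: eq_bigr => -[].
  by move/ind/(_ j)/ia/(_ i).
have s1 : fspan iotaq (fun p : I * 'I_N => iota (X p.1) * a p.2).
  move=> x; have [c ->] := sp x.
  have [g hg] := choice (fun i : 'I_N => hX (c i)).
  exists (fun p => g p.2 p.1).
  rewrite -(pair_bigA _ (fun al i => iotaq (g i al) * (iota (X al) * a i))) exchange_big /=.
  apply: eq_bigr => i _; rewrite hg rmorph_sum mulr_suml; apply: eq_bigr => al _.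
  by rewrite rmorphM rmorphXn mulrA pFrobenius_autE.
have := findep_le_span i1 s1; rewrite !card_prod card_ord mulnC leq_pmul2r //.
rewrite lt0n; apply/eqP => N0; move: a sp {ia i1 s1}; rewrite N0 => a sp.
by have [c /eqP] := sp 1; rewrite big_ord0 oner_eq0.
Qed.

Variable (b : 'I_n -> K).
Hypothesis sp : fspan iota b.
Hypothesis sq : fspan iota (fun i => b i ^+ q).

Let qF : q \in [pchar F]. Proof. by rewrite -(fmorph_pchar iota). Qed.

(** The coordinates of the [u i ^+ q] in the family [b i ^+ q], a basis for dimension reasons, are
    the q-th powers of the coordinates of [u] in [b], and Frobenius preserves the rank of a
    matrix. *)
Lemma findep_frobenius (I : finType) (u : I -> K) : findep iota b ->
  findep iota u -> findep iota (fun i => u i ^+ q).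
Proof.
move=> ib iu c e; have [M hM] := choice (fun i : I => sp (u i)).
have ibq : findep iota (fun i => b i ^+ q) by apply: (fspan_card_indep sq ib); rewrite card_ord.
have := findep_row_free hM iu; rewrite -(row_free_map (pFrobenius_aut qF)).
set X := map_mx _ _ => fX.
pose v : 'rV[F]_#|I| := \row_i c (enum_val i).
have : v *m X = 0.
  apply/rowP => l; rewrite !mxE.
  have e2 : \sum_j iota (\sum_i c i * M i j ^+ q) * b j ^+ q = 0.
    rewrite -[RHS]e.
    under eq_bigr do rewrite rmorph_sum mulr_suml.
    rewrite exchange_big /=; apply: eq_bigr => i _; rewrite hM pchar_sumX // mulr_sumr.
    by apply: eq_bigr => j _; rewrite exprMn rmorphM rmorphXn mulrA.
  apply: (etrans _ (ibq _ e2 (enum_val l))).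
  rewrite [RHS](reindex (@enum_val I I)) /=; last first.
    by exists enum_rank => x _; rewrite ?enum_rankK ?enum_valK.
  by apply: eq_bigr => i _; rewrite !mxE /= pFrobenius_autE.
move/eqP; rewrite mulmx_free_eq0 // => /eqP v0 i.
by have := congr1 (fun r : 'rV_ _ => r 0 (enum_rank i)) v0; rewrite !mxE enum_rankK.
Qed.

(** If the derivative vanished, [mu] would be a polynomial in X^q. This would be a linear relation
    over [F] among the q-th powers of 1, a, ..., a^(m-1), where m is the degree of [mu], and these
    are independent by [findep_frobenius]. *)
Lemma minpoly_deriv_neq0 (mu : {poly F}) a : findep iota b -> mu != 0 -> root (map_poly iota mu) a ->
  (forall p, p != 0 -> root (map_poly iota p) a -> (size mu <= size p)%N) ->
  mu^`() != 0.
Proof.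
move=> ib nz r mn; have q_prime := pcharf_prime qK; have q_gt1 := prime_gt1 q_prime.
apply/eqP => d0.
have s1 : (1 < size mu)%N.
  rewrite ltnNge; apply/negP => /size1_polyC e; move: r nz; rewrite e.
  by rewrite map_polyC rootC fmorph_eq0 polyC_eq0 => ->.
pose m := (size mu).-1.
have m0 : (0 < m)%N by rewrite /m; case: (size mu) s1 => [|[]].
have ind : findep iota (fun i : 'I_m => a ^+ i).
  move=> c e i; apply/eqP/negP => /negP nc.
  pose p := \poly_(i < m) oapp c 0 (insub i).
  have : (size mu <= size p)%N.
    apply: mn; first by apply: contraNneq nc => p0; have := congr1 (fun u : {poly F} => u`_i) p0;
       rewrite coef_poly ltn_ord valK coef0 => /= ->.
    rewrite /root (@horner_coef_wide _ m); last by rewrite (leq_trans (size_poly _ _)) // size_poly.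
    apply/eqP; rewrite -[RHS]e; apply: eq_bigr => j _.
    by rewrite coef_map coef_poly ltn_ord valK.
  rewrite leqNgt; apply/negP/negPn; apply: leq_ltn_trans (size_poly _ _) _.
  by rewrite /m; case: (size mu) s1 => [|[]].
have coef0P i : ~~ (q %| i)%N -> mu`_i = 0.
  case: i => [|i] nd; first by rewrite dvdn0 in nd.
  have := congr1 (fun u : {poly F} => u`_i) d0; rewrite coef_deriv coef0 => /eqP.
  by rewrite -mulr_natr mulf_eq0 -(dvdn_pcharf qF) (negbTE nd) orbF => /eqP.
have lead : mu`_m != 0 by rewrite -/(lead_coef mu) lead_coef_eq0.
have /dvdnP[m' em] : (q %| m)%N by apply: contraNT lead => /coef0P ->.
have m'0 : (0 < m')%N by move: m0; rewrite em muln_gt0 => /andP[].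
have m'm : (m' < m)%N by rewrite em -{1}[m']muln1 ltn_pmul2l.
pose nu := \poly_(i < m'.+1) mu`_(i * q).
have sm : size mu = m.+1 by rewrite /m prednK // ltnW.
have munu : mu = nu \Po 'X^q.
  apply/polyP => i; rewrite coef_comp_poly_Xn ?prime_gt0 //; case: ifP => qi; last first.
    by rewrite coef0P // qi.
  rewrite coef_poly divnK //; case: ltnP => // h; rewrite nth_default // sm em.
  by rewrite -(divnK qi) ltn_pmul2r // prime_gt0.
have rnu : \sum_(i < m) iota nu`_i * (a ^+ i) ^+ q = 0.
  have : (map_poly iota nu).[a ^+ q] = 0.
    by move: r; rewrite {1}munu map_comp_poly map_polyXn /root horner_comp hornerXn => /eqP.
  rewrite (@horner_coef_wide _ m); last first.
    by rewrite size_map_poly (leq_trans (size_poly _ _)).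
  move=> h; rewrite -[RHS]h; apply: eq_bigr => i _.
  by rewrite coef_map -!exprM mulnC.
have := findep_frobenius ib ind rnu (Ordinal m'm).
by rewrite /= coef_poly ltnSn -em => /eqP; apply/negP.
Qed.

End FrobeniusIndependence.

Definition all_separable (F K : fieldType) (iota : {rmorphism F -> K}) :=
  forall a, exists mu : {poly F},
    [/\ mu != 0, root (map_poly iota mu) a & separable_poly mu].

Section SeparableParameters.
Variables (k : closedFieldType) (A : idomainType) (L : local_alg k A) (d : nat).
Hypotheses (noeth : noetherian_ring A) (dimA : has_krull_dim A d) (d_gt0 : (0 < d)%N).
Notation io := (la_io L).

Lemma frac_pbasis q (qk : q \in [pchar k]) (f : {fraction mfps k d}) :
  exists g : {ffun 'I_d -> 'I_q} -> {fraction mfps k d},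
    f = \sum_al g al ^+ q * tofrac (mfpsXm k (mres al)).
Proof.
have q_gt0 := prime_gt0 (pcharf_prime qk).
have [a [b [nb ->]]] := fracP f.
have [g hg] := mfps_pbasis qk (a * b ^+ q.-1).
exists (fun al => tofrac (g al) / tofrac b).
have nb' : tofrac b != 0 :> {fraction mfps k d} by rewrite tofrac_eq0.
have -> : tofrac a / tofrac b = tofrac (a * b ^+ q.-1) / tofrac b ^+ q.
  by rewrite -{2}(prednK q_gt0) exprS tofracM tofracXn invfM mulrA mulrAC mulfK // expf_neq0.
rewrite hg rmorph_sum mulr_suml; apply: eq_bigr => al _.
by rewrite rmorphM rmorphXn expr_div_n mulrAC.
Qed.

Lemma separable_pchar0 : [pchar k] =i pred0 ->
  forall (iota : {rmorphism {fraction mfps k d} -> {fraction A}}) n (b : 'I_n -> {fraction A}),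
  fspan iota b -> all_separable iota.
Proof.
move=> ch0 iota n b sp a; have [mu [nz r mn]] := minpoly_exists sp a.
exists mu; split=> //; apply: (minpoly_separable nz r mn).
have chF : [pchar {fraction mfps k d}] =i pred0.
  pose f : {rmorphism k -> {fraction mfps k d}} := @tofrac (mfps k d) \o @mfpsC k d.
  by move=> p; rewrite -(ch0 p) (fmorph_pchar f).
have s1 : (1 < size mu)%N.
  rewrite ltnNge; apply/negP => /size1_polyC e; move: r nz; rewrite e.
  by rewrite map_polyC rootC fmorph_eq0 polyC_eq0 => ->.
apply/negP => /eqP d0.
have := congr1 (fun u : {poly _} => u`_(size mu).-2) d0; rewrite coef_deriv coef0.
have -> : (size mu).-2.+1 = (size mu).-1 by case: (size mu) s1 => [|[]].
rewrite -/(lead_coef mu) => /eqP; rewrite -mulr_natr mulf_eq0 lead_coef_eq0 (negbTE nz) /=.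
have /pcharf0P -> := chF.
by case: (size mu) s1 => [|[]].
Qed.

(** In characteristic q this is MacLane's criterion: separability follows once the q-th powers of a
    basis span again, that is, once K(A) is the compositum of the base field with its own q-th
    powers. The parameters are therefore corrected by generators [w] of K(A) over its q-th powers,
    and the bound on that degree allows at most [d] of them. *)
Lemma separable_sop : exists (y : 'I_d -> A) (hy : forall i, L 1 (y i)), sop L y /\
  forall iota : {rmorphism {fraction mfps k d} -> {fraction A}},
    (forall r, iota (tofrac r) = tofrac (ev io hy r)) -> all_separable iota.
Proof.
have [x hx sx] := sop_exists L noeth dimA.
have fin_span (y : 'I_d -> A) (hy : forall i, L 1 (y i)) : sop L y ->
    exists n (b : 'I_n -> {fraction A}),
    forall iota : {rmorphism {fraction mfps k d} -> {fraction A}},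
    (forall r, iota (tofrac r) = tofrac (ev io hy r)) -> fspan iota b.
  move=> sy; have [N [s hs]] := sop_finite hy sy.
  exists N, (fun j => tofrac (s j)) => iota hi.
  exact: (frac_fspan (sop_inj noeth dimA (hy := hy) sy) hs hi).
have [ch0|[q qk]] : [pchar k] =i pred0 \/ exists q, q \in [pchar k].
  have [h|h] := pselect (exists q, q \in [pchar k]); [by right | left => q].
  by apply/negP => hq; apply: h; exists q.
  exists x, hx; split=> // iota hi.
  have [n [b hb]] := fin_span _ hx sx; exact: (separable_pchar0 ch0 (hb iota hi)).
have qA : q \in [pchar A] by apply: (rmorph_pchar io).
have qK : q \in [pchar {fraction A}] by apply: (rmorph_pchar (@tofrac A)).
have q_prime := pcharf_prime qk; have q_gt0 := prime_gt0 q_prime.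
have injx := sop_inj noeth dimA (hy := hx) sx.
have [iox hiox] := fracmap_exists injx.
have [nx [bx hbx]] := fin_span _ hx sx; have spx := hbx iox hiox.
have [w [szw Tw genw]] : exists w : seq {fraction A},
    [/\ (size w <= d)%N, forall a, a \in w -> exists a' : A, a = tofrac a' & generates q w].
  apply: (pbasis_exists qK).
  - move=> V qV TV z; have [a [b [nb ->]]] := fracP z.
    have nb' : tofrac b != 0 :> {fraction A} by rewrite tofrac_eq0.
    have -> : tofrac a / tofrac b = tofrac (a * b ^+ q.-1) * (tofrac b)^-1 ^+ q.
      by rewrite exprVn -{2}(prednK q_gt0) exprS tofracM tofracXn invfM mulrA mulrAC mulfK // expf_neq0.
    have [_ VM Vq] := qV; apply: VM => //; apply: TV; by exists (a * b ^+ q.-1).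
  - move=> J u ind.
    have := qindep_bound qK spx (frac_pbasis qk) ind.
    by rewrite card_ffun !card_ord.
(* [w] may have fewer than [d] elements; the default 0 of [nth] fills the remaining places. *)
have wex (i : 'I_d) : exists a : A, tofrac a = w`_i.
  have [lt|le] := ltnP i (size w); last by exists 0; rewrite nth_default // rmorph0.
  by have [a ->] := Tw _ (mem_nth 0 lt); exists a.
have {wex} [wA hwA] := choice wex.
pose o0 : 'I_d := Ordinal d_gt0.
(* Up to adding a q-th power, [y i] is the i-th element of [w] times a nonzero q-th power, so the
   [y i] and the q-th powers together yield all of [w]. The square makes [y o0] a unit times
   [x o0 ^+ q], so that the [y i] remain parameters. *)
pose y i := x i ^+ q + wA i * (x o0 ^+ q) ^+ 2.
have F1q i : L 1 (x i ^+ q) by apply: filX_gt0.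
have hy i : L 1 (y i).
  apply: filD; first exact: F1q.
  by apply: filMl; rewrite expr2; apply: filMr; exact: F1q.
have I0 := isid0 A.
have idy := idgen_isid y I0; have [y0 yD yM] := idy.
have x0y : idgen y (fun x => x = 0) (x o0 ^+ q).
  have [|v hv] := @fil1_unit _ L (- (wA o0 * x o0 ^+ q)).
    by apply: filN; apply: filMl; exact: F1q.
  have -> : x o0 ^+ q = v * y o0.
    by rewrite -[LHS]mulr1 -hv /y; ring.
  by apply: yM; apply: idgen_y.
have sy : sop L y.
  case: sx => e he; apply: (la_nilpotent_gen idy (q := q) _ (x := x) (e := e)).
    move=> i; have -> : x i ^+ q = y i - wA i * x o0 ^+ q * x o0 ^+ q by rewrite /y; ring.
    by apply: (isidB idy); [exact: idgen_y | exact: yM].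
  by move=> a /he; apply: idgen_sub => z ->.
exists y, hy; split=> // iota hi.
have [ny [by0 hby]] := fin_span _ hy sy; have sp0 := hby iota hi.
have [n [b [sp ib]]] := fbasis_exists sp0.
have qF : q \in [pchar {fraction mfps k d}] by rewrite -(fmorph_pchar iota).
(* The compositum of the base field with the q-th powers; containing every element of [w], it is the
   whole field. *)
pose W z := exists c : 'I_n -> {fraction mfps k d}, z = \sum_i iota (c i) * b i ^+ q.
have Wq z : W (z ^+ q).
  have [c ->] := sp z; exists (fun i => c i ^+ q); rewrite pchar_sumX //.
  by apply: eq_bigr => i _; rewrite exprMn rmorphXn.
have WB z z' : W z -> W z' -> W (z - z').
  move=> [c ->] [c' ->]; exists (fun i => c i - c' i); rewrite -sumrB.
  by apply: eq_bigr => i _; rewrite rmorphB mulrBl.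
have W0 : W 0 by rewrite -(subrr (1 ^+ q)); apply: WB.
have WD z z' : W z -> W z' -> W (z + z').
  by move=> h1 h2; rewrite -[z']opprK; apply: (WB) => //; rewrite -sub0r; apply: WB.
have WZ c z : W z -> W (iota c * z).
  move=> [g ->]; exists (fun i => c * g i); rewrite mulr_sumr.
  by apply: eq_bigr => i _; rewrite rmorphM mulrA.
have WM z z' : W z -> W z' -> W (z * z').
  move=> [c ->] [c' ->]; rewrite mulr_suml; elim/big_ind: _ => // i _.
  rewrite mulr_sumr; elim/big_ind: _ => // j _.
  have -> : iota (c i) * b i ^+ q * (iota (c' j) * b j ^+ q) =
     iota (c i) * (iota (c' j) * (b i * b j) ^+ q) by rewrite exprMn; ring.
  by apply: (WZ); apply: WZ.
have Wiota c : W (iota c) by rewrite -[iota c]mulr1 -(expr1n _ q); apply: WZ.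
have Wy i : W (tofrac (y i)).
  have -> : tofrac (y i) = iota (tofrac (mfpsX k i)) by rewrite hi /= ev_X.
  exact: Wiota.
have x0nz : tofrac (x o0) != 0 :> {fraction A}.
  rewrite tofrac_eq0; apply/eqP => x00.
  have : ev io hx (mfpsX k o0) = ev io hx 0 by rewrite ev_X x00 rmorph0.
  move/injx/(congr1 (fun u => mfps_coef u U_(o0)%MM))/eqP.
  by rewrite mfps_coefXm eqxx mfps_coef0 oner_eq0.
have spq : fspan iota (fun i => b i ^+ q).
  apply: (genw W); first by split.
  move=> a ha; have lt : (index a w < d)%N by rewrite (leq_trans _ szw) // index_mem.
  have -> : a = tofrac (wA (Ordinal lt)) by rewrite hwA nth_index.
  have -> : tofrac (wA (Ordinal lt)) = (tofrac (y (Ordinal lt)) - tofrac (x (Ordinal lt)) ^+ q)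
      * ((tofrac (x o0) ^+ 2)^-1) ^+ q.
    rewrite /y tofracD tofracM !tofracXn [_ + _ * _]addrC addrK exprVn -!exprM mulnC mulfK //.
    by rewrite expf_neq0.
  by apply: WM => //; apply: WB.
move=> a; have [mu [nz r mn]] := minpoly_exists sp a.
exists mu; split=> //; apply: (minpoly_separable nz r mn).
exact: (minpoly_deriv_neq0 qK sp spq ib nz r mn).
Qed.

End SeparableParameters.

(** * Primitive elements and integral generators *)

Lemma poly_nonroot (R : idomainType) (e : nat -> R) (r : {poly R}) M :
  injective e -> r != 0 -> exists2 n, (M <= n)%N & ~~ root r (e n).
Proof.
move=> ei nz; apply: contrapT => H.
have all_root n : (M <= n)%N -> root r (e n).
  by move=> le; apply/negPn/negP => h; apply: H; exists n.
pose s := [seq e (M + i)%N | i <- iota 0 (size r)].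
have us : uniq s.
  by rewrite map_inj_uniq ?iota_uniq // => i j /ei /addnI.
have := max_poly_roots nz _ us; rewrite size_map size_iota ltnn; apply/implyP/allP => _ /mapP[i _ ->].
by apply: all_root; rewrite leq_addr.
Qed.

Section Primitive.
Variables (F K : fieldType) (io : {rmorphism F -> K}) (e : nat -> F).
Hypotheses (e_inj : injective e) (sepK : all_separable io).

Definition adjoins z x := exists r : {poly F}, x = (map_poly io r).[z].

Lemma adjoins_trans z z' x : adjoins z x -> adjoins z' z -> adjoins z' x.
Proof.
move=> [r ->] [s ->]; exists (r \Po s).
by rewrite map_comp_poly horner_comp.
Qed.

(** [e] supplies infinitely many scalars, of which the primitive element theorem excludes the roots
    of one nonzero polynomial. *)
Lemma primitive_element n (b : 'I_n -> K) : fspan io b -> exists z, forall x, adjoins z x.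
Proof.
move=> sp; suff [z hz] : exists z, forall i, adjoins z (b i).
  have [p hp] := choice hz; exists z => x; have [c ->] := sp x.
  exists (\sum_i c i *: p i); rewrite rmorph_sum horner_sum; apply: eq_bigr => i _.
  by rewrite /= map_polyZ hornerZ -hp.
elim: n b {sp} => [|n IH] b; first by exists 0 => -[].
have [z hz] := IH (fun i => b (lift ord0 i)).
have [p [nzp pz _]] := sepK z; have [q [nzq qb sq]] := sepK (b ord0).
have [r nzr hr] := large_field_PET nzp pz qb sq.
have [m _ /hr[[s1 e1] [s2 e2]]] := poly_nonroot 0 (inj_comp (fmorph_inj io) e_inj) nzr.
exists (io (e m) * b ord0 - z) => i; case: (unliftP ord0 i) => [i' ->|->].
  by apply: adjoins_trans (hz i') _; exists s1.
by exists s2.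
Qed.

End Primitive.

Lemma clear_denominators (R : idomainType) (P : {poly {fraction R}}) :
  exists s (P0 : {poly R}), s != 0 /\ map_poly (@tofrac R) P0 = tofrac s *: P.
Proof.
elim/poly_ind: P => [|P c [s [P0 [nz e]]]].
  by exists 1, 0; rewrite oner_eq0 rmorph0 scaler0.
have [a [b [nb ->]]] := fracP c.
exists (s * b), (b *: P0 * 'X + (a * s)%:P); split; first by rewrite mulf_neq0.
rewrite rmorphD rmorphM /= map_polyX map_polyC map_polyZ e scalerDr /=.
have nb' : tofrac b != 0 :> {fraction R} by rewrite tofrac_eq0.
rewrite scalerA -scalerAl; congr (_ *: _ + _); first by rewrite -tofracM mulrC.
rewrite -[X in _ = X]mul_polyC -polyCM !tofracM; congr (_%:P).
by rewrite mulrACA divff // mulr1 mulrC.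
Qed.

Section PrimitiveInteger.
Variables (R A : idomainType) (phi : {rmorphism R -> A}).
Hypothesis phi_inj : injective phi.
Variables (N : nat) (s : 'I_N -> A).
Hypothesis phi_fin : forall a, exists g : 'I_N -> R, a = \sum_j phi (g j) * s j.
Variable iota : {rmorphism {fraction R} -> {fraction A}}.
Hypothesis iotaE : forall r, iota (tofrac r) = tofrac (phi r).
Hypothesis sepK : all_separable iota.
Variable e : nat -> {fraction R}.
Hypothesis e_inj : injective e.

(** Start from an equation of least size over [R] for a numerator [a] of a primitive element;
    scaling [a] by the leading coefficient makes it monic and keeps it minimal, with no appeal to
    unique factorisation in [R]. Clearing denominators in a Bezout identity for [f] and its
    derivative gives [delta]. *)
Lemma primitive_integer : exists (z : A) (f u v : {poly R}) (delta : R),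
  [/\ f \is monic /\ (1 < size f)%N, (map_poly phi f).[z] = 0,
      forall p : {poly R}, (size p < size f)%N -> (map_poly phi p).[z] = 0 -> p = 0,
      forall x, adjoins iota (tofrac z) x
    & delta != 0 /\ u * f + v * f^`() = delta%:P].
Proof.
have spK := frac_fspan phi_inj phi_fin iotaE.
have [z0 hz0] := primitive_element e_inj sepK spK.
have [a [r [nr ez0]]] := frac_common_denom phi_inj phi_fin iotaE z0.
pose P n := `[< exists p : {poly R}, [/\ p != 0, (map_poly phi p).[a] = 0 & size p = n] >].
have exP : exists n, P n.
  have [q mq hq] := integral_over phi_fin a.
  by exists (size q); apply/asboolP; exists q; split=> //; apply: monic_neq0.
case: (ex_minnP exP) => n /asboolP[p0 [nzp0 rp0 sp0]] minn.
have minp (p : {poly R}) : (size p < n)%N -> (map_poly phi p).[a] = 0 -> p = 0.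
  move=> lt rp; apply/eqP/negP => /negP nz.
  have /minn : P (size p) by apply/asboolP; exists p.
  by rewrite leqNgt lt.
have n1 : (1 < n)%N.
  rewrite ltnNge -sp0; apply/negP => /size1_polyC e0; move: rp0 nzp0.
  rewrite e0 map_polyC hornerC -[RHS](rmorph0 phi) => /phi_inj ->.
  by rewrite polyC0 eqxx.
pose c := lead_coef p0; have nc : c != 0 by rewrite lead_coef_eq0.
pose z := phi c * a.
have nphi x : x != 0 -> phi x != 0 by rewrite -(rmorph0 phi) (inj_eq phi_inj).
(* This is c^(n-2) p0(X/c). The leading coefficient is written apart because there the exponent n -
   2 - i would be negative. *)
pose f := \poly_(i < n) (if i == n.-1 then 1 else c ^+ (n.-2 - i) * p0`_i).
have szf : size f = n by apply: size_poly_eq; rewrite eqxx oner_eq0.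
have mf : f \is monic.
  rewrite monicE /lead_coef szf coef_poly prednK ?(ltnW n1) // leqnn eqxx //.
have cf i : (i < n)%N -> f`_i * c ^+ i = c ^+ n.-2 * p0`_i.
  move=> lt; rewrite coef_poly lt; case: eqP => [->|ne].
    have -> : p0`_n.-1 = c by rewrite /c /lead_coef sp0.
    by rewrite mul1r -exprSr; case: (n) n1 => [|[]].
  have le : (i <= n.-2)%N by move: (n) n1 lt ne => n' h1 h2 h3; lia.
  by rewrite mulrAC -exprD subnK.
have rf : (map_poly phi f).[z] = 0.
  rewrite (@horner_coef_wide _ n) ?size_map_inj_poly ?rmorph0 ?szf //.
  transitivity (phi (c ^+ n.-2) * (map_poly phi p0).[a]); last by rewrite rp0 mulr0.
  rewrite (@horner_coef_wide _ n (map_poly phi p0)); last by rewrite size_map_inj_poly ?rmorph0 ?sp0.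
  rewrite mulr_sumr; apply: eq_bigr => i _; rewrite !coef_map /z exprMn mulrA -rmorphXn -rmorphM /=.
  by rewrite cf // rmorphM mulrA.
have minf (p : {poly R}) : (size p < size f)%N -> (map_poly phi p).[z] = 0 -> p = 0.
  rewrite szf => lt rp; pose p1 := \poly_(i < size p) (c ^+ i * p`_i).
  have p10 : p1 = 0.
    apply: minp; first by apply: leq_ltn_trans (size_poly _ _) lt.
    rewrite -[RHS]rp (@horner_coef_wide _ (size p)); last by rewrite size_map_inj_poly ?rmorph0 ?size_poly.
    rewrite (@horner_coef_wide _ (size p) (map_poly phi p)); last by rewrite size_map_inj_poly ?rmorph0.
    apply: eq_bigr => i _; rewrite !coef_map /=.
    have -> : p1`_i = c ^+ i * p`_i by rewrite coef_poly ltn_ord.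
    by rewrite /z exprMn rmorphM rmorphXn /=; ring.
  apply/polyP => i; rewrite coef0; have [lt'|le] := ltnP i (size p); last by rewrite nth_default.
  have := congr1 (fun q : {poly R} => q`_i) p10; rewrite coef_poly lt' coef0 => /eqP.
  by rewrite mulf_eq0 expf_eq0 (negbTE nc) andbF /= => /eqP.
pose fF := map_poly (@tofrac R) f.
have mapiF (p : {poly R}) x : (map_poly iota (map_poly (@tofrac R) p)).[tofrac x] = tofrac (map_poly phi p).[x].
  rewrite -horner_map -!map_poly_comp; congr (_.[_]).
  by apply: eq_map_poly => y /=; rewrite iotaE.
have rfF : root (map_poly iota fF) (tofrac z) by rewrite /root mapiF rf rmorph0.
have tinj : injective (@tofrac R) by move=> x y /eqP; rewrite tofrac_eq => /eqP.
have szfF : size fF = n by rewrite size_map_inj_poly ?rmorph0.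
have nzfF : fF != 0 by rewrite -size_poly_gt0 szfF ltnW.
have minF (p : {poly {fraction R}}) : p != 0 -> root (map_poly iota p) (tofrac z) -> (size fF <= size p)%N.
  move=> nz rp; rewrite leqNgt; apply/negP => lt.
  have [t [q [nt eq]]] := clear_denominators p.
  have nt' : tofrac t != 0 :> {fraction R} by rewrite tofrac_eq0.
  have q0 : q = 0.
    apply: minf.
      by rewrite szf -szfF -(size_map_inj_poly tinj) ?rmorph0 // eq size_scale.
    apply/eqP; rewrite -tofrac_eq0 -mapiF eq map_polyZ hornerZ (eqP rp) mulr0 //.
  by move/eqP: eq; rewrite q0 rmorph0 eq_sym scaler_eq0 (negbTE nt') (negbTE nz).
have [mu [nmu rmu smu]] := sepK (tofrac z).
have := minpoly_dvd nzfF rfF minF rmu => dvd.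
have := dvdp_separable dvd smu; rewrite unlock => /Bezout_eq1_coprimepP[[U V] /= UV].
have [t1 [u1 [nt1 eu]]] := clear_denominators U.
have [t2 [v1 [nt2 ev]]] := clear_denominators V.
exists z, f, (t2 *: u1), (t1 *: v1), (t1 * t2); split=> //.
- by split=> //; rewrite szf.
- move=> x; apply: adjoins_trans (hz0 x) _; rewrite ez0.
  exists ((tofrac r * tofrac c)^-1 *: 'X).
  rewrite map_polyZ map_polyX hornerZ hornerX fmorphV rmorphM /= !iotaE.
  have nc' : tofrac (phi c) != 0 :> {fraction A} by rewrite tofrac_eq0 nphi.
  by rewrite /z tofracM invfM -mulrA mulKf // mulrC.
- split; first by rewrite mulf_neq0.
  have /(@map_inj_poly _ _ (@tofrac R)) : injective (@tofrac R) by [].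
  rewrite rmorph0 => /(_ erefl); apply.
  rewrite rmorphD !rmorphM /= !map_polyZ map_polyC -deriv_map eu ev -/fF /=.
  by rewrite !scalerA -!scalerAl [tofrac t2 * _]mulrC -scalerDr UV alg_polyC polyCM map_polyC.
Qed.

End PrimitiveInteger.

(** * Norms over the power series ring in one variable *)

Lemma horner_mx_comp_poly (R : comNzRingType) n (M : 'M[R]_n.+1) h a :
  horner_mx (horner_mx M h) a = horner_mx M (a \Po h).
Proof.
elim/poly_ind: a => [|a c IH]; first by rewrite comp_poly0 !rmorph0.
by rewrite comp_poly_MXaddC !rmorphD !rmorphM /= IH horner_mx_X !horner_mx_C.
Qed.

Section Companion.
Variables (R : comNzRingType) (n : nat).

(* companionmx, with an index type of the form n.+1 so that horner_mx applies. *)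
Definition cmpx (p : {poly R}) : 'M[R]_n.+1 :=
  \matrix_(i, j) if i == n :> nat then - p`_j else (i.+1 == j :> nat)%:R.

(* The norm of the class of [h] in R[X]/(p). *)
Definition nm (p h : {poly R}) := \det (horner_mx (cmpx p) h).

Lemma char_poly_cmpx p : p \is monic -> size p = n.+2 -> char_poly (cmpx p) = p.
Proof.
move=> mp sp.
have gen m (e : (size p).-1 = m) : char_poly (\matrix_(i < m, j < m)
    (if i == m.-1 :> nat then - p`_j else (i.+1 == j :> nat)%:R)) = p.
  by subst m; exact: companionmxK.
by apply: (gen n.+1); rewrite sp.
Qed.

Lemma horner_cmpx0 p : p \is monic -> size p = n.+2 -> horner_mx (cmpx p) p = 0.
Proof. by move=> mp sp; rewrite -{2}(char_poly_cmpx mp sp) Cayley_Hamilton. Qed.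

Lemma nmM p h h' : nm p (h * h') = nm p h * nm p h'.
Proof. by rewrite /nm rmorphM det_mulmx. Qed.

Lemma nmC p c : nm p c%:P = c ^+ n.+1.
Proof. by rewrite /nm horner_mx_C det_scalar. Qed.

Lemma nm1 p : nm p 1 = 1.
Proof. by rewrite -polyC1 nmC expr1n. Qed.

Lemma nmX p h i : nm p (h ^+ i) = nm p h ^+ i.
Proof.
elim: i => [|i IH]; first by rewrite !expr0 nm1.
by rewrite [h ^+ _]exprS nmM IH -exprS.
Qed.

Lemma nmN1 p h : nm p (- h) = (-1) ^+ n.+1 * nm p h.
Proof. by rewrite -(mulN1r h) nmM -polyCN nmC. Qed.

Lemma nm_mod p h q : p \is monic -> size p = n.+2 -> nm p (h + p * q) = nm p h.
Proof. by move=> mp sp; rewrite /nm rmorphD rmorphM /= horner_cmpx0 // mul0r addr0. Qed.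

(** The powers of a root form an eigenvector of the companion matrix; this carries matrix identities
    over [R] to values at [z] in [A]. *)
Lemma cmpx_col (A : comNzRingType) (f : {rmorphism R -> A}) p z :
  p \is monic -> size p = n.+2 -> (map_poly f p).[z] = 0 ->
  map_mx f (cmpx p) *m (\col_i z ^+ i) = z *: (\col_i z ^+ i).
Proof.
move=> mp sp rp; apply/matrixP => i j; rewrite !mxE -exprS.
have [il|ne] := eqVneq (i : nat) n.
  move: rp; rewrite (@horner_coef_wide _ n.+2); last first.
    by rewrite -sp size_poly.
  rewrite big_ord_recr /= => /eqP; rewrite addr_eq0 => /eqP e.
  under eq_bigr do rewrite !mxE il eqxx rmorphN mulNr -coef_map.
  rewrite sumrN e opprK il coef_map /=.
  by have := monicP mp; rewrite /lead_coef sp => ->; rewrite rmorph1 mul1r.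
have lt : (i.+1 < n.+1)%N by rewrite ltn_neqAle eqSS ne /= ltn_ord.
rewrite (bigD1 (Ordinal lt)) //= !mxE (negbTE ne) eqxx rmorph1 mul1r big1 ?addr0 //.
move=> l nl; rewrite !mxE (negbTE ne); case: eqP => [e|]; last by rewrite rmorph0 mul0r.
by case/eqP: nl; apply: val_inj.
Qed.

Lemma horner_cmpx_col (A : comNzRingType) (f : {rmorphism R -> A}) p z h :
  p \is monic -> size p = n.+2 -> (map_poly f p).[z] = 0 ->
  map_mx f (horner_mx (cmpx p) h) *m (\col_i z ^+ i) = (map_poly f h).[z] *: (\col_i z ^+ i).
Proof.
move=> mp sp rp; elim/poly_ind: h => [|h c IH].
  by rewrite !rmorph0 horner0 scale0r mul0mx.
rewrite !rmorphD !rmorphM /= horner_mx_X horner_mx_C map_scalar_mx -?mulmxE.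
rewrite mulmxDl -mulmxA cmpx_col // -scalemxAr IH mul_scalar_mx scalerA -scalerDl.
by rewrite map_polyX map_polyC hornerMXaddC mulrC.
Qed.

Lemma map_cmpx (S : comNzRingType) (f : {rmorphism R -> S}) p :
  map_mx f (cmpx p) = \matrix_(i, j) if i == n :> nat then - (map_poly f p)`_j else (i.+1 == j :> nat)%:R.
Proof.
apply/matrixP => i j; rewrite !mxE; case: ifP => _; first by rewrite rmorphN coef_map.
by rewrite rmorph_nat.
Qed.

End Companion.

Lemma map_nm n (R S : comNzRingType) (f : {rmorphism R -> S}) (p h : {poly R}) :
  f (nm n p h) = nm n (map_poly f p) (map_poly f h).
Proof. by rewrite /nm -det_map_mx map_horner_mx map_cmpx. Qed.

Section CompanionField.
Variables (F : fieldType).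

Lemma rV_cmpx n (p : {poly F}) (v : 'rV_n.+1) : p \is monic -> size p = n.+2 ->
  rVpoly (v *m cmpx n p) = (rVpoly v * 'X) %% p.
Proof.
move=> mp sp; pose c := v 0 ord_max.
have e : rVpoly v * 'X = c%:P * p + rVpoly (v *m cmpx n p).
  have pl : p`_n.+1 = 1 by have := monicP mp; rewrite /lead_coef sp.
  apply/polyP => j; rewrite coefMX coefD coefCM.
  have [lt|le] := ltnP j n.+1; last first.
    rewrite [(rVpoly (_ *m _))`_j]nth_default ?addr0; last by apply: leq_trans le; apply: size_poly.
    case: j le => // j; rewrite ltnS leq_eqVlt => /orP[/eqP <-|lt] /=.
      by rewrite pl mulr1 -[n in _`_n]/(nat_of_ord (@ord_max n)) coef_rVpoly_ord.
    rewrite !nth_default ?mulr0 //; first by rewrite sp.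
    by apply: leq_trans lt; apply: size_poly.
  have -> : (rVpoly (v *m cmpx n p))`_j = (v *m cmpx n p) 0 (Ordinal lt).
    by rewrite -[j in _`_j]/(nat_of_ord (Ordinal lt)) coef_rVpoly_ord.
  rewrite mxE big_ord_recr /= mxE eqxx mulrN addrCA subrr addr0.
  case: j lt => [|j] lt /=.
    by rewrite big1 // => i _; rewrite mxE /= ltn_eqF ?ltn_ord // mulr0.
  have lt' : (j < n)%N by [].
  rewrite (bigD1 (Ordinal lt')) //= mxE /= ltn_eqF // eqxx mulr1 big1 ?addr0.
    by rewrite -coef_rVpoly_ord.
  move=> i ne; rewrite mxE /= ltn_eqF ?ltn_ord // eqSS; case: eqP => [e|]; last by rewrite mulr0.
  by case/eqP: ne; apply: val_inj.
rewrite e modp_addl_mul_small // sp ltnS; exact: size_poly.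
Qed.

Lemma rV_horner n (p h : {poly F}) (v : 'rV_n.+1) : p \is monic -> size p = n.+2 ->
  rVpoly (v *m horner_mx (cmpx n p) h) = (rVpoly v * h) %% p.
Proof.
move=> mp sp; elim/poly_ind: h v => [|h c IH] v.
  by rewrite rmorph0 mulmx0 linear0 mulr0 mod0p.
rewrite rmorphD rmorphM /= horner_mx_X horner_mx_C mulmxDr linearD /=.
rewrite -[_ *m (_ * _)]/(v *m (horner_mx (cmpx n p) h *m cmpx n p)) mulmxA rV_cmpx // IH.
rewrite mul_mx_scalar linearZ /= mulrDr modpD mulrA; congr (_ + _).
  by rewrite [(_ %% p) * 'X]mulrC modp_mul ['X * _]mulrC.
rewrite mulrC mul_polyC modpZl modp_small // sp ltnS; exact: size_poly.
Qed.

Lemma nm_inverse n (p h : {poly F}) : p \is monic -> size p = n.+2 -> coprimep p h ->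
  exists h', nm n p h * nm n p h' = 1 /\ exists q, h * h' = 1 + p * q.
Proof.
move=> mp sp /Bezout_eq1_coprimepP[[u v] /= e]; exists v.
have e' : h * v = 1 + p * (- u) by rewrite -e; ring.
by split; [rewrite -nmM e' nm_mod // nm1 | exists (- u)].
Qed.

Lemma row_poly m n (a : {poly F}) (u : 'rV_m) :
  u *m (\matrix_(i < m) (poly_rV (a * 'X^i) : 'rV_n)) = poly_rV (a * rVpoly u).
Proof.
have -> : rVpoly u = \sum_i u 0 i *: 'X^i.
  apply/polyP => j; rewrite coef_sum coef_rVpoly; case: insubP => [i _ <-|nlt].
    rewrite (bigD1 i) //= coefZ coefXn eqxx mulr1 big1 ?addr0 // => l ne.
    by rewrite coefZ coefXn; case: eqP => [/val_inj e|]; [rewrite e eqxx in ne | rewrite mulr0].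
  rewrite big1 // => i _; rewrite coefZ coefXn; case: eqP => [e|]; last by rewrite mulr0.
  by case/negP: nlt; rewrite e ltn_ord.
rewrite mulr_sumr linear_sum; apply/rowP => j; rewrite !mxE summxE.
by apply: eq_bigr => i _; rewrite /= -scalerAr linearZ /= !mxE.
Qed.

(** In F[X]/(g1 g2) the multiples of [g2] form a copy of F[X]/(g1), with quotient F[X]/(g2). In the
    basis made of the g2 X^i and the X^i, multiplication by [h] is block triangular with the two
    smaller multiplications on the diagonal. *)
Lemma nm_mul_poly n1 n2 (g1 g2 h : {poly F}) : g1 \is monic -> size g1 = n1.+2 ->
  g2 \is monic -> size g2 = n2.+2 ->
  nm (n1 + n2.+1) (g1 * g2) h = nm n1 g1 h * nm n2 g2 h.
Proof.
move=> m1 s1 m2 s2; set n := (n1 + n2.+1)%N; set f := g1 * g2.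
have nz1 := monic_neq0 m1; have nz2 := monic_neq0 m2.
have mf : f \is monic by rewrite /f monicMr.
have sf : size f = n.+2 by rewrite /f size_mul // s1 s2 /n; lia.
have nzf := monic_neq0 mf.
pose Bu := \matrix_(i < n1.+1) (poly_rV (g2 * 'X^i) : 'rV[F]_n.+1).
pose Bl := \matrix_(i < n2.+1) (poly_rV (1 * 'X^i) : 'rV[F]_n.+1).
pose B : 'M[F]_(n1.+1 + n2.+1, n.+1) := col_mx Bu Bl.
pose E := \matrix_(i < n2.+1) (poly_rV ((('X^i * h) %% f) %/ g2) : 'rV[F]_n1.+1).
pose M' : 'M[F]_(n1.+1 + n2.+1) := block_mx (horner_mx (cmpx n1 g1) h) 0 E (horner_mx (cmpx n2 g2) h).
have modf a : (g2 * a) %% f = g2 * (a %% g1).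
  rewrite {1}(divp_eq a g1) mulrDr.
  have -> : g2 * (a %/ g1 * g1) = (a %/ g1) * f by rewrite /f; ring.
  rewrite modp_addl_mul_small // sf.
  have [->|nzr] := eqVneq (a %% g1) 0; first by rewrite mulr0 size_poly0.
  have := ltn_modp a g1; rewrite nz1 s1 (size_mul nz2 nzr) s2 /n.
  by move: (size (a %% g1)) => u; lia.
have modg2 a : (a %% f) %% g2 = a %% g2.
  rewrite {2}(divp_eq a f) modpD (_ : (a %/ f * f) %% g2 = 0) ?add0r //.
  by apply/eqP; rewrite -/(dvdp g2 _) /f mulrA dvdp_mull.
have sB (a : {poly F}) : (size a <= n.+1)%N -> rVpoly (poly_rV a : 'rV[F]_n.+1) = a by apply: poly_rV_K.
have bu (u : 'rV_n1.+1) (w : 'rV_n2.+1) :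
    row_mx u w *m B = poly_rV (g2 * rVpoly u + 1 * rVpoly w).
  by rewrite mul_row_col !row_poly linearD.
have row_h m (p : {poly F}) i : p \is monic -> size p = m.+2 ->
    rVpoly (row i (horner_mx (cmpx m p) h)) = ('X^i * h) %% p.
  by move=> mp sp; rewrite rowE rV_horner // rVpoly_delta.
have key : B *m horner_mx (cmpx n f) h = M' *m B.
  apply/row_matrixP => i; rewrite !row_mul.
  apply: (can_inj (@rVpolyK _ _)); rewrite rV_horner //.
  case: (splitP i) => l il; [have -> : i = lshift n2.+1 l by apply: val_inj |
                             have -> : i = rshift n1.+1 l by apply: val_inj].
    rewrite /M' /B /block_mx !rowKu rowK row_row_mx row0 -/B bu linear0 mulr0 addr0.
    rewrite row_h // -modf sB; last first.
      by rewrite -ltnS -sf ltn_modp.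
    rewrite sB ?mulrA // size_mul ?monic_neq0 ?monicXn // size_polyXn s2.
    by have := ltn_ord l; rewrite /n; lia.
  rewrite /M' /B /block_mx !rowKd rowK row_row_mx -/B bu mul1r rowK row_h //.
  have -> : rVpoly (poly_rV ((('X^l * h) %% f) %/ g2) : 'rV_n1.+1) = (('X^l * h) %% f) %/ g2.
    apply: poly_rV_K; rewrite size_divp // s2; have := ltn_modp ('X^l * h) f; rewrite nzf sf.
    by rewrite /n; move: (size _) => u; lia.
  have -> : g2 * ((('X^l * h) %% f) %/ g2) + 1 * (('X^l * h) %% g2) = ('X^l * h) %% f.
    by rewrite mul1r -(modg2 ('X^l * h)) mulrC -divp_eq.
  rewrite (sB 'X^l); last by rewrite size_polyXn; have := ltn_ord l; rewrite /n; lia.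
  by rewrite sB // -ltnS -sf ltn_modp.
have fB : row_free B.
  rewrite -kermx_eq0; apply/rowV0P => v /sub_kermxP.
  rewrite -[v]hsubmxK; set u : 'rV_n1.+1 := lsubmx _; set w : 'rV_n2.+1 := rsubmx _.
  have su : (size (rVpoly u) <= n1.+1)%N by apply: size_poly.
  have sw : (size (rVpoly w) <= n2.+1)%N by apply: size_poly.
  have sgu : (size (g2 * rVpoly u)%R <= n.+1)%N.
    have [->|nz] := eqVneq (rVpoly u) 0; first by rewrite mulr0 size_poly0.
    by move: su; rewrite size_mul // s2 /n; move: (size (rVpoly u)) => x; lia.
  rewrite bu mul1r => /(congr1 rVpoly); rewrite linear0 sB; last first.
    apply: leq_trans (size_polyD _ _) _; rewrite geq_max sgu (leq_trans sw) // /n; lia.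
  move=> e; have w0 : rVpoly w = 0.
    have := congr1 (fun a : {poly F} => a %% g2) e.
    by rewrite mulrC modp_addl_mul_small ?s2 // mod0p.
  move: e; rewrite w0 addr0 => /eqP; rewrite mulf_eq0 (negbTE nz2) /= => /eqP u0.
  have inj0 m (x : 'rV[F]_m) : rVpoly x = 0 -> x = 0.
    by move=> h0; rewrite -[x]rVpolyK h0 linear0.
  by rewrite (inj0 _ _ u0) (inj0 _ _ w0) row_mx0.
have detB : \det (B : 'M[F]_n.+1) != 0 by rewrite -unitfE -[_ \is a _]unitmxE -row_free_unit.
apply: (mulfI detB); rewrite /nm -det_mulmx.
rewrite [X in \det X](key : (B : 'M[F]_n.+1) *m _ = (M' : 'M[F]_n.+1) *m B).
have dM : \det M' = nm n1 g1 h * nm n2 g2 h by apply: det_lblock.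
by rewrite det_mulmx mulrC; congr (_ * _); apply: dM.
Qed.

End CompanionField.

Section IrreduciblePowers.
Variables (F : fieldType).
Implicit Types (g p q : {poly F}).

Lemma irredp_coprime g p : irreducible_poly g -> ~~ (g %| p) -> coprimep g p.
Proof.
move=> ig nd; apply/coprimepP => d dg dp.
rewrite -size_poly_eq1; apply/negPn/negP => s1; case/negP: nd.
by rewrite -(eqp_dvdl _ (ig.2 _ s1 dg)).
Qed.

Lemma irredp_prime g p q : irreducible_poly g -> g %| p * q -> (g %| p) || (g %| q).
Proof.
move=> ig; have [//|nd] := boolP (g %| p).
by rewrite mulrC Gauss_dvdpl // irredp_coprime.
Qed.

Lemma irredp_factor p : p \is monic -> (1 < size p)%N ->
  exists g, [/\ g \is monic, irreducible_poly g & g %| p].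
Proof.
have [N] := ubnP (size p); elim: N p => // N IH p; rewrite ltnS => sp mp s1.
have [|/existsNP[q]] := pselect (forall q, size q != 1 -> q %| p -> q %= p).
  by move=> H; exists p; rewrite dvdpp; split.
move/not_implyP => [sq /not_implyP[qp nq]].
have nzp := monic_neq0 mp; have nzq : q != 0 by apply: contraTneq qp => ->; rewrite dvd0p.
have lq : lead_coef q != 0 by rewrite lead_coef_eq0.
pose r := (lead_coef q)^-1 *: q.
have rq : r %= q by rewrite eqp_scale // invr_eq0.
have mr : r \is monic by rewrite monicE lead_coefZ mulVf.
have rp : r %| p by rewrite (eqp_dvdl _ rq).
have sr : (size r < size p)%N.
  rewrite (eqp_size rq) ltn_neqAle dvdp_leq // andbT dvdp_size_eqp //; exact/negP.
have s1r : (1 < size r)%N.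
  rewrite (eqp_size rq) ltn_neqAle eq_sym sq /= lt0n size_poly_eq0 //.
have [g [mg ig gr]] := IH r (leq_trans sr sp) mr s1r.
by exists g; split=> //; apply: dvdp_trans rp.
Qed.

Lemma monic_dvd_exp g q n : g \is monic -> irreducible_poly g -> q \is monic ->
  q %| g ^+ n -> exists s, q = g ^+ s.
Proof.
move=> mg ig; elim: n q => [|n IH] q mq.
  rewrite expr0 dvdp1 => /size_poly1P[c nc e]; exists 0%N; rewrite expr0 e.
  by move: mq; rewrite e monicE lead_coefC => /eqP ->; rewrite polyC1.
have [/dvdpP[q' e] |nd] := boolP (g %| q).
  have mq' : q' \is monic by move: mq; rewrite e monicMr.
  rewrite e exprSr dvdp_mul2r ?monic_neq0 // => /(IH _ mq')[s ->].
  by exists s.+1; rewrite exprSr.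
rewrite exprS Gauss_dvdpr; first exact: IH.
by rewrite coprimep_sym irredp_coprime.
Qed.

End IrreduciblePowers.

(* p(X) - p(M) is divisible by X - M, so a polynomial killing M has a power divisible
   by the characteristic polynomial. *)
Lemma char_poly_dvd_exp (F : fieldType) n (M : 'M[F]_n.+1) p :
  horner_mx M p = 0 -> char_poly M %| p ^+ n.+1.
Proof.
move=> h0; suff [S e] : exists S, p%:M - map_mx polyC (horner_mx M p) = char_poly_mx M *m S.
  rewrite -det_scalar; move: e; rewrite h0 raddf0 subr0 => ->.
  by rewrite det_mulmx dvdp_mulr.
elim/poly_ind: p {h0} => [|p c [S e]].
  by exists 0; rewrite !rmorph0 subr0 mulmx0.
exists (p%:M + map_mx polyC M *m S).
have comm : map_mx polyC M *m char_poly_mx M = char_poly_mx M *m map_mx polyC M.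
  by rewrite /char_poly_mx mulmxBr mulmxBl scalar_mxC.
rewrite mulmxDr mulmxA -comm -mulmxA -e [p * 'X]mulrC.
rewrite [horner_mx M _]rmorphD /= [horner_mx M ('X * p)]rmorphM /= horner_mx_X horner_mx_C.
rewrite [(_ + _)%:M]raddfD /= [map_mx _ (_ + _)]raddfD /= [map_mx _ (_ * _)]map_mxM map_scalar_mx /=.
rewrite mulmxBr [in RHS]/char_poly_mx mulmxBl -scalar_mxM opprD addrACA subrr addr0.
by rewrite addrA subrK.
Qed.

(** * Valuation and integral norms over k[[t]] *)

Section Valuation.
Variable k : fieldType.
Notation O := (mfps k 1).
Notation F := {fraction O}.
Notation tF := (tofrac (tO : O) : F).
Implicit Types (x y : F) (f g : O).

Lemma tO_neq0 : tO != 0 :> O.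
Proof.
apply/eqP => /(congr1 (fun f => cf f 1)); rewrite -[tO]expr1 cf_t eqxx => /eqP.
by rewrite oner_eq0.
Qed.

Lemma tF_neq0 : tF != 0.
Proof. by rewrite tofrac_eq0 tO_neq0. Qed.

Lemma cf0M f g : cf (f * g) 0 = cf f 0 * cf g 0.
Proof.
have [f1 [_ ef]] := cf_shift 1 f; have [g1 [_ eg]] := cf_shift 1 g.
rewrite {1}ef {1}eg !big_ord1 !expr0 !mulr1 expr1.
set a := mfpsC 1 _; set b := mfpsC 1 _.
have -> : (a + tO * f1) * (b + tO * g1) = a * b + tO ^+ 1 * (f1 * b + a * g1 + tO * f1 * g1).
  by rewrite expr1; ring.
by rewrite cf_D cf_tM /= addr0 /a /b -rmorphM cfC.
Qed.

Lemma cf0_div f : cf f 0 = 0 -> exists g, f = tO * g.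
Proof. by move=> h; have [|g e] := @cf_dvd k 1 f; [case | exists g; rewrite -[tO]expr1]. Qed.

Lemma mfps1_decomp f : f != 0 -> exists j u, cf u 0 != 0 /\ f = tO ^+ j * u.
Proof.
move=> nz; have ex : exists i, cf f i != 0.
  apply: contrapT => H; case/eqP: nz; apply: cfP => i.
  rewrite [RHS]mfps_coef0; apply/eqP/negP => /negP h; apply: H; by exists i.
case: (ex_minnP ex) => j hj mn.
have [|u e] := @cf_dvd k j f.
  move=> i lt; apply/eqP/negP => /negP /mn; rewrite leqNgt lt //.
by exists j, u; split=> //; move: hj; rewrite e cf_tM leqnn subnn.
Qed.

(* [x] is nonzero of valuation [j]; only nonnegative valuations are covered. *)
Definition hval x j := exists2 u : O, cf u 0 != 0 & x = tF ^+ j * tofrac u.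

Definition inO x := exists f, x = tofrac f.

Lemma hval_unit u : cf u 0 != 0 -> hval (tofrac u) 0.
Proof. by exists u; rewrite // expr0 mul1r. Qed.

Lemma hval1 : hval 1 0.
Proof.
by rewrite -(@tofrac1 O); apply: hval_unit; rewrite -(rmorph1 (@mfpsC k 1)) cfC eqxx oner_eq0.
Qed.

Lemma hval_t : hval tF 1.
Proof. by have [u h e] := hval1; exists u; rewrite // expr1 -[tofrac u]mul1r -(expr0 tF) -e mulr1. Qed.

Lemma hvalM x y i j : hval x i -> hval y j -> hval (x * y) (i + j).
Proof.
move=> [u hu ->] [v hv ->]; exists (u * v); first by rewrite cf0M mulf_neq0.
by rewrite tofracM exprD mulrACA.
Qed.

Lemma hvalX x i n : hval x i -> hval (x ^+ n) (i * n).
Proof.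
move=> h; elim: n => [|n IH]; first by rewrite muln0; apply: hval1.
by rewrite exprS mulnS; apply: hvalM.
Qed.

Lemma hval_inv0 x : hval x 0 -> hval x^-1 0.
Proof.
move=> [u hu ->]; have [v e] := mfps_inverse1 hu.
have hv : cf v 0 != 0.
  apply: contraNneq (oner_neq0 k) => v0; have := cf0M u v.
  by rewrite e v0 mulr0 -(rmorph1 (@mfpsC k 1)) cfC eqxx => ->.
exists v => //; rewrite !expr0 !mul1r; apply: (mulfI (x := tofrac u)).
  by rewrite tofrac_eq0; apply: contraNneq hu => ->; rewrite /cf mfps_coef0.
by rewrite divff -?tofracM ?e ?tofrac1 // tofrac_eq0; apply: contraNneq hu => ->; rewrite /cf mfps_coef0.
Qed.

Lemma hval_neq0 x j : hval x j -> x != 0.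
Proof.
move=> [u hu ->]; rewrite mulf_neq0 ?expf_neq0 ?tF_neq0 // tofrac_eq0.
by apply: contraNneq hu => ->; rewrite /cf mfps_coef0.
Qed.

Lemma hval_inO x j : hval x j -> inO x.
Proof. by move=> [u _ ->]; exists (tO ^+ j * u); rewrite tofracM tofracXn. Qed.

Lemma inO_hval x : inO x -> x != 0 -> exists j, hval x j.
Proof.
move=> [f ->]; rewrite tofrac_eq0 => /mfps1_decomp[j [u [hu ->]]].
by exists j, u; rewrite // tofracM tofracXn.
Qed.

Lemma hval_le f x i j : hval x i -> x = tF ^+ j * tofrac f -> (j <= i)%N.
Proof.
move=> [u hu e]; rewrite e leqNgt -!tofracXn -!tofracM => /eqP; rewrite tofrac_eq => /eqP e'.
apply/negP => lt; case/negP: hu; have := congr1 (fun f => cf f i) e'.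
by rewrite !cf_tM leqnn subnn leqNgt lt /= => ->.
Qed.

Lemma hval_uniq x i j : hval x i -> hval x j -> i = j.
Proof.
move=> hi hj; apply/eqP; rewrite eqn_leq.
by case: (hi) => u _ eu; case: (hj) => v _ ev; rewrite (hval_le hi ev) (hval_le hj eu).
Qed.

Lemma hval_div x y i j : hval x i -> hval y j -> (j <= i)%N -> hval (x / y) (i - j).
Proof.
move=> [u hu ->] [v hv ->] le.
have [w hw e] := hval_inv0 (hval_unit hv).
exists (u * w); first by rewrite cf0M mulf_neq0.
rewrite -{1}(subnK le) exprD tofracM; move: e; rewrite expr0 mul1r => <-.
by rewrite invfM mulrACA mulfK // expf_neq0 ?tF_neq0.
Qed.

Lemma val_cases x : x != 0 -> (exists j, hval x j) \/ exists2 j, (0 < j)%N & hval x^-1 j.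
Proof.
have [a [b [nb ->]]] := fracP x; rewrite mulf_eq0 negb_or tofrac_eq0 => /andP[na _].
have [|i ha] := inO_hval (ex_intro _ a erefl); first by rewrite tofrac_eq0.
have [|j hb] := inO_hval (ex_intro _ b erefl); first by rewrite tofrac_eq0.
have [le|lt] := leqP j i; first by left; exists (i - j)%N; apply: hval_div.
right; exists (j - i)%N; rewrite ?subn_gt0 // invfM invrK mulrC.
by apply: hval_div => //; apply: ltnW.
Qed.

Lemma inO_closed x s : inO (x ^+ s.+1) -> inO x.
Proof.
move=> h; have [->|nz] := eqVneq x 0; first by exists 0; rewrite tofrac0.
have [[j /hval_inO //]|[j j0 hj]] := val_cases nz.
have [|i hi] := inO_hval h; first by rewrite expf_neq0.
have := hvalM hi (hvalX s.+1 hj); rewrite -exprMn divff // expr1n => /(hval_uniq hval1).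
by move/esym/eqP; rewrite addn_eq0 muln_eq0 (gtn_eqF j0) !andbF.
Qed.

Lemma inOM x y : inO x -> inO y -> inO (x * y).
Proof. by move=> [f ->] [g ->]; exists (f * g); rewrite tofracM. Qed.

Lemma inO_all x : (forall M, exists f, x = tF ^+ M * tofrac f) -> x = 0.
Proof.
move=> H; apply/eqP/negP => /negP nz; have [f e] := H 0%N.
have [|j hj] := inO_hval (x := x) _ nz; first by exists f; rewrite e expr0 mul1r.
by have [g /(hval_le hj)] := H j.+1; rewrite ltnn.
Qed.

Lemma clear_t (P : {poly F}) : exists J (P0 : {poly O}), map_poly (@tofrac O) P0 = tF ^+ J *: P.
Proof.
have [s [P0 [nz e]]] := clear_denominators P.
have [J [u [hu es]]] := mfps1_decomp nz; have [v ev] := mfps_inverse1 hu.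
exists J, (v *: P0); rewrite map_polyZ /= e scalerA -tofracM es mulrCA [v * u]mulrC ev mulr1.
by rewrite tofracXn.
Qed.

End Valuation.

Section PolynomialEmbedding.
Variables (k : fieldType) (n : nat) (j : 'I_n.+1).

Lemma rho_emb (f : mfps k n) : rho j (emb j f) = mfpsC 1 (mfps_coef f 0%MM).
Proof.
apply: cfP => i; rewrite rho_coef emb_coef cfC mulmnE mnm1E eqxx mul1n.
case: eqP => // ->; congr (mfps_coef _ _); apply/mnmP => l.
by rewrite !mnmE.
Qed.

Lemma rho_T : rho j (mfpsX k j) = tO.
Proof. by rewrite /rho /= ev_X /axis_pt eqxx. Qed.

(* A polynomial over a power series ring, read as a power series in one more variable. *)
Definition pemb : {rmorphism {poly mfps k n} -> mfps k n.+1} :=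
  horner_eval (mfpsX k j) \o map_poly (emb j).

Lemma pemb_horner P : pemb P = (map_poly (emb j) P).[mfpsX k j].
Proof. by []. Qed.

Lemma pembC f : pemb f%:P = emb j f.
Proof. by rewrite pemb_horner map_polyC hornerC. Qed.

Lemma pemb_wide (P : {poly mfps k n}) N : (size P <= N)%N ->
  pemb P = \sum_(i < N) emb j P`_i * mfpsX k j ^+ i.
Proof.
move=> le; rewrite pemb_horner (@horner_coef_wide _ N).
  by apply: eq_bigr => i _; rewrite coef_map.
by apply: leq_trans le; apply: size_poly.
Qed.

Lemma rho_pemb (P : {poly mfps k n}) i : cf (rho j (pemb P)) i = mfps_coef P`_i 0%MM.
Proof.
rewrite (@pemb_wide P (maxn (size P) i.+1)) ?leq_maxl // rmorph_sum /cf mfps_coef_sum.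
have lt : (i < maxn (size P) i.+1)%N by rewrite leq_max ltnSn orbT.
rewrite (bigD1 (Ordinal lt)) //= big1 ?addr0 => [|l ne].
  by rewrite rmorphM rmorphXn /= rho_emb rho_T mulrC -[mfps_coef _ _]/(cf _ i) cf_tM leqnn subnn cfC.
rewrite rmorphM rmorphXn /= rho_emb rho_T mulrC -[mfps_coef _ _]/(cf _ i) cf_tM.
case: leqP => // le; rewrite cfC subn_eq0 leqNgt ltn_neqAle le andbT.
by have -> : (l != i :> nat) by apply: contraNneq ne => e; apply/eqP/val_inj.
Qed.

End PolynomialEmbedding.

Section OneDimensional.
Variable k : fieldType.
Notation O := (mfps k 1).
Notation F := {fraction O}.
Notation tF := (tofrac (tO : O) : F).
Notation toF := (map_poly (@tofrac O)).
Implicit Types (mu g h y : {poly F}).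

(* Otherwise Weierstrass division of [T^r] by a primitive multiple of [mu] would produce a
   proper factor. *)
Lemma irreducible_integral mu : mu \is monic -> irreducible_poly mu -> inO mu`_0 ->
  exists G : {poly O}, mu = toF G.
Proof.
move=> mm im m0.
have exJ : exists J, `[< exists G : {poly O}, toF G = tF ^+ J *: mu >].
  by have [J [G e]] := clear_t mu; exists J; apply/asboolP; exists G.
case: (ex_minnP exJ) => J /asboolP[G eG] mn.
case: J eG mn => [|J] eG mn; first by exists G; rewrite eG expr0 scale1r.
(* Minimality of the power of t: otherwise every coefficient of [G] could be divided by t. *)
have [r0 hr0] : exists i, cf G`_i 0 != 0.
  apply: contrapT => H; suff : (J.+1 <= J)%N by rewrite ltnn.
  apply/mn/asboolP.
  have Hd i : exists x, G`_i = tO * x.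
    by apply: cf0_div; apply/eqP/negP => /negP h; apply: H; exists i.
  have [g hg] := choice Hd; exists (\poly_(i < size G) g i).
  apply/polyP => i; rewrite coef_map coef_poly coefZ; apply: (mulfI (tF_neq0 k)).
  rewrite mulrA -exprS -coefZ -eG coef_map /= hg tofracM; congr (_ * tofrac _).
  case: ltnP => // le; apply/esym/eqP; have := tO_neq0 k; apply: contraNT => nz.
  have : tO * g i == 0 by rewrite -hg nth_default.
  by rewrite mulf_eq0 (negbTE nz) orbF.
have exr : exists i, cf G`_i 0 != 0 by exists r0.
case: (ex_minnP exr) => r hr minr {r0 hr0 exr exJ mn}.
have cG i x : tofrac G`_i = tF ^+ J.+1 * tofrac x -> cf G`_i 0 = 0.
  rewrite -tofracXn -tofracM => /eqP; rewrite tofrac_eq => /eqP ->.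
  by rewrite cf_tM.
have eGi i : tofrac G`_i = tF ^+ J.+1 * mu`_i by rewrite -coefZ -eG coef_map.
(* The leading coefficient and, by [m0], the constant coefficient of [G] are divisible by t, so the
   first unit coefficient sits strictly between them. *)
have sr : (r < (size mu).-1)%N.
  have smu : (0 < size mu)%N by rewrite size_poly_gt0 monic_neq0.
  rewrite ltn_neqAle; apply/andP; split; apply: contraNT hr.
    move=> /negPn/eqP er; apply/eqP; apply: (cG _ 1).
    by rewrite eGi er -/(lead_coef mu) (monicP mm) tofrac1.
  rewrite -ltnNge => lt; have : tofrac G`_r == 0 :> F.
    by rewrite eGi nth_default ?mulr0 ?eqxx // -(prednK smu).
  by rewrite tofrac_eq0 => /eqP ->; rewrite /cf mfps_coef0.
have r_gt0 : (0 < r)%N.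
  rewrite lt0n; apply: contraNneq hr => r0; case: m0 => x ex.
  by apply/eqP; apply: (cG _ x); rewrite eGi r0 ex.
pose j : 'I_2 := ord0; pose T := mfpsX k j.
pose ho := @pemb k 1 j; pose chi := ho G.
have cchi i : cf (rho j chi) i = cf G`_i 0 by rewrite rho_pemb /cf /mpow mulm0n.
have chi_lt i : (i < r)%N -> cf (rho j chi) i = 0.
  by move=> lt; apply/eqP; rewrite cchi; apply: contraTT lt => /minr; rewrite -leqNgt.
have chi_r : cf (rho j chi) r != 0 by rewrite cchi.
have [a [q eT]] := weierstrass_div chi_lt chi_r (T ^+ r).
(* A monic polynomial of degree r that is a multiple of [chi] as a series. Its degree is below that
   of [mu], so the two are coprime and some power of t is a combination of [G] and [W], hence a
   multiple of [chi]; but that power is its own remainder modulo [chi]. *)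
pose W : {poly O} := 'X^r - \poly_(i < r) (if insub i is Some i' then a i' else 0).
have sP : (size (\poly_(i < r) (if insub i is Some l then a l else 0))%R < r.+1)%N.
  by rewrite ltnS size_poly.
have hW : ho W = chi * q.
  rewrite /W rmorphB [X in _ - X](@pemb_wide _ _ _ _ r) ?size_poly //.
  rewrite /ho pemb_horner map_polyXn hornerXn eT addrAC -[RHS]add0r; congr (_ + _); apply/eqP.
  rewrite subr_eq0; apply/eqP; apply: eq_bigr => i _.
  by rewrite coef_poly ltn_ord valK.
have sW : size W = r.+1 by rewrite /W size_polyDl size_polyXn // size_polyN.
have : coprimep mu (toF W).
  apply: irredp_coprime => //; apply/negP => /dvdp_leq.
  rewrite size_map_poly_id0 ?sW; last by rewrite tofrac_eq0 lead_coef_eq0 -size_poly_gt0 sW.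
  rewrite -size_poly_gt0 size_map_poly_id0 ?sW; last by rewrite tofrac_eq0 lead_coef_eq0 -size_poly_gt0 sW.
  by move=> /(_ isT); rewrite leqNgt -ltn_predRL sr.
move=> /Bezout_eq1_coprimepP[[u v] /= e1].
have [J1 [U eU]] := clear_t u; have [J2 [V eV]] := clear_t v.
have eW : (tO ^+ J2 *: U) * G + (tO ^+ (J1 + J.+1) *: V) * W = (tO ^+ (J1 + J2 + J.+1))%:P.
  have inj : injective toF by apply: map_inj_poly (@tofrac0 O) => x y /eqP; rewrite tofrac_eq => /eqP.
  apply: inj; rewrite rmorphD !rmorphM /= !map_polyZ /= map_polyC /= eU eV eG !tofracXn.
  rewrite -!scalerAl -!scalerAr !scalerA -!exprD -addnA [(J2 + _)%N]addnC [(J1 + _ + _)%N]addnAC addnAC.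
  by rewrite -scalerDr e1 alg_polyC.
have := congr1 ho eW; rewrite rmorphD !rmorphM -/chi hW => e2.
have := @weierstrass_uniq k 1 j chi r chi_lt chi_r (ho (tO ^+ J2 *: U) + ho (tO ^+ (J1 + J.+1) *: V) * q)
  (fun i => if i == Ordinal r_gt0 then tO ^+ (J1 + J2 + J.+1) else 0).
case.
  have eq4 (x y z w : mfps k 2) : x * (y + z * w) = y * x + z * (x * w) by ring.
  rewrite eq4 e2 /ho pembC (bigD1 (Ordinal r_gt0)) // eqxx.
  rewrite [X in _ = _ + X]big1; last by move=> i /negbTE ->; rewrite rmorph0 mul0r.
  have -> : T ^+ Ordinal r_gt0 = 1 by apply: expr0.
  by rewrite addr0 mulr1.
move=> _ /(_ (Ordinal r_gt0)); rewrite eqxx => /eqP.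
by rewrite expf_eq0 (negbTE (tO_neq0 k)) andbF.
Qed.

End OneDimensional.

Section NormField.
Variables (F : fieldType) (n : nat) (g : {poly F}).
Hypotheses (mg : g \is monic) (sg : size g = n.+2) (ig : irreducible_poly g).
Notation N := (nm n g).
Implicit Types h : {poly F}.

Lemma nm_dvd h : g %| h -> N h = 0.
Proof.
move=> /dvdpP[q ->]; rewrite -[q * g]add0r mulrC nm_mod //.
by rewrite -polyC0 nmC expr0n.
Qed.

Lemma nm_inv h : N h != 0 -> exists h', N h * N h' = 1 /\ exists q, h * h' = 1 + g * q.
Proof.
move=> nz; apply: nm_inverse => //; apply: irredp_coprime => //.
by apply: contra nz => /nm_dvd ->.
Qed.

Lemma nm_eq0_dvd h : N h = 0 -> g %| h.
Proof.
move=> N0; apply/negPn/negP => /(irredp_coprime ig)/(nm_inverse mg sg)[h' []].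
by rewrite N0 mul0r => /esym/eqP; rewrite oner_eq0.
Qed.

Lemma horner_cmpx_eq0 h : (horner_mx (cmpx n g) h == 0) = (g %| h).
Proof.
apply/eqP/idP => [e|/dvdpP[q ->]]; last by rewrite rmorphM /= horner_cmpx0 // mulr0.
by apply: nm_eq0_dvd; rewrite /nm e det0.
Qed.

(** Since F[X]/(g) is a field, a proper factorisation of the minimal polynomial of [h] would give
    zero divisors. *)
Lemma irreducible_mxminpoly h : irreducible_poly (mxminpoly (horner_mx (cmpx n g) h)).
Proof.
set H := horner_mx _ h; have mm := mxminpoly_monic H.
split=> [|q sq qm]; first by rewrite size_mxminpoly ltnS mxminpoly_nonconstant.
have dv a : (mxminpoly H %| a) = (g %| a \Po h).
  by rewrite dvd_mxminpoly horner_mx_comp_poly horner_cmpx_eq0.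
have [q' e] := dvdpP _ _ qm.
have nzq' : q' != 0 by apply: contraTneq (monic_neq0 mm) => q0; rewrite e q0 mul0r eqxx.
have : g %| (q' \Po h) * (q \Po h) by rewrite -comp_polyM -e -dv dvdpp.
move=> /(irredp_prime ig)/orP[]; rewrite -dv => d; last by rewrite /eqp qm d.
have nzq : q != 0 by apply: contraTneq (monic_neq0 mm) => q0; rewrite e q0 mulr0 eqxx.
case/negP: sq; have := dvdp_leq nzq' d; rewrite e size_mul //.
have : (0 < size q)%N by rewrite size_poly_gt0.
have : (0 < size q')%N by rewrite size_poly_gt0.
by move: (size q) (size q') => x y; lia.
Qed.

Lemma char_poly_exp h : exists s, char_poly (horner_mx (cmpx n g) h) =
  mxminpoly (horner_mx (cmpx n g) h) ^+ s.+1.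
Proof.
set H := horner_mx _ h.
have [||||[|s] e] := @monic_dvd_exp _ (mxminpoly H) (char_poly H) n.+1.
- exact: mxminpoly_monic.
- exact: irreducible_mxminpoly.
- exact: char_poly_monic.
- by apply: char_poly_dvd_exp; apply: mx_root_minpoly.
- by have := size_char_poly H; rewrite e expr0 size_poly1.
by exists s.
Qed.

End NormField.

Section OneDimNorm.
Variables (k : closedFieldType).
Notation O := (mfps k 1).
Notation F := {fraction O}.
Notation tF := (tofrac (tO : O) : F).
Notation toF := (map_poly (@tofrac O)).
Variables (n : nat) (g : {poly F}).
Hypotheses (mg : g \is monic) (sg : size g = n.+2) (ig : irreducible_poly g).
Notation N := (nm n g).
Implicit Types h y : {poly F}.

(** The characteristic polynomial is a power of an irreducible polynomial. Its constant term is the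
    norm up to sign, so the irreducible one has an integral constant term, as k[[t]] is closed under
    roots, and [irreducible_integral] makes all its coefficients integral. *)
Lemma char_integral h : inO (N h) -> exists2 P : {poly O},
  P \is monic /\ size P = n.+2 & forall c, N (c%:P - h) = (toF P).[c].
Proof.
move=> hN; set H := horner_mx (cmpx n g) h.
have [s e] := char_poly_exp mg sg ig h.
have [|||G eG] := @irreducible_integral k (mxminpoly H).
- exact: mxminpoly_monic.
- exact: irreducible_mxminpoly.
- have := char_poly_det H; rewrite e -horner_coef0 horner_exp horner_coef0 => e0.
  apply: (@inO_closed k _ s); rewrite e0; apply: inOM => //.
  by exists ((-1) ^+ n.+1); rewrite tofracXn tofracN tofrac1.
have inj : injective (@tofrac O) by move=> x y /eqP; rewrite tofrac_eq => /eqP.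
have lead1 P : (toF P) \is monic -> P \is monic.
  by rewrite !monicE lead_coef_map_inj ?tofrac0 // -tofrac1 tofrac_eq.
exists (G ^+ s.+1).
  split; first by apply: lead1; rewrite rmorphXn /= -eG -e char_poly_monic.
  by rewrite -(size_map_inj_poly inj (@tofrac0 O)) rmorphXn /= -eG -e size_char_poly.
by move=> c; rewrite rmorphXn /= -eG -e char_poly_horner /nm rmorphB /= horner_mx_C.
Qed.

Lemma nm_subC h f : inO (N h) -> inO (N ((tofrac f)%:P - h)).
Proof.
move=> /char_integral[P _ ->]; exists P.[f]; by rewrite horner_map.
Qed.

Lemma nm_opp h : inO (N h) -> inO (N (- h)).
Proof. by move=> /(nm_subC 0); rewrite tofrac0 polyC0 sub0r. Qed.

(** Writing y + h = y (1 + h/y) with the norm of h/y integral, which is possible up to exchanging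
    the two, reduces the claim to adding 1; the norm is then, up to sign, a value of the integral
    characteristic polynomial. *)
Lemma nm_add y h : inO (N y) -> inO (N h) -> inO (N (y + h)).
Proof.
wlog H : y h / N y != 0 /\ inO (N h / N y) => [W hy hh|].
  have [y0|ny] := eqVneq (N y) 0.
    by have /dvdpP[q ->] := nm_eq0_dvd mg sg ig y0; rewrite addrC mulrC nm_mod.
  have [h0|nh] := eqVneq (N h) 0.
    by have /dvdpP[q ->] := nm_eq0_dvd mg sg ig h0; rewrite mulrC nm_mod.
  have [[j /hval_inO hj]|[j _ /hval_inO hj]] := val_cases (mulf_neq0 nh (invr_neq0 ny)).
    exact: W.
  by rewrite addrC; apply: (W) => //; split=> //; rewrite -invf_div.
move: H => [ny hq] hy hh; have [y' [e1 [q e2]]] := nm_inv mg sg ig ny.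
have := nm_subC (-1) (h := h * y').
rewrite nmM (_ : N y' = (N y)^-1) => [/(_ hq)/nm_opp|]; last first.
  by apply: (mulfI ny); rewrite divff.
rewrite tofracN tofrac1 polyCN opprB opprK => hO.
have -> : N (y + h) = N y * N (h * y' + 1); last exact: inOM.
rewrite -nmM -(nm_mod (y + h) (h * q) mg sg); congr (nm _ _ _).
by rewrite mulrDr mulr1 [y * _]mulrCA e2; ring.
Qed.

(** The characteristic polynomial has integral coefficients, and its reduction modulo t has a root
    in the algebraically closed field [k]: the residue field does not grow. *)
Lemma nm_residue h : inO (N h) -> exists c f, cf f 0 = 0 /\
  N ((tofrac (mfpsC 1 c))%:P - h) = tofrac f.
Proof.
move=> /char_integral[P [mP sP] eP].
have [c hc] : exists c, cf P.[mfpsC 1 c] 0 = 0.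
  have [c] := @solve_monicpoly k n.+1 (fun i => - cf P`_i 0) isT.
  move=> hc; exists c; rewrite (@horner_coef_wide _ n.+2) ?sP //.
  have e i : cf (P`_i * mfpsC 1 c ^+ i) 0 = cf P`_i 0 * c ^+ i.
    by rewrite -rmorphXn cf0M cfC.
  rewrite big_ord_recr /= /cf mfps_coefD mfps_coef_sum -![mfps_coef _ _]/(cf _ 0) e hc.
  have := monicP mP; rewrite /lead_coef sP /= => ->.
  rewrite -(rmorph1 (@mfpsC k 1)) cfC eqxx mul1r -big_split big1 // => i _.
  by rewrite -[mfps_coef _ _]/(cf _ 0) e mulNr /= subrr.
by exists c, P.[mfpsC 1 c]; rewrite eP horner_map.
Qed.

End OneDimNorm.

Lemma field_inv (F : fieldType) (x y : F) : x * y = 1 -> y = x^-1.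
Proof.
move=> e; have nz : x != 0 by apply: contra_eq_neq e => ->; rewrite mul0r eq_sym oner_neq0.
by apply: (mulfI nz); rewrite e divff.
Qed.

Lemma polyC_mulK (F : fieldType) (t : F) (p : {poly F}) :
  t != 0 -> t%:P * (p * (t^-1)%:P) = p.
Proof. by move=> nz; rewrite mulrCA -polyCM divff // mulr1. Qed.

Lemma poly_unscale (F : fieldType) e (c : F) (y w r : {poly F}) (a : 'I_e -> F) :
  c != 0 -> c%:P * y - \sum_(l < e) (a l)%:P * w ^+ l = r ->
  y - \sum_(l < e) (c^-1 * a l)%:P * w ^+ l = (c^-1)%:P * r.
Proof.
move=> nz <-; rewrite mulrBr mulrA -polyCM mulVf // mul1r mulr_sumr.
by congr (_ - _); apply: eq_bigr => l _; rewrite mulrA polyCM.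
Qed.

(** * Total ramification over k((t)) *)

Section Uniformizer.
Variables (k : closedFieldType).
Notation O := (mfps k 1).
Notation F := {fraction O}.
Notation tF := (tofrac (tO : O) : F).
Variables (n : nat) (g : {poly F}).
Hypotheses (mg : g \is monic) (sg : size g = n.+2) (ig : irreducible_poly g).
Notation N := (nm n g).
Notation W h := (inO (N h)).
Implicit Types h y : {poly F}.

Lemma nm_const f : W (tofrac f)%:P.
Proof. by rewrite nmC; exists (f ^+ n.+1); rewrite tofracXn. Qed.

Lemma nm_sum (I : Type) (r : seq I) (f : I -> {poly F}) : (forall i, W (f i)) -> W (\sum_(i <- r) f i).
Proof.
move=> H; apply: (big_ind (fun h => W h)) => [|x y hx hy|i _].
- rewrite -polyC0 -(@tofrac0 O); exact: nm_const.
- exact: (nm_add mg sg ig hx hy).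
- exact: H.
Qed.

Variables (g0 : nat) (w : {poly F}).
Hypotheses (g0_gt0 : (0 < g0)%N) (hw : hval (N w) g0).
Hypothesis g0_min : forall j h, (0 < j)%N -> hval (N h) j -> (g0 <= j)%N.

(** Dividing by a power of [w] leaves the remainder of [j] modulo [g0] as a value, and [g0] is the
    least positive one. *)
Lemma value_dvd j h : hval (N h) j -> (g0 %| j)%N.
Proof.
move=> hj; have [w' [ew _]] := nm_inv mg sg ig (hval_neq0 hw).
have w'E : N w' = (N w)^-1 by apply: field_inv.
have hr : hval (N (h * w' ^+ (j %/ g0))) (j %% g0).
  have -> : (j %% g0 = j - g0 * (j %/ g0))%N by rewrite {2}(divn_eq j g0) mulnC addKn.
  rewrite nmM nmX w'E exprVn; apply: hval_div => //; first exact: hvalX.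
  by rewrite mulnC leq_divM.
rewrite /dvdn -leqn0 leqNgt; apply/negP => r0.
by have := g0_min r0 hr; rewrite leqNgt ltn_mod g0_gt0.
Qed.

(** After subtraction of the residue [c] the norm is 0 or has positive valuation, thus at least
    [g0], so the difference can be divided by [w]. *)
Lemma expand_step y : W y -> exists (c : k) y', W y' /\ g %| y - ((tofrac (mfpsC 1 c))%:P + w * y').
Proof.
move=> /(nm_residue mg sg ig)[c [f [f0 ef]]].
set C := (tofrac _)%:P in ef *; have fE : N (y - C) = (-1) ^+ n.+1 * tofrac f by rewrite -opprB nmN1 ef.
have [y0|ny] := eqVneq (N (y - C)) 0.
  exists c, 0; split; first by rewrite -polyC0 -(@tofrac0 O); apply: nm_const.
  by rewrite mulr0 addr0; apply: nm_eq0_dvd y0.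
have [w' [ew [q eq]]] := nm_inv mg sg ig (hval_neq0 hw).
have w'E : N w' = (N w)^-1 by apply: field_inv.
have Ny : N (y - C) = tofrac ((-1) ^+ n.+1 * f) by rewrite fE tofracM tofracXn tofracN tofrac1.
have [j hj] := inO_hval (ex_intro _ _ Ny) ny.
have j0 : (0 < j)%N.
  rewrite lt0n; apply/negP => /eqP j0; move: hj; rewrite j0 Ny => -[u hu].
  rewrite expr0 mul1r => /eqP; rewrite tofrac_eq => /eqP e; case/negP: hu.
  by rewrite -e cf0M f0 mulr0.
exists c, ((y - C) * w'); split.
  by rewrite nmM w'E; apply: hval_inO (hval_div hj hw (g0_min j0 hj)).
have -> : y - (C + w * ((y - C) * w')) = g * (- (q * (y - C))); last by rewrite dvdp_mulr.
have -> : w * ((y - C) * w') = (1 + g * q) * (y - C) by rewrite -eq; ring.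
by ring.
Qed.

Lemma expand_steps e y : W y -> exists (c : 'I_e -> k) y', W y' /\
  g %| y - (\sum_(i < e) (tofrac (mfpsC 1 (c i)))%:P * w ^+ i + w ^+ e * y').
Proof.
elim: e y => [|e IH] y hy.
  by exists (fun=> 0), y; split=> //; rewrite big_ord0 expr0 mul1r add0r subrr dvdp0.
have [a [y1 [h1 d1]]] := expand_step hy; have [c [y2 [h2 d2]]] := IH y1 h1.
exists (fun i => if unlift ord0 i is Some i' then c i' else a), y2; split=> //.
rewrite big_ord_recl unlift_none expr0 mulr1.
under eq_bigr => i _ do rewrite liftK lift0 exprS mulrCA.
rewrite -mulr_sumr; set S := \sum_(i < e) _ in d2 *.
have -> : y - ((tofrac (mfpsC 1 a))%:P + w * S + w ^+ e.+1 * y2) =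
  (y - ((tofrac (mfpsC 1 a))%:P + w * y1)) + w * (y1 - (S + w ^+ e * y2)).
  by rewrite exprS; ring.
by rewrite dvdp_add // dvdp_mull.
Qed.

Variable e : nat.
Hypothesis ne : n.+1 = (e * g0)%N.

(** The norms of [w ^+ e] and of t have the same valuation e g0 = n + 1, so the remainder of the
    expansion in powers of [w] can be rewritten with t in place of [w ^+ e]. *)
Lemma expand_t y : W y -> exists (c : 'I_e -> k) y', W y' /\
  g %| y - (\sum_(i < e) (tofrac (mfpsC 1 (c i)))%:P * w ^+ i + tF%:P * y').
Proof.
move=> /(expand_steps e)[c [y' [h d]]]; exists c, (w ^+ e * y' * (tF^-1)%:P); split.
  rewrite mulrAC nmM; apply: inOM _ h; apply: (@hval_inO _ _ 0).
  rewrite nmM nmX nmC exprVn -[X in hval _ X](subnn n.+1); apply: hval_div (leqnn _).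
    rewrite ne mulnC; exact: hvalX.
  rewrite -[X in hval _ X]mul1n; apply: hvalX; exact: hval_t.
rewrite polyC_mulK ?tF_neq0 //; exact: d.
Qed.

(** Iterating [expand_t] produces the coefficients of the series [a i] in t. The error is divisible
    by every power of t, so its norm is 0 and [g] divides it. *)
Lemma integral_span y : W y -> exists a : 'I_e -> O,
  g %| y - \sum_(i < e) (tofrac (a i))%:P * w ^+ i.
Proof.
move=> hy.
pose T y (cy : ('I_e -> k) * {poly F}) := W y -> W cy.2 /\
  g %| y - (\sum_(i < e) (tofrac (mfpsC 1 (cy.1 i)))%:P * w ^+ i + tF%:P * cy.2).
have Tex y1 : exists cy, T y1 cy.
  have [h|h] := pselect (W y1); last by exists (fun=> 0, 0).
  by have [c [y' H]] := expand_t h; exists (c, y').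
have [f hf] := choice Tex; pose z m := iter m (fun y => (f y).2) y.
have hz m : W (z m) by elim: m => [|m IH]; [exact: hy | case: (hf _ IH)].
pose a (i : 'I_e) : O := Mfps (fun m => (f (z (m ord0))).1 i); exists a.
have ca i j : cf (a i) j = (f (z j)).1 i by rewrite /cf /a mfps_coefE mpow0.
pose s M := \sum_(i < e) (tofrac (\sum_(l < M) mfpsC 1 (cf (a i) l) * tO ^+ l))%:P * w ^+ i.
have ds M : g %| y - (s M + (tF ^+ M)%:P * z M).
  elim: M => [|M IH].
    rewrite /s big1 => [|i _]; last by rewrite big_ord0 tofrac0 polyC0 mul0r.
    by rewrite expr0 polyC1 mul1r add0r /z /= subrr dvdp0.
  have [_ d] := hf _ (hz M).
  pose S := \sum_(i < e) (tofrac (mfpsC 1 ((f (z M)).1 i)))%:P * w ^+ i.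
  have -> : s M.+1 = s M + (tF ^+ M)%:P * S.
    rewrite mulr_sumr -big_split; apply: eq_bigr => i _ /=; rewrite mulrA -mulrDl -polyCM -polyCD.
    by rewrite -tofracXn -tofracM -tofracD big_ord_recr /= ca [tO ^+ M * _]mulrC.
  have -> : y - (s M + (tF ^+ M)%:P * S + (tF ^+ M.+1)%:P * z M.+1) =
    (y - (s M + (tF ^+ M)%:P * z M)) + (tF ^+ M)%:P * (z M - (S + tF%:P * z M.+1)).
    by rewrite exprS polyCM; ring.
  by rewrite dvdp_add // dvdp_mull.
have hs M : exists2 r, W r & s M - \sum_(i < e) (tofrac (a i))%:P * w ^+ i = - ((tF ^+ M)%:P * r).
  have [b hb] := choice (fun i => cf_shift M (a i)).
  exists (\sum_(i < e) (tofrac (b i))%:P * w ^+ i).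
    apply: nm_sum => i; rewrite nmM; apply: inOM; first exact: nm_const.
    by rewrite nmX; case: (hval_inO hw) => x ->; exists (x ^+ i); rewrite tofracXn.
  rewrite mulr_sumr -sumrB -sumrN; apply: eq_bigr => i _.
  rewrite mulrA -mulrBl -mulNr -polyCM -polyCB -polyCN -tofracXn -tofracM -tofracB -tofracN.
  by rewrite {2}(proj2 (hb i)) opprD addrA subrr add0r.
apply: (nm_eq0_dvd mg sg ig); apply: inO_all => M; have [r hr er] := hs M.
have /dvdpP[q eq] := ds M.
set SA := \sum_(i < e) _ in er *.
have -> : y - SA = (tF ^+ M)%:P * (z M - r) + g * q.
  transitivity (y - (s M + (tF ^+ M)%:P * z M) + (s M - SA) + (tF ^+ M)%:P * z M); first by ring.
  by rewrite eq er; ring.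
rewrite nm_mod // nmM nmC -exprM mulnS exprD.
have [x ->] := nm_add mg sg ig (hz M) (nm_opp mg sg ig hr).
by exists (tO ^+ (M * n) * x); rewrite tofracM tofracXn mulrA.
Qed.

(** Every X^i gets an integral norm after multiplication by a power of t, so the [e] powers of [w]
    span a space of dimension n + 1 = e g0. *)
Lemma value_one : g0 = 1%N.
Proof.
have sp (i : 'I_n.+1) : exists a : 'I_e -> F, g %| 'X^i - \sum_(l < e) (a l)%:P * w ^+ l.
  have [y0|ny] := eqVneq (N 'X^i) 0.
    by exists (fun=> 0); rewrite big1 ?subr0 ?(nm_eq0_dvd mg sg ig) // => l _; rewrite polyC0 mul0r.
  have [x ex] : exists j, inO (N ((tF ^+ j)%:P * 'X^i)).
    have [[j /hval_inO h]|[j j0 h]] := val_cases ny.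
      by exists 0%N; rewrite expr0 mul1r.
    exists j; rewrite nmM nmC -exprM -[N _]invrK.
    apply: (@hval_inO _ _ (j * n.+1 - j)%N); apply: hval_div => //.
      by rewrite -{2}[(j * _)%N]mul1n; apply: hvalX; apply: hval_t.
    by rewrite leq_pmulr.
  have [a /dvdpP[q eq]] := integral_span ex; exists (fun l => tF ^- x * tofrac (a l)).
  apply/dvdpP; exists ((tF ^- x)%:P * q); rewrite -mulrA.
  exact: (poly_unscale (expf_neq0 x (tF_neq0 k)) eq).
have [a ha] := choice sp.
have le : (n.+1 <= e)%N.
  pose A := \matrix_(i < n.+1, l < e) a i l.
  pose B := \matrix_(l < e) (poly_rV ((w ^+ l) %% g) : 'rV[F]_n.+1).
  apply: (@mulmx1_min _ _ _ A B); apply/row_matrixP => i.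
  rewrite row1 row_mul mulmx_sum_row.
  apply: (can_inj (@rVpolyK _ _)); rewrite rVpoly_delta linear_sum.
  have small : 'X^i %% g = 'X^i by rewrite modp_small // size_polyXn sg ltnS ltn_ord.
  have /dvdpP[q eq] := ha i; rewrite -small.
  have -> : 'X^i = \sum_(l < e) (a i l)%:P * w ^+ l + q * g by rewrite -eq addrC subrK.
  rewrite modpD modp_mull addr0 (big_morph (fun p => p %% g) (modpD g) (mod0p g)); apply: eq_bigr => l _.
  rewrite linearZ /= !mxE rowK mul_polyC modpZl poly_rV_K // -ltnS -sg ltn_modp.
  exact: monic_neq0.
by move: le ne g0_gt0; clear; nia.
Qed.

End Uniformizer.

Section UniformizerExists.
Variables (k : closedFieldType).
Notation O := (mfps k 1).
Notation F := {fraction O}.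
Notation tF := (tofrac (tO : O) : F).

Lemma uniformizer_exists n (g : {poly F}) : g \is monic -> size g = n.+2 -> irreducible_poly g ->
  exists h, hval (nm n g h) 1.
Proof.
move=> mg sg ig.
have ex : exists j, (0 < j)%N && `[< exists h, hval (nm n g h) j >].
  exists n.+1; apply/asboolP; exists tF%:P; rewrite nmC -[X in hval _ X]mul1n.
  apply: hvalX; exact: hval_t.
case: (ex_minnP ex) => g0 /andP[g0_gt0 /asboolP[w hw]] mn.
have g0_min j h : (0 < j)%N -> hval (nm n g h) j -> (g0 <= j)%N.
  by move=> j0 hj; apply: mn; rewrite j0; apply/asboolP; exists h.
have : (g0 %| n.+1)%N.
  apply: (value_dvd mg sg ig g0_gt0 hw g0_min (h := tF%:P)); rewrite nmC -[X in hval _ X]mul1n.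
  apply: hvalX; exact: hval_t.
move=> /dvdnP[e ne]; exists w; move: (hw).
by rewrite (value_one mg sg ig g0_gt0 hw g0_min ne).
Qed.

End UniformizerExists.

Section CoprimeOrder.
Variables (k : closedFieldType).
Notation O := (mfps k 1).
Notation F := {fraction O}.
Notation tF := (tofrac (tO : O) : F).
Notation toF := (map_poly (@tofrac O)).

Lemma separable_factor_value (Fd : fieldType) (f g f2 : {poly Fd}) (u v : {poly Fd}) c :
  irreducible_poly g -> f = g * f2 -> u * f + v * f^`() = c%:P -> c != 0 -> coprimep g f2.
Proof.
move=> ig ef e nz; apply: irredp_coprime => //; apply/negP => d.
have : g %| c%:P.
  rewrite -e ef derivM; apply: dvdp_add; apply: dvdp_mull; first exact: dvdp_mulIl.
  by apply: dvdp_add; [apply: dvdp_mull | apply: dvdp_mulIl].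
by move/dvdp_leq; rewrite polyC_eq0 nz size_polyC nz => /(_ isT); rewrite leqNgt ig.
Qed.

Lemma monic_size1 (Fd : fieldType) (f : {poly Fd}) : f \is monic -> size f = 1%N -> f = 1.
Proof.
by move=> m /eqP/size_poly1P[c _ e]; move: m; rewrite e monicE lead_coefC => /eqP ->.
Qed.

(** [h] is taken congruent to [h1] modulo [g1] and to 1 modulo [g2]. *)
Lemma nm_crt (Fd : fieldType) n1 n2 (g1 g2 h1 : {poly Fd}) :
  g1 \is monic -> size g1 = n1.+2 -> g2 \is monic -> size g2 = n2.+2 -> coprimep g1 g2 ->
  exists h, nm (n1 + n2.+1) (g1 * g2) h = nm n1 g1 h1.
Proof.
move=> m1 s1 m2 s2 /Bezout_eq1_coprimepP[[a b] /= e].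
have eb : b * g2 = 1 - a * g1 by rewrite -e addrAC subrr add0r.
exists (h1 * (b * g2) + a * g1); rewrite nm_mul_poly //.
have -> : nm n1 g1 (h1 * (b * g2) + a * g1) = nm n1 g1 h1.
  rewrite (_ : _ + _ = h1 + g1 * (a * (1 - h1))); first by rewrite nm_mod.
  by rewrite eb; ring.
have -> : nm n2 g2 (h1 * (b * g2) + a * g1) = 1; last by rewrite mulr1.
rewrite (_ : _ + _ = 1 + g2 * (b * (h1 - 1))); first by rewrite nm_mod // nm1.
have -> : a * g1 = 1 - b * g2 by rewrite eb opprB addrC subrK.
by ring.
Qed.

Lemma value_one_exists N (f : {poly O}) u v delta :
  f \is monic -> size f = N.+2 -> delta != 0 -> u * f + v * f^`() = delta%:P ->
  exists h : {poly F}, hval (nm N (toF f) h) 1.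
Proof.
move=> mf sf nd e.
have inj : injective (@tofrac O) by move=> x y /eqP; rewrite tofrac_eq => /eqP.
have mF : toF f \is monic by apply: monic_map.
have sF : size (toF f) = N.+2 by rewrite size_map_inj_poly // tofrac0.
have eF : toF u * toF f + toF v * (toF f)^`() = (tofrac delta)%:P.
  by rewrite deriv_map -!rmorphM -rmorphD e /= map_polyC.
have [|g [mg ig dg]] := irredp_factor mF; first by rewrite sF.
have /dvdpP[f2] := dg; rewrite mulrC => ef.
have m2 : f2 \is monic by move: mF; rewrite ef (monicMl _ mg).
have cg : coprimep g f2.
  by apply: (separable_factor_value ig ef eF); rewrite tofrac_eq0.
have [n sg] : exists n, size g = n.+2.
  by have := ig.1; case: (size g) => [|[|n]] // _; exists n.
have [h1 h1E] := uniformizer_exists mg sg ig.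
have sizes := size_mul (monic_neq0 mg) (monic_neq0 m2); rewrite -ef sF sg in sizes.
case E2: (size f2) sizes => [|[|n2]] sizes.
- by move/eqP: E2; rewrite size_poly_eq0 (negbTE (monic_neq0 m2)).
- have f21 := monic_size1 m2 E2.
  have -> : N = n by lia.
  by exists h1; rewrite ef f21 mulr1.
have -> : N = (n + n2.+1)%N by lia.
have [h eh] := nm_crt h1 mg sg m2 E2 cg; exists h; rewrite ef eh; exact: h1E.
Qed.

Lemma coprime_order N (f : {poly O}) u v delta p :
  f \is monic -> size f = N.+2 -> delta != 0 -> u * f + v * f^`() = delta%:P -> prime p ->
  exists (h : {poly O}) D (w : O), [/\ forall i, cf h`_i 0 = 0, (0 < D)%N, coprime p D, cf w 0 != 0 &
    nm N f h = tO ^+ D * w].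
Proof.
move=> mf sf nd e pp; have [h hE] := value_one_exists mf sf nd e.
(* [M] is a multiple of [p], so that the valuation M (N + 1) + 1 of the new norm is prime to [p]; it
   is larger than [J], so that t^M [h] has all its coefficients divisible by t. *)
have [J [P eP]] := clear_t h; pose M := (p * J.+1)%N.
have lt : (J < M)%N by rewrite /M; have := prime_gt0 pp; move: J {eP} @M => J; nia.
have le := ltnW lt; pose h' := tO ^+ (M - J) *: P.
have eh' : toF h' = (tF ^+ M)%:P * h.
  by rewrite map_polyZ /= eP scalerA tofracXn -exprD subnK // mul_polyC.
have : hval (nm N (toF f) (toF h')) (M * N.+1 + 1).
  rewrite eh' nmM nmC -exprM; apply: hvalM => //.
  by rewrite -[X in hval _ X]mul1n; apply: hvalX; apply: hval_t.
rewrite -map_nm => -[w hw eN]; exists h', (M * N.+1 + 1)%N, w.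
split=> //; first 1 last.
- by rewrite addn1.
- by rewrite prime_coprime // /M -mulnA dvdn_addr ?dvdn_mulr // dvdn1; case: p pp {M lt le h' eh' eN} => [|[]].
- by move: eN; rewrite -tofracXn -tofracM => /eqP; rewrite tofrac_eq => /eqP.
by move=> i; rewrite coefZ cf_tM leqn0 subn_eq0 leqNgt lt.
Qed.

End CoprimeOrder.

(** * Exchange of parameters *)

Section Krylov.
Variables (R : comNzRingType) (n : nat).

Definition krylov (H : 'M[R]_n.+1) : 'M[R]_n.+1 := \matrix_(i, j) (H ^+ i) ord0 j.

Lemma krylov_cmpx p : krylov (cmpx n p) = 1%:M.
Proof.
suff H i (j : 'I_n.+1) : (i < n.+1)%N -> (cmpx n p ^+ i) ord0 j = (i == j :> nat)%:R.
  by apply/matrixP => i j; rewrite !mxE H.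
elim: i j => [|i IH] j lt; first by rewrite expr0 mxE.
have lt' := ltnW lt; rewrite exprSr mxE (bigD1 (Ordinal lt')) //= big1 ?addr0 => [|l ne].
  by rewrite IH // eqxx mul1r mxE /= ltn_eqF.
rewrite IH //; case: eqP => [e|]; last by rewrite mul0r.
by case/eqP: ne; apply: val_inj.
Qed.

Lemma det_krylovZ a H : \det (krylov (a *: H)) = (\prod_(i < n.+1) a ^+ i) * \det (krylov H).
Proof.
have -> : krylov (a *: H) = diag_mx (\row_i a ^+ i) *m krylov H.
  by apply/matrixP => i j; rewrite mul_diag_mx !mxE exprZn mxE.
by rewrite det_mulmx det_diag; congr (_ * _); apply: eq_bigr => i _; rewrite mxE.
Qed.

End Krylov.

Lemma map_krylov (R S : comNzRingType) (f : {rmorphism R -> S}) n (H : 'M[R]_n.+1) :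
  map_mx f (krylov H) = krylov (map_mx f H).
Proof. by apply/matrixP => i j; rewrite !mxE -rmorphXn mxE. Qed.

(** The Krylov determinant of [cmpx n p + x *: H] is a polynomial in [x] with value 1 at 0, so it
    vanishes for finitely many [x] only; take for [x] the inverse of [e M] and scale by [e M]. *)
Lemma krylov_perturb (F : fieldType) n p (H : 'M[F]_n.+1) (e : nat -> F) M0 :
  injective e -> (forall i, e i != 0) ->
  exists2 M, (M0 <= M)%N & \det (krylov (H + e M *: cmpx n p)) != 0.
Proof.
move=> e_inj e_nz; pose D := \det (krylov (map_mx polyC (cmpx n p) + 'X *: map_mx polyC H)).
have Dx x : D.[x] = \det (krylov (cmpx n p + x *: H)).
  rewrite -[D.[x]]/(horner_eval x D) -det_map_mx map_krylov; congr (\det (krylov _)).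
  by apply/matrixP => i j; rewrite !mxE /= /horner_eval hornerD hornerM !hornerE.
have nzD : D != 0.
  apply/eqP => D0; have := Dx 0; rewrite D0 horner0 scale0r addr0 krylov_cmpx det1.
  by move/esym/eqP; rewrite oner_eq0.
have ei : injective (fun i => (e i)^-1) by move=> i j /invr_inj/e_inj.
have [M le nr] := poly_nonroot M0 ei nzD; exists M => //.
have -> : H + e M *: cmpx n p = e M *: (cmpx n p + (e M)^-1 *: H).
  by rewrite scalerDr scalerA divff ?scale1r 1?addrC.
rewrite det_krylovZ mulf_neq0 -?Dx //; apply/prodf_neq0 => i _.
by rewrite expf_neq0.
Qed.

Lemma krylov_perturb_domain (R : idomainType) n p (H : 'M[R]_n.+1) t M0 :
  t != 0 -> (forall i j, t ^+ i = t ^+ j -> i = j) ->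
  exists2 M, (M0 <= M)%N & \det (krylov (H + t ^+ M *: cmpx n p)) != 0.
Proof.
move=> nz ti; have [||M le nd] := @krylov_perturb _ n (map_poly (@tofrac R) p)
  (map_mx (@tofrac R) H) (fun i => tofrac (t ^+ i)) M0.
- by move=> i j /eqP; rewrite tofrac_eq => /eqP/ti.
- by move=> i; rewrite tofrac_eq0 expf_neq0.
exists M => //; move: nd; apply: contraNneq => D0.
have -> : cmpx n (map_poly (@tofrac R) p) = map_mx (@tofrac R) (cmpx n p) by rewrite map_cmpx.
by rewrite -map_mxZ -map_mxD -map_krylov det_map_mx D0 rmorph0.
Qed.

(* The rows of the Krylov matrix are the powers of [h] in the basis of powers of [z]. *)
Section Generator.
Variables (R A : idomainType) (phi : {rmorphism R -> A}) (N : nat) (f : {poly R}) (z : A).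
Hypotheses (mf : f \is monic) (sf : size f = N.+2) (fz : (map_poly phi f).[z] = 0).
Hypothesis fmin : forall p : {poly R}, (size p < size f)%N -> (map_poly phi p).[z] = 0 -> p = 0.
Variable hp : {poly R}.
Let H := horner_mx (cmpx N f) hp.
Let h := (map_poly phi hp).[z].

Lemma generator_root : (map_poly phi (char_poly H)).[h] = 0.
Proof.
have := Cayley_Hamilton H; rewrite /H horner_mx_comp_poly -/H => e.
have := horner_cmpx_col (char_poly H \Po hp) mf sf fz.
rewrite e map_mx0 mul0mx => /matrixP/(_ ord0 ord0); rewrite !mxE expr0 mulr1 => ->.
by rewrite map_comp_poly horner_comp.
Qed.

Lemma generator_power i : h ^+ i = \sum_(j < N.+1) phi ((H ^+ i) ord0 j) * z ^+ j.
Proof.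
have := horner_cmpx_col (hp ^+ i) mf sf fz => /matrixP/(_ ord0 ord0).
rewrite !mxE expr0 mulr1 [map_poly _ (_ ^+ _)]rmorphXn /= horner_exp -/h => <-.
by apply: eq_bigr => j _; rewrite !mxE [horner_mx _ (_ ^+ _)]rmorphXn.
Qed.

Hypothesis nzK : \det (krylov H) != 0.

Lemma generator_free (c : 'I_N.+1 -> R) : \sum_i phi (c i) * h ^+ i = 0 -> forall i, c i = 0.
Proof.
move=> e; pose c' : 'rV_N.+1 := \row_i c i.
have cK : c' *m krylov H = 0.
  pose p := \poly_(j < N.+1) (c' *m krylov H) ord0 (inord j).
  have p0 : p = 0.
    apply: fmin; first by rewrite sf ltnS size_poly.
    rewrite (@horner_coef_wide _ N.+1); last first.
      by apply: leq_trans (size_poly _ _); apply: size_poly.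
    rewrite -[RHS]e; under [RHS]eq_bigr => i _ do rewrite generator_power mulr_sumr.
    rewrite exchange_big; apply: eq_bigr => j _.
    rewrite coef_map /= coef_poly ltn_ord inord_val mxE rmorph_sum mulr_suml.
    by apply: eq_bigr => i _; rewrite !mxE rmorphM mulrA.
  apply/rowP => j; have := congr1 (fun q : {poly R} => q`_j) p0.
  by rewrite coef_poly ltn_ord inord_val coef0 => ->; rewrite mxE.
have : c' *m krylov H *m \adj (krylov H) = 0 by rewrite cK mul0mx.
rewrite -mulmxA mul_mx_adj mul_mx_scalar => e0 i.
have := congr1 (fun v : 'rV_N.+1 => v ord0 i) e0; rewrite !mxE => /eqP.
by rewrite mulf_eq0 (negbTE nzK) => /eqP.
Qed.

Lemma generator_span (p : {poly R}) : exists g : 'I_N.+1 -> R,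
  phi (\det (krylov H)) * (map_poly phi p).[z] = \sum_i phi (g i) * h ^+ i.
Proof.
have := horner_cmpx_col p mf sf fz => /matrixP/(_ ord0 ord0).
rewrite !mxE expr0 mulr1 => <-; set P := horner_mx _ p.
pose g : 'rV_N.+1 := (\row_j P ord0 j) *m \adj (krylov H).
exists (fun i => g ord0 i).
have gK : g *m krylov H = \det (krylov H) *: \row_j P ord0 j.
  by rewrite -mulmxA mul_adj_mx mul_mx_scalar.
under [RHS]eq_bigr => i _ do rewrite generator_power mulr_sumr.
rewrite exchange_big mulr_sumr; apply: eq_bigr => j _.
have := congr1 (fun v : 'rV_N.+1 => v ord0 j) gK; rewrite !mxE => e.
rewrite mulrA -rmorphM -e rmorph_sum mulr_suml; apply: eq_bigr => i _.
by rewrite !mxE rmorphM mulrA.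
Qed.

End Generator.

Lemma rho_emb_lift (k : comNzRingType) n (j : 'I_n.+1) (i : 'I_n) (f : mfps k n) :
  rho (lift j i) (emb j f) = rho i f.
Proof.
apply: cfP => l; rewrite !rho_coef emb_coef mulmnE mnm1E [lift _ _ == _]eq_sym (negbTE (neq_lift _ _)) mul0n eqxx.
congr (mfps_coef _ _); apply/mnmP => a.
by rewrite mnmE !mulmnE !mnm1E (inj_eq lift_inj).
Qed.

(* As a power series in the parameters [y] and [h], the relation [chi] is regular of order [n]
   in [h] and of order [D] in the last parameter [t]; dividing by it in the direction of [t]
   makes [1, t, ..., t^(D-1)] a basis over the power series in [h] and the other parameters. *)
Section ParameterExchange.
Variables (k : fieldType) (d : nat) (A : comNzRingType) (F : cfilt A).
Variables (io : {rmorphism k -> A}) (y : 'I_d.+1 -> A) (hy : forall i, F 1 (y i)).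
Notation R := (mfps k d.+1).
Notation phi := (ev io hy).
Notation t := (y ord_max).
Variables (chi : {poly R}) (n D : nat) (h : A).
Hypotheses (chi_monic : chi \is monic) (chi_size : size chi = n.+1).
Hypothesis chi_fil : forall i, (i < n)%N -> mfps_coef chi`_i 0%MM = 0.
Hypothesis chi0_lt : forall i, (i < D)%N -> cf (rho ord_max chi`_0) i = 0.
Hypothesis chi0_D : cf (rho ord_max chi`_0) D != 0.
Hypotheses (h_fil : F 1 h) (h_root : (map_poly phi chi).[h] = 0).
Hypothesis h_free : forall c : 'I_n -> R, \sum_i phi (c i) * h ^+ i = 0 -> forall i, c i = 0.

Definition exchange_pt (i : 'I_d.+2) : A := if unlift ord_max i is Some i' then y i' else h.

Lemma exchange_pt_fil i : F 1 (exchange_pt i).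
Proof. by rewrite /exchange_pt; case: unlift. Qed.

Notation Psi := (ev io exchange_pt_fil).
Notation jt := (lift ord_max (ord_max : 'I_d.+1)).

Lemma Psi_emb f : Psi (emb ord_max f) = phi f.
Proof.
apply: ev_comp => [M x|c|i]; [exact: ev_fil | exact: ev_C |].
by rewrite /= ev_X /exchange_pt liftK.
Qed.

Lemma Psi_h : Psi (mfpsX k ord_max) = h.
Proof. by rewrite ev_X /exchange_pt unlift_none. Qed.

Lemma Psi_t : Psi (mfpsX k jt) = t.
Proof. by rewrite ev_X /exchange_pt liftK. Qed.

Lemma Psi_pemb P : Psi (pemb k ord_max P) = (map_poly phi P).[h].
Proof.
rewrite pemb_horner -horner_map /= Psi_h -map_poly_comp; congr (_.[_]).
exact/eq_map_poly/Psi_emb.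
Qed.

Notation chiE := (pemb k ord_max chi).

Lemma chiE_lt i : (i < n)%N -> cf (rho ord_max chiE) i = 0.
Proof. by move=> lt; rewrite rho_pemb chi_fil. Qed.

Lemma chiE_n : cf (rho ord_max chiE) n != 0.
Proof.
have := monicP chi_monic; rewrite rho_pemb /lead_coef chi_size /= => ->.
by rewrite mfps_coef1 eqxx oner_eq0.
Qed.

(** Division by [chi] in the direction of [h] leaves a remainder whose value is a combination of the
    powers of [h] below [n], and these are free. *)
Lemma Psi_ker a : Psi a = 0 -> exists q, a = chiE * q.
Proof.
have [g [q ->]] := weierstrass_div chiE_lt chiE_n a.
rewrite rmorphD rmorphM /= Psi_pemb h_root mul0r addr0 rmorph_sum => /= e.
exists q; rewrite big1 ?add0r // => i _.
have -> : g i = 0; last by rewrite rmorph0 mul0r.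
apply: (@h_free g); rewrite -[RHS]e; apply: eq_bigr => l _.
by rewrite rmorphM rmorphXn /= Psi_emb Psi_h.
Qed.

(** On the t-axis the variable of [h] is 0, which leaves only the constant term of [chi]. *)
Lemma rho_t_chiE : rho jt chiE = rho ord_max chi`_0.
Proof.
rewrite (@pemb_wide k d.+1 ord_max chi n.+1); last by rewrite chi_size.
rewrite big_ord_recl rmorphD rmorphM /= rho_emb_lift rmorphXn [_ ^+ 0]expr0 mulr1.
rewrite rmorph_sum big1 ?addr0 // => i _.
rewrite rmorphM rmorphXn /= /rho [ev _ _ (mfpsX k ord_max)]ev_X /axis_pt (negbTE (neq_lift _ _)).
by rewrite expr0n mulr0.
Qed.

Lemma tE_lt i : (i < D)%N -> cf (rho jt chiE) i = 0.
Proof. by rewrite rho_t_chiE; apply: chi0_lt. Qed.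

Lemma tE_D : cf (rho jt chiE) D != 0.
Proof. by rewrite rho_t_chiE. Qed.

Definition psi : {rmorphism R -> A} := Psi \o emb jt.

Lemma psi_span a : exists g : 'I_D -> R, Psi a = \sum_i psi (g i) * t ^+ i.
Proof.
have [g [q ->]] := weierstrass_div tE_lt tE_D a; exists g.
rewrite rmorphD rmorphM /= Psi_pemb h_root mul0r addr0 rmorph_sum.
by apply: eq_bigr => i _; rewrite rmorphM rmorphXn /= Psi_t.
Qed.

(** A relation lies in the kernel of [Psi], so it is a multiple of [chi]; a Weierstrass remainder in
    t that is a multiple of [chi] vanishes. *)
Lemma psi_free (g : 'I_D -> R) : \sum_i psi (g i) * t ^+ i = 0 -> forall i, g i = 0.
Proof.
move=> e; have [|q eq] := @Psi_ker (\sum_i emb jt (g i) * mfpsX k jt ^+ i).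
  rewrite rmorph_sum -[RHS]e; apply: eq_bigr => i _.
  by rewrite rmorphM rmorphXn /= Psi_t.
by have [_] := weierstrass_uniq tE_lt tE_D (esym eq).
Qed.

Lemma parameter_exchange : exists (P : {rmorphism mfps k d.+2 -> A}) (s : {rmorphism R -> A}),
  [/\ forall f, exists e, phi f = P e, exists e, h = P e, forall f, exists e, s f = P e,
      forall e, exists g : 'I_D -> R, P e = \sum_i s (g i) * t ^+ i
    & forall g : 'I_D -> R, \sum_i s (g i) * t ^+ i = 0 -> forall i, g i = 0].
Proof.
exists Psi, psi; split.
- by move=> f; exists (emb ord_max f); apply/esym/Psi_emb.
- by exists (mfpsX k ord_max); apply/esym/Psi_h.
- by move=> f; exists (emb jt f).
- exact: psi_span.
- exact: psi_free.
Qed.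

End ParameterExchange.

(** * Finiteness and generic degree over the new parameters *)

Section Families.
Variables (V : comNzRingType) (S : {pred V}) (N : nat) (b : 'I_N -> V).

Let size_b : size (codom b) = N.
Proof. by rewrite size_codom card_ord. Qed.

Let nth_b (i : 'I_(size (codom b))) : (codom b)`_i = b (cast_ord size_b i).
Proof.
have lt : (i < N)%N by rewrite -[X in (_ < X)%N]size_b ltn_ord.
rewrite /codom /image_mem (nth_map (Ordinal lt)) ?size_enum_ord //; congr b.
by apply: val_inj; rewrite /= nth_enum_ord.
Qed.

Let sum_b (c : 'I_N -> V) : \sum_(i < size (codom b)) c (cast_ord size_b i) * (codom b)`_i =
  \sum_i c i * b i.
Proof.
rewrite [RHS](reindex_onto (cast_ord size_b) (cast_ord (esym size_b))) => [|i _]; last exact: cast_ordKV.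
by apply: eq_big => [i|i _]; rewrite ?cast_ordK ?eqxx // nth_b.
Qed.

Lemma spanned_by_codom (c : 'I_N -> V) : (forall i, c i \in S) ->
  spanned_by S (codom b) (\sum_i c i * b i).
Proof. by move=> cS; exists (fun i => c (cast_ord size_b i)); rewrite // sum_b. Qed.

Lemma lin_indep_codom :
  (forall c : 'I_N -> V, (forall i, c i \in S) -> \sum_i c i * b i = 0 -> forall i, c i = 0) ->
  lin_indep_over S (codom b).
Proof.
move=> H c cS e i; rewrite -(cast_ordK size_b i).
apply: (H (fun j => c (cast_ord (esym size_b) j))) => [j|]; first exact: cS.
by rewrite -sum_b -[RHS]e; apply: eq_bigr => j _; rewrite cast_ordK.
Qed.

End Families.

Section ExchangedDegree.
Variables (R A : idomainType) (E : comNzRingType) (phi s : {rmorphism R -> A}).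
Variables (P : {rmorphism E -> A}) (t : A) (D : nat).
Hypotheses (phi_inj : injective phi) (D_gt0 : (0 < D)%N).
Variables (N : nat) (b : 'I_N -> A).
Hypothesis phi_fin : forall a, exists g : 'I_N -> R, a = \sum_j phi (g j) * b j.
Hypothesis phi_P : forall f, exists e, phi f = P e.
Hypothesis s_P : forall f, exists e, s f = P e.
Hypothesis s_span : forall e, exists g : 'I_D -> R, P e = \sum_i s (g i) * t ^+ i.
Hypothesis s_free : forall g : 'I_D -> R, \sum_i s (g i) * t ^+ i = 0 -> forall i, g i = 0.
Hypothesis P_frac : forall a, exists r e, r != 0 /\ phi r * a = P e.

Definition image_pred : {pred A} := [pred x | `[< exists f, s f = x >]].

Lemma image_predP x : x \in image_pred <-> exists f, s f = x.
Proof. by split=> [/asboolP|h]; [| apply/asboolP]. Qed.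

Lemma image_pred_subring : GRing.subring_closed image_pred.
Proof.
split=> [|x y|x y]; first by apply/image_predP; exists 1; rewrite rmorph1.
  move=> /image_predP[f <-] /image_predP[g <-]; apply/image_predP; exists (f - g).
  by rewrite rmorphB.
move=> /image_predP[f <-] /image_predP[g <-]; apply/image_predP; exists (f * g).
by rewrite rmorphM.
Qed.

Lemma exchanged_inj : injective s.
Proof.
apply: raddf_inj => f f0.
apply: (@s_free (fun i => if i == Ordinal D_gt0 then f else 0) _ (Ordinal D_gt0)).
  rewrite (bigD1 (Ordinal D_gt0)) //= f0 mul0r add0r big1 // => i /negbTE ->.
  by rewrite rmorph0 mul0r.
Qed.

(** [A] is finite over the image of [phi], which lies in the image of [P], which is finite over the
    image of [s]. *)
Lemma exchanged_fin : exists N' (b' : 'I_N' -> A), forall a, exists g : 'I_N' -> R,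
  a = \sum_j s (g j) * b' j.
Proof.
pose v (l : 'I_#|{: 'I_D * 'I_N}|) : 'I_D * 'I_N := enum_val l.
exists #|{: 'I_D * 'I_N}|, (fun l => t ^+ (v l).1 * b (v l).2) => a.
have [g ->] := phi_fin a.
have hg j : exists u : 'I_D -> R, phi (g j) = \sum_i s (u i) * t ^+ i.
  by have [e ->] := phi_P (g j); apply: s_span.
have [u hu] := choice hg; exists (fun l => u (v l).2 (v l).1).
pose F (p : 'I_D * 'I_N) := s (u p.2 p.1) * (t ^+ p.1 * b p.2).
transitivity (\sum_p F p); last exact: (@big_enum_val _ _ _ _ predT F).
rewrite -(pair_bigA _ (fun i j => F (i, j))) exchange_big; apply: eq_bigr => j _.
by rewrite hu mulr_suml; apply: eq_bigr => i _; rewrite /F mulrA.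
Qed.

Lemma exchanged_finite_over : finite_over image_pred.
Proof.
have [N' [b' hb]] := exchanged_fin; exists (codom b') => a; have [g ->] := hb a.
by apply: spanned_by_codom => i; apply/image_predP; exists (g i).
Qed.

Lemma poly_in_image (q : {poly R}) e : exists e', (map_poly s q).[P e] = P e'.
Proof.
elim/poly_ind: q => [|q c [e' IH]]; first by exists 0; rewrite !rmorph0 horner0.
have [e1 ec] := s_P c; exists (e' * e + e1).
rewrite [map_poly s _]rmorphD /= [map_poly s (q * _)]rmorphM /= map_polyX map_polyC hornerMXaddC.
by rewrite IH [RHS]rmorphD rmorphM /= ec.
Qed.

(** The fraction is first brought to the form P e1 / P e2 by way of [phi]. Its denominator is then
    multiplied into the image of [s] by a polynomial in P e2, a factor which stays in the image of
    [P], where the powers of [t] span. *)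
Lemma exchanged_frac_span (x : {fraction A}) :
  exists c : 'I_D -> {fraction A}, (forall i, c i \in subring_frac image_pred) /\
    x = \sum_i c i * tofrac t ^+ i.
Proof.
have [N' [b' hb]] := exchanged_fin; have [a [a' [na' ->]]] := fracP x.
have [a'' [r [nr er]]] := divides_base phi_fin na'.
have [r1 [e1 [nr1 er1]]] := P_frac (a * a''); have [e2 ee2] := phi_P (r1 * r).
have nz2 : P e2 != 0.
  by rewrite -ee2 -(rmorph0 phi) (inj_eq phi_inj) mulf_neq0.
have [q [r2 [nr2 eq]]] := divides_base_poly hb nz2.
have [e3 ee3] := poly_in_image q e2; have [g eg] := s_span (e1 * e3).
have ns2 : s r2 != 0 by rewrite -(rmorph0 s) (inj_eq exchanged_inj).
exists (fun i => tofrac (s (g i)) / tofrac (s r2)); split.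
  move=> i; apply/asboolP; exists (s (g i)), (s r2).
  by split=> //; apply/image_predP; [exists (g i) | exists r2].
transitivity (tofrac (P (e1 * e3)) / tofrac (s r2)).
  apply/eqP; rewrite eqr_div ?tofrac_eq0 // -!tofracM tofrac_eq; apply/eqP.
  by rewrite rmorphM /= -er1 -ee3 -eq -ee2 rmorphM /= -er; ring.
rewrite eg rmorph_sum mulr_suml; apply: eq_bigr => i _.
by rewrite /= tofracM tofracXn mulrAC.
Qed.

Lemma exchanged_frac_free (c : 'I_D -> {fraction A}) :
  (forall i, c i \in subring_frac image_pred) -> \sum_i c i * tofrac t ^+ i = 0 ->
  forall i, c i = 0.
Proof.
move=> cS e.
have cS' i : exists fg : R * R, fg.2 != 0 /\ c i = tofrac (s fg.1) / tofrac (s fg.2).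
  have /asboolP[a [a' [/image_predP[f <-] /image_predP[g <-] nz ->]]] := cS i.
  by exists (f, g); split=> //; apply: contraNneq nz => /= ->; rewrite rmorph0.
have [fg hfg] := choice cS'; pose Q i := \prod_(j | j != i) (fg j).2.
have Q0 i : Q i != 0 by apply/prodf_neq0 => j _; have [] := hfg j.
have snz i : tofrac (s (fg i).2) != 0 :> {fraction A}.
  by rewrite tofrac_eq0 -(rmorph0 s) (inj_eq exchanged_inj); have [] := hfg i.
have H := @s_free (fun i => (fg i).1 * Q i); have {}H : forall i, (fg i).1 * Q i = 0.
  apply: H; apply/eqP; rewrite -tofrac_eq0; apply/eqP.
  rewrite -[RHS](mulr0 (tofrac (s (\prod_j (fg j).2)))) -e mulr_sumr rmorph_sum.
  apply: eq_bigr => i _; have [_ ->] := hfg i.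
  rewrite /= tofracM tofracXn (bigD1 i) //= -/(Q i) !rmorphM /= [RHS]mulrA; congr (_ * _).
  by rewrite mulrC [X in _ = X * _]mulrC -mulrA [X in _ = _ * X]mulrC divfK.
move=> i; have [_ ->] := hfg i; have /eqP := H i.
by rewrite mulf_eq0 (negbTE (Q0 i)) orbF => /eqP ->; rewrite !rmorph0 mul0r.
Qed.

Lemma exchanged_degree : has_degree_over (subring_frac image_pred) D.
Proof.
exists (codom (fun i : 'I_D => (tofrac t : {fraction A}) ^+ i)); split.
- by rewrite size_codom card_ord.
- by move=> x; have [c [cS ->]] := exchanged_frac_span x; apply: spanned_by_codom.
- by apply: lin_indep_codom; apply: exchanged_frac_free.
Qed.

End ExchangedDegree.

Lemma mfpsX_exp_inj (k : comNzRingType) n (j : 'I_n) a b : mfpsX k j ^+ a = mfpsX k j ^+ b -> a = b.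
Proof.
rewrite !mfpsXn => /(congr1 (fun f => mfps_coef f (U_(j) *+ a)%MM)).
rewrite !mfps_coefXm eqxx; case: eqP => [e _|_ /eqP]; last by rewrite oner_eq0.
by have := congr1 (fun m : 'X_{1..n} => m j) e; rewrite !mulmnE mnm1E eqxx !mul1n.
Qed.

(** * Parameters whose polynomial stays separable on an axis, and the conclusion *)

Section Transport.
Variables (R A : idomainType) (phi phi' : {rmorphism R -> A}) (sg : {rmorphism R -> R}).
Hypotheses (sg_phi : forall r, phi (sg r) = phi' r) (sg_surj : forall r, exists r', sg r' = r).
Hypothesis phi'_inj : injective phi'.

Lemma transport_inj : injective sg.
Proof. by move=> r r' e; apply: phi'_inj; rewrite -!sg_phi e. Qed.

Lemma transport_poly (p : {poly R}) : exists p', map_poly sg p' = p.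
Proof.
have [g hg] := choice sg_surj; exists (\poly_(i < size p) g p`_i).
apply/polyP => i; rewrite coef_map coef_poly; case: ltnP => [_|le]; first exact: hg.
by rewrite [RHS]nth_default //; apply: rmorph0.
Qed.

Lemma transport_horner p x : (map_poly phi (map_poly sg p)).[x] = (map_poly phi' p).[x].
Proof. by congr (_.[_]); rewrite -map_poly_comp; apply: eq_map_poly. Qed.

Lemma transport_size (p : {poly R}) : size (map_poly sg p) = size p.
Proof. by apply: size_map_inj_poly; [apply: transport_inj | apply: rmorph0]. Qed.

Lemma transport_poly_inj : injective (map_poly sg).
Proof. by apply: map_inj_poly; [apply: transport_inj | apply: rmorph0]. Qed.

End Transport.

Section ParameterSystem.
Variables (k : closedFieldType) (A : idomainType) (L : local_alg k A) (d : nat).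
Hypotheses (noeth : noetherian_ring A) (dimA : has_krull_dim A d.+1).
Notation io := (la_io L).
Notation R := (mfps k d.+1).

(** The element [delta] attached to separable parameters may vanish on the last axis, but not on a
    suitable curve whose coordinates are powers of t. Straightening that curve into the axis changes
    the parameters, and all data are pulled back along [straight]. *)
Lemma good_parameters : exists (y : 'I_d.+1 -> A) (hy : forall i, L 1 (y i))
    (z : A) (f u v : {poly R}) (delta : R) (N : nat),
  let phi := ev io hy in
  [/\ sop L y, [/\ f \is monic, size f = N.+2 & (map_poly phi f).[z] = 0],
      forall p : {poly R}, (size p < size f)%N -> (map_poly phi p).[z] = 0 -> p = 0,
      forall a, exists r P, r != 0 /\ phi r * a = (map_poly phi P).[z]
    & u * f + v * f^`() = delta%:P /\ rho ord_max delta != 0].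
Proof.
have [y [hy [sy sepy]]] := separable_sop L noeth dimA (ltn0Sn d).
have y_inj := sop_inj noeth dimA (hy := hy) sy.
have [n [b phi_fin]] := sop_finite hy sy.
have [iota iotaE] := fracmap_exists y_inj.
have e_inj : injective (fun i => tofrac (mfpsX k (ord_max : 'I_d.+1) ^+ i)).
  by move=> i j /eqP; rewrite tofrac_eq => /eqP/mfpsX_exp_inj.
have [z [f [u [v [delta [[mf sf] fz fmin zgen [nd ed]]]]]]] :=
  primitive_integer y_inj phi_fin iotaE (sepy iota iotaE) e_inj.
have [e [e_max e_gt0 /(_ e_gt0) ce]] := curve_neq0 nd.
pose y' i := ev io hy (straight_pt k e i).
have hy' i : L 1 (y' i) by apply: ev_fil; apply: straight_pt_fil.
have sgE r : ev io hy (straight k e_gt0 r) = ev io hy' r.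
  apply: ev_comp => [M x|c|i]; [exact: ev_fil | exact: ev_C | by []].
have y'_max : y' ord_max = y ord_max by rewrite /y' /straight_pt eqxx ev_X.
have sy' : sop L y'.
  have [l hl] := sy; exists l => x /hl[c /eqP]; rewrite subr_eq0 => /eqP ex.
  have I0 := idgen_isid y' (isid0 A); rewrite ex; apply: (isid_sum _ I0) => i _.
  have [_ ID IM] := I0; rewrite mulrC; apply: (IM).
  have ymax : idgen y' (fun x => x = 0) (y ord_max) by rewrite -y'_max; apply: idgen_y (isid0 A).
  have [->//|ne] := eqVneq i ord_max.
  have -> : y i = y' i + y ord_max ^+ e i.
    by rewrite /y' /straight_pt (negbTE ne) rmorphB rmorphXn /= !ev_X subrK.
  apply: ID; first exact: idgen_y (isid0 A).
  by rewrite -(prednK (e_gt0 i)) exprSr; apply: IM.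
have y'_inj := sop_inj noeth dimA (hy := hy') sy'.
have sg_surj := @straight_surj k d e e_gt0.
have s_inj := transport_inj sgE y'_inj.
have tr := transport_poly sg_surj.
have [f' ef] := tr f; have [u' eu] := tr u; have [v' ev'] := tr v.
have [delta' edl] := sg_surj delta.
have sf' : size f' = size f by rewrite -ef (transport_size sgE y'_inj).
exists y', hy', z, f', u', v', delta', (size f).-2; split.
- exact: sy'.
- split; last by rewrite -(transport_horner sgE) ef; exact: fz.
    have := monicP mf; rewrite -ef lead_coef_map_inj ?rmorph0 // => e1.
    by apply/monicP/s_inj; rewrite e1 rmorph1.
  by rewrite sf'; case: (size f) sf => [|[]].
- move=> p; rewrite sf' -(transport_size sgE y'_inj p) -(transport_horner sgE) => sp /(fmin _ sp).
  by rewrite -[RHS](rmorph0 (map_poly (straight k e_gt0))) => /(transport_poly_inj sgE y'_inj).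
- move=> a; have [P eP] := zgen (tofrac a); have [r [P0 [nr eP0]]] := clear_denominators P.
  have [r' er] := sg_surj r; have [P' eP'] := tr P0; exists r', P'; split.
    by apply: contraNneq nr => r0; rewrite -er r0 rmorph0.
  rewrite -(transport_horner sgE) eP' -sgE er; apply/eqP; rewrite -tofrac_eq; apply/eqP.
  rewrite tofracM eP -iotaE -hornerZ -map_polyZ -eP0 -map_poly_comp -horner_map -map_poly_comp.
  by congr (_.[_]); apply: eq_map_poly => c; rewrite /= iotaE.
split; last by rewrite -(curve_straight e_max e_gt0) edl.
apply: (transport_poly_inj sgE y'_inj).
by rewrite rmorphD !rmorphM /= -deriv_map ef eu ev' ed map_polyC /= edl.
Qed.

End ParameterSystem.

Definition mfps_const (k : comNzRingType) n (f : mfps k n) : k := mfps_coef f 0%MM.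

Lemma mfps_const_zmod (k : comNzRingType) n : zmod_morphism (@mfps_const k n).
Proof. by []. Qed.

Lemma mfps_const_monoid (k : comNzRingType) n : monoid_morphism (@mfps_const k n).
Proof.
split=> [|f g]; first by rewrite /mfps_const mfps_coef1 eqxx.
rewrite /mfps_const -{1}[0%MM]addm0 mfps_coefM_unique // => a b.
by rewrite addm0 => /(congr1 (@mdeg n)); rewrite mdegD mdeg0 => /eqP;
   rewrite addn_eq0 !mdeg_eq0 => /andP[/eqP -> /eqP ->].
Qed.

HB.instance Definition _ (k : comNzRingType) n :=
  GRing.isZmodMorphism.Build (mfps k n) k (@mfps_const k n) (@mfps_const_zmod k n).
HB.instance Definition _ (k : comNzRingType) n :=
  GRing.isMonoidMorphism.Build (mfps k n) k (@mfps_const k n) (@mfps_const_monoid k n).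

Lemma const_axis_in (k : comNzRingType) n (j : 'I_n) (g : mfps k 1) : mfps_const (axis_in j g) = cf g 0.
Proof.
have := rho_coef j (axis_in j g) 0; rewrite axis_inK => ->.
by rewrite /mfps_const mulm0n.
Qed.

(** Modulo the maximal ideal the matrix is 0 and its characteristic polynomial is X^n. *)
Lemma char_poly_const (k : comNzRingType) d n (M : 'M[mfps k d]_n) i :
  (forall a b, mfps_const (M a b) = 0) -> (i < n)%N -> mfps_const (char_poly M)`_i = 0.
Proof.
move=> M0 lt; rewrite -coef_map map_char_poly.
have -> : map_mx (@mfps_const k d) M = 0 by apply/matrixP => a b; rewrite !mxE M0.
by rewrite /char_poly /char_poly_mx map_mx0 subr0 det_scalar coefXn ltn_eqF.
Qed.

Lemma horner_mx_const (k : comNzRingType) d n (C : 'M[mfps k d]_n.+1) (p : {poly mfps k d}) :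
  (forall i, mfps_const p`_i = 0) -> forall a b, mfps_const (horner_mx C p a b) = 0.
Proof.
move=> p0 a b; have := map_horner_mx (@mfps_const k d) C p.
have -> : map_poly (@mfps_const k d) p = 0 by apply/polyP => i; rewrite coef_map coef0 /= p0.
by rewrite rmorph0 => /matrixP/(_ a b); rewrite !mxE.
Qed.

Lemma horner_mx_addX (R : comNzRingType) n (C : 'M[R]_n.+1) (p : {poly R}) c :
  horner_mx C (p + c%:P * 'X) = horner_mx C p + c *: C.
Proof. by rewrite rmorphD rmorphM /= horner_mx_X horner_mx_C -mulmxE mul_scalar_mx. Qed.

Lemma cf_sign (k : comNzRingType) n (f : mfps k 1) i : cf ((-1) ^+ n * f) i = (-1) ^+ n * cf f i.
Proof.
elim: n f => [|n IH] f; first by rewrite !expr0 !mul1r.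
by rewrite !exprSr -!mulrA IH !mulN1r /cf mfps_coefN.
Qed.

Lemma nm_perturb_cf (k : comNzRingType) n (f h : {poly mfps k 1}) M i : (i < M)%N ->
  cf (nm n f (h + (tO ^+ M)%:P * 'X)) i = cf (nm n f h) i.
Proof.
move=> lt; pose I (x : mfps k 1) := exists q, x = tO ^+ M * q.
have [|||a b|q eq] := @idl_cg_det _ I _ _ _ _ (horner_mx (cmpx n f) (h + (tO ^+ M)%:P * 'X))
  (horner_mx (cmpx n f) h).
- by exists 0; rewrite mulr0.
- by move=> x y [q ->] [r ->]; exists (q + r); rewrite mulrDr.
- by move=> a x [q ->]; exists (a * q); rewrite mulrCA.
- by rewrite horner_mx_addX; eexists; rewrite mxE addrAC subrr add0r mxE.
have -> : nm n f (h + (tO ^+ M)%:P * 'X) = nm n f h + tO ^+ M * q by rewrite -eq /nm addrCA subrr addr0.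
by rewrite cf_D cf_tM leqNgt lt addr0.
Qed.

Lemma map_bezout_deriv (R S : comNzRingType) (g : {rmorphism R -> S}) (f u v : {poly R}) c :
  u * f + v * f^`() = c%:P ->
  map_poly g u * map_poly g f + map_poly g v * (map_poly g f)^`() = (g c)%:P.
Proof. by move=> e; rewrite deriv_map -!rmorphM -rmorphD e /= map_polyC. Qed.

Theorem theorem2p7 (A : idomainType) (m : {pred A}) (k : closedFieldType)
    (pi : {rmorphism A -> k}) (d : nat)
    (A_noetherian : noetherian_ring A)
    (A_local : local_ring_with m)
    (k_residue : is_residue_field m pi)
    (A_complete : adic_complete m)
    (A_equichar : equicharacteristic A k)
    (A_dim : has_krull_dim A d)
    (d_gt0 : (0 < d)%N)
    (p : nat) (p_prime : prime p) :
  exists R : {pred A},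
    [/\ power_series_subring k d R,
        finite_over R
      & exists n : nat,
          has_degree_over (subring_frac R) n /\ coprime p n].
Proof.
have [L _] := local_alg_exists A_noetherian A_local k_residue A_complete A_equichar.
case: d A_dim d_gt0 => // d dimA _.
have [y [hy [z [f [u [v [delta [N [sy [mf sf fz] fmin prim [ed rd]]]]]]]]]] :=
  good_parameters L A_noetherian dimA.
have phi_inj : injective (ev (la_io L) hy) := sop_inj A_noetherian dimA (hy := hy) sy.
have [n0 [b phi_fin]] := sop_finite hy sy.
pose rh : {rmorphism mfps k d.+1 -> mfps k 1} := rho ord_max.
have mfb : map_poly rh f \is monic by apply: monic_map.
have sfb : size (map_poly rh f) = N.+2.
  by rewrite size_map_poly_id0; [exact: sf | rewrite (monicP mf) rmorph1; exact: oner_neq0].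
have edb : map_poly rh u * map_poly rh f + map_poly rh v * (map_poly rh f)^`() = (rh delta)%:P.
  exact: map_bezout_deriv.
have [hb [D [w [hb0 D_gt0 coD w0 ehb]]]] := coprime_order mfb sfb rd edb p_prime.
(* The coefficients involve t alone, so restriction to the axis gives back [hb]. *)
pose h0 : {poly mfps k d.+1} := map_poly (axis_in ord_max) hb.
pose tR : mfps k d.+1 := mfpsX k ord_max.
(* The lift need not generate the fraction field; adding a large power of t times X makes its powers
   independent. As M exceeds D, the coefficients of the norm on the axis are unchanged up to order
   D. *)
have [||M leM nzK] := @krylov_perturb_domain _ N f (horner_mx (cmpx N f) h0) tR D.+1.
- apply/eqP => t0; suff /mfpsX_exp_inj : tR ^+ 1 = tR ^+ 2 by [].
  by rewrite t0 !expr0n.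
- by move=> i j /mfpsX_exp_inj.
pose hM := h0 + (tR ^+ M)%:P * 'X; rewrite -horner_mx_addX -/hM in nzK.
set H := horner_mx (cmpx N f) hM in nzK.
have M_gt0 : (0 < M)%N by apply: leq_trans leM.
(* All coefficients lie in the maximal ideal; hence so does [h], and the characteristic polynomial
   of [H] is distinguished. *)
have hM0 i : mfps_const hM`_i = 0.
  rewrite coefD coefCM rmorphD rmorphM rmorphXn /= coef_map const_axis_in hb0 add0r.
  by rewrite /mfps_const mfps_coefXm eq_sym -mdeg_eq0 mdeg1 /= expr0n gtn_eqF ?mul0r.
have H0 := horner_mx_const (cmpx N f) hM0.
pose h := (map_poly (ev (la_io L) hy) hM).[z].
have h_fil : L 1 h.
  rewrite /h horner_coef; apply: fil_sum => i _; apply: filMr; rewrite coef_map.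
  by apply: ev_fil; apply: mord1P; apply: hM0.
have chi0 i : cf (rh (char_poly H)`_0) i = (-1) ^+ N.+1 * cf (nm N (map_poly rh f) (map_poly rh hM)) i.
  by rewrite char_poly_det rmorphM rmorphXn rmorphN1 cf_sign -map_nm.
have rhM : map_poly rh hM = hb + (tO ^+ M)%:P * 'X.
  rewrite rmorphD rmorphM /= map_polyX map_polyC /= rmorphXn /= /tR rho_T; congr (_ + _).
  by rewrite -map_poly_comp map_poly_id // => x _; apply: axis_inK.
have chi_lt i : (i < D)%N -> cf (rh (char_poly H)`_0) i = 0.
  move=> lt; rewrite chi0 rhM nm_perturb_cf; last by apply: ltn_trans lt _.
  by rewrite ehb cf_tM leqNgt lt mulr0.
have chi_D : cf (rh (char_poly H)`_0) D != 0.
  by rewrite chi0 rhM nm_perturb_cf // ehb cf_tM leqnn subnn mulf_neq0 // signr_eq0.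
have [P [s [phi_P [eh ehP] s_P s_span s_free]]] := parameter_exchange
  (char_poly_monic H) (size_char_poly H) (fun i => char_poly_const (i := i) H0) chi_lt chi_D
  h_fil (generator_root mf sf fz hM) (generator_free mf sf fz fmin nzK).
(* [prim] and [generator_span] express a multiple of [a] by powers of [h] over the series in [y],
   and such combinations lie in the image of [P]. *)
have P_frac a : exists r e, r != 0 /\ (ev (la_io L) hy) r * a = P e.
  have [r [Q [nr eQ]]] := prim a; have [g eg] := generator_span mf sf fz hM Q.
  have [c hc] := choice phi_P.
  exists (\det (krylov H) * r), (\sum_i c (g i) * eh ^+ i); split; first by rewrite mulf_neq0.
  rewrite rmorphM -mulrA eQ eg [RHS]rmorph_sum; apply: eq_bigr => i _.
  by rewrite /= [RHS]rmorphM rmorphXn /= -hc -ehP.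
exists (image_pred s); split.
- split; first exact: image_pred_subring.
  exists s; split; first exact: exchanged_inj D_gt0 s_free.
  exact: image_predP.
- exact: exchanged_finite_over phi_fin phi_P s_span.
exists D; split; last exact: coD.
apply: (exchanged_degree phi_inj D_gt0 phi_fin phi_P s_P s_span s_free); exact: P_frac.
Qed.
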